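(* Let $c>0$, let $\phi\in\Phi_c$ with constant $\kappa_\phi\in(0,1)$, let $m\ge2$ be an integer, and let $\widetilde E\subseteq[0,1]$ be a compact set. Assume that there exists $\delta>0$ such that for every $0\le j<k\le m-1$ and every $\xi\in\widetilde E$ $$\left|\widehat\phi_p\left(\tfrac{2c}{m}(\xi+j)\right)-\widehat\phi_p\left(\tfrac{2c}{m}(\xi+k)\right)\right|\ge\delta.$$ Let $E=\left(\frac{2c}{m}(\widetilde E+\mathbb{Z})\right)\cap[-c,c]$. Then for any $f\in PW_c$ the function $\widehat f\,\mathbf 1_E$ can be recovered in a stable way from the samples $\left\{f_t\left(\frac{m\pi}{c}k\right):k\in\mathbb{Z},\ 0\le t\le1\right\}$. Moreover, for all $f\in PW_c$, $$A\,\|\widehat f\,\mathbf 1_E\|_2^2\le\int_0^1\sum_{k\in\mathbb{Z}}\left|f_t\left(\tfrac{m\pi}{c}k\right)\right|^2\mathrm{d}t\le\frac{c}{2\pi^2}\|\widehat f\|_2^2,$$ where $$A=\frac{c}{4e\pi^2}\,\frac{\delta^{m(m-1)}}{m^{1+m^2}}\,\frac{\kappa_\phi^{2/m}-1}{\ln\kappa_\phi}.$$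
   Context: The Fourier transform is $\widehat f(\xi)=\int_{\mathbb{R}}f(x)e^{-ix\xi}\,\mathrm{d}x$, and $PW_c=\{f\in L^2(\mathbb{R}):\operatorname{supp}\widehat f\subseteq[-c,c]\}$ (elements identified with continuous representatives). The class of kernels is $$\Phi_c=\{\phi\in L^1(\mathbb{R}):\ \exists\,\kappa_\phi>0 \text{ with } \kappa_\phi\le\widehat\phi(\xi)\le 1 \text{ for } |\xi|\le c,\ \widehat\phi(0)=1\}.$$ For $f\in PW_c$, $t\ge0$, $f_t\in PW_c$ is defined by $\widehat{f_t}(\xi)=\widehat f(\xi)\widehat\phi(\xi)^t$. $\widehat\phi_p$ is the $2c$-periodization of $\widehat\phi|_{[-c,c)}$: $\widehat\phi_p(x)=\sum_{k\in\mathbb{Z}}\widehat\phi(x-2ck)\mathbf 1_{[-c,c)}(x-2ck)$. $\mathbf 1_E$ is the characteristic function of $E$. ''$\widehat f\,\mathbf 1_E$ can be recovered in a stable way'' means that there is a constant $A'>0$ with $A'\|\widehat f\,\mathbf 1_E\|_2^2\le\int_0^1\sum_{k}|f_t(\frac{m\pi}{c}k)|^2\,\mathrm{d}t$ for all $f\in PW_c$. *)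

(* Defs.v *)
From HB Require Import structures.
From mathcomp Require Export all_boot all_order all_algebra.
From mathcomp Require Export complex.
From mathcomp Require Export all_classical all_reals all_analysis.
Export Order.TTheory GRing.Theory Num.Theory.
Export numFieldNormedType.Exports.

Set Implicit Arguments.
Unset Strict Implicit.
Unset Printing Implicit Defensive.

Local Open Scope classical_set_scope.
Local Open Scope ring_scope.
Local Open Scope complex_scope.

Section FourierTransform.
Context {R : realType}.
Implicit Types (f g phi : R -> R[i]) (D E : set R) (c t : R).

Local Notation mu := (@lebesgue_measure R).

(* e^{i theta} *)
Definition cis (theta : R) : R[i] := cos theta +i* sin theta.

(* The library integrates (extended) real functions only, so complex-valued
   functions are handled through their real and imaginary parts. *)
Definition cmeasurable f : Prop :=
  measurable_fun [set: R] (fun x => complex.Re (f x)) /\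
  measurable_fun [set: R] (fun x => complex.Im (f x)).

Definition cintegrable f : Prop :=
  mu.-integrable [set: R] (EFin \o (fun x => complex.Re (f x))) /\
  mu.-integrable [set: R] (EFin \o (fun x => complex.Im (f x))).

Definition cintegral D f : R[i] :=
  (\int[mu]_(x in D) complex.Re (f x)) +i* (\int[mu]_(x in D) complex.Im (f x)).

Definition ccontinuous f : Prop :=
  continuous (fun x => complex.Re (f x)) /\
  continuous (fun x => complex.Im (f x)).

Definition norm2 f : \bar R :=
  Lnorm mu 2%:E (fun x => (Normc.normc (f x))%:E).

Definition L2 f : Prop := cmeasurable f /\ (norm2 f < +oo)%E.

(* Fourier transform of an integrable function. *)
Definition fourier phi (xi : R) : R[i] :=
  cintegral [set: R] (fun x => phi x * cis (- (x * xi))).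

(* g is (a representative of) the Fourier-Plancherel transform of f in L^2:
   the limit in L^2 of the transforms of the truncations of f to [-n, n]. *)
Definition is_fourier2 f g : Prop :=
  [/\ L2 f, L2 g &
    (fun n : nat => norm2 (fun xi =>
       g xi - cintegral `[- n%:R, n%:R] (fun x => f x * cis (- (x * xi)))))
      @ \oo --> 0%E].

(* Paley-Wiener space, elements being continuous representatives; the support
   of an L^2 function lies in the closed set [-c, c] iff the function vanishes
   almost everywhere outside it. *)
Definition PW c f : Prop :=
  [/\ L2 f, ccontinuous f &
    exists2 g, is_fourier2 f g & {ae mu, forall xi, ~ (`|xi| <= c) -> g xi = 0}].

(* The order of R[i] relates only numbers with equal imaginary parts, so this
   includes that the transform of phi is real on [-c, c]. *)
Definition kernel_bound c phi (kappa : R) : Prop :=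
  forall xi : R, `|xi| <= c -> kappa%:C <= fourier phi xi <= 1.

Definition Phi c phi : Prop :=
  [/\ cintegrable phi, exists2 kappa, 0 < kappa & kernel_bound c phi kappa
    & fourier phi 0 = 1].

(* ft t is f_t, fhat being the transform of f.  The transform of phi is a
   positive real on [-c, c], outside which fhat vanishes almost everywhere, so
   the exponentiation is that of positive reals wherever its value matters. *)
Definition is_flow c phi (fhat : R -> R[i]) (ft : R -> R -> R[i]) : Prop :=
  forall t, 0 <= t ->
    PW c (ft t) /\
    is_fourier2 (ft t) (fun xi => fhat xi * (complex.Re (fourier phi xi) `^ t)%:C).

(* 2c-periodization of the restriction of the transform of phi to [-c, c);
   exactly one term of the sum has a nonzero indicator. *)
Definition phat_p c phi (x : R) : R[i] :=
  \sum_(k \in [set: int])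
     fourier phi (x - 2 * c * k%:~R) * (\1_(`[- c, c[) (x - 2 * c * k%:~R))%:C.

Definition restr E (g : R -> R[i]) : R -> R[i] := fun xi => g xi * (\1_E xi)%:C.

Definition sample_energy c (m : nat) (ft : R -> R -> R[i]) : \bar R :=
  (\int[mu]_(t in `[0%R, 1%R])
     esum [set: int] (fun k : int =>
       (Normc.normc (ft t (m%:R * pi / c * k%:~R)%R) ^+ 2)%:E))%E.

Definition stably_recoverable c (m : nat) phi E : Prop :=
  exists2 A' : R, 0 < A' &
    forall f fhat ft, PW c f -> is_fourier2 f fhat -> is_flow c phi fhat ft ->
      (A'%:E * norm2 (restr E fhat) ^+ 2 <= sample_energy c m ft)%E.

Definition lifted_set c (m : nat) (Et : set R) : set R :=
  [set x | exists2 y, Et y & exists k : int, x = 2 * c / m%:R * (y + k%:~R)]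
    `&` `[- c, c].

End FourierTransform.

(* Main.v *)
(* The samples of f_t at the points m pi k / c are the Fourier coefficients, on an
   interval I of length L = 2c/m, of the folded spectrum
   u |-> sum_(j < m) fhat (u + j L) * phihat (u + j L) ^ t, so by Parseval their
   energy is a multiple of the integral over I of the squared modulus of this sum.
   The upper bound is then Cauchy-Schwarz.  For the lower bound, group the times
   t, t + 1/m, ..., t + (m-1)/m: for u fixed they give a Vandermonde system with
   nodes phihat (u + j L) ^ (1/m), which are separated by delta / m when u + j L
   meets E; integrating over t in [0, 1/m] concludes.

   Parseval is obtained from the Fejer kernel K_n, since the defect between n times
   the energy of G and its n-th Fejer sum is a double integral of
   (G x - G y) ^ 2 * K_n (x - y), hence nonnegative, and negligible for continuous G.
   Pointwise inversion follows from the L^2 definition of the transform by pairing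
   with e^{-e|y|}, whose transform is the Poisson kernel. *)

From HB Require Import structures.
Require Import Defs.
From mathcomp Require Import measurable_realfun ring lra zify.

Set Implicit Arguments.
Unset Strict Implicit.
Unset Printing Implicit Defensive.

Local Open Scope classical_set_scope.
Local Open Scope ring_scope.

(** * Vandermonde systems *)

(** The time step [1 / m] keeps all [m] grouped times inside [[0, 1]]; its price is that the nodes
    are [m]-th roots, whose gaps shrink from [delta] to [delta / m]. Interpolation at these nodes
    gives the constant [(delta / m) ^+ (2 * m.-1) / (m * 4 ^+ m.-1)]. Since the bounds on the symbol
    force [delta <= 1], it is at least [delta ^+ (m * (m - 1)) / (expR 1 * m ^+ (m ^ 2))], where
    [expR 1] serves only as a number above 2. The weights lose [kappa ^ (2 t)], whose integral over
    [[0, 1 / m]] is [(kappa ^ (2 / m) - 1) / (2 * ln kappa)]. The remaining factors are [L] from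
    Parseval and [1 / (4 pi ^ 2)] from inversion. Samples are point values, on which an [L^2] limit
    says nothing. The factor [e^{-e|y|}] is both integrable and square integrable, so Fubini applies
    to truncations and the pairing survives the [L^2] limit. As [e] tends to 0, continuity at the
    sample point handles the Poisson side and band limitation the frequency side. The cut of the
    periodization at [[-c, c)] gives separation only for [u] in a half-open interval. *)

Lemma sum_norm_coef_prod_XsubC (F : realFieldType) (s : seq F) (n : nat) :
  all (fun a => `|a| <= 1) s ->
  \sum_(l < n) `|(\prod_(a <- s) ('X - a%:P))`_l| <= 2 ^+ size s.
Proof.
elim: s n => [|a s IH] n /=.
  move=> _; rewrite big_nil expr0; case: n => [|n]; first by rewrite big_ord0.
  rewrite big_ord_recl coef1 eqxx normr1 big1 ?addr0// => i _.
  by rewrite coef1 lift0 normr0.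
(* Multiplying by ['X - a%:P] with [|a| <= 1] at most doubles the sum of absolute coefficients: the
   shift [p * 'X] and the multiple [a *: p] cost one copy each. *)
move=> /andP[a1 hs]; rewrite big_cons; set p := \prod_(_ <- _) _ in IH *.
have -> : ('X - a%:P) * p = p * 'X - a *: p.
  by rewrite mulrBl mul_polyC commr_polyX.
apply: (@le_trans _ _ (\sum_(l < n) (`|(p * 'X)`_l| + `|p`_l|))).
  apply: ler_sum => l _; rewrite coefB coefZ (le_trans (ler_normB _ _))// lerD2l.
  by rewrite normrM ler_piMl.
rewrite big_split/= exprS (_ : 2 = 1 + 1)// mulrDl !mul1r lerD ?IH//.
case: n => [|n]; first by rewrite big_ord0 exprn_ge0.
rewrite big_ord_recl coefMX eqxx normr0 add0r.
by under eq_bigr do rewrite coefMX lift0/=; exact: IH.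
Qed.

(* Lagrange interpolation: the coefficients of [prod_(k != j) ('X - x k)] combine
   the power sums into [w j * prod_(k != j) (x j - x k)]. *)
Lemma vandermonde_lower_bound (F : rcfType) (m : nat) (x w : 'I_m -> F) (d : F) :
  0 <= d -> (forall j, 0 <= x j <= 1) ->
  (forall j k, j != k -> d <= `|x j - x k|) ->
  d ^+ (2 * m.-1) * \sum_j w j ^+ 2 <=
  m%:R * 4 ^+ m.-1 * \sum_(l < m) (\sum_j w j * x j ^+ l) ^+ 2.
Proof.
move=> d0 x01 sep; pose y l := \sum_j w j * x j ^+ l.
pose Y := \sum_(l < m) y l ^+ 2.
have Y0 : 0 <= Y by apply: sumr_ge0 => l _; exact: sqr_ge0.
have key j : d ^+ (2 * m.-1) * w j ^+ 2 <= 4 ^+ m.-1 * Y.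
  pose r := [seq k <- index_enum 'I_m | k != j].
  have szr : size r = m.-1.
    rewrite size_filter -sum1_count sum1_card; have := cardC1 j.
    by rewrite card_ord => <-; apply: eq_card => k; rewrite !inE.
  pose p : {poly F} := \prod_(k <- r) ('X - (x k)%:P).
  have m0 : (0 < m)%N by exact: leq_ltn_trans (ltn_ord j).
  have szp : size p = m by rewrite /p size_prod_XsubC szr prednK.
  have pj k : k != j -> p.[x k] = 0.
    move=> kj; rewrite horner_prod big_filter (bigD1 k)//=.
    by rewrite hornerXsubC subrr mul0r.
  (* Exchanging the sums evaluates [p] at every node, and [p] vanishes at all of them except
     [x j]. *)
  have E : \sum_(l < m) p`_l * y l = w j * p.[x j].
    transitivity (\sum_k w k * p.[x k]).
      under eq_bigr do rewrite /y mulr_sumr.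
      rewrite exchange_big/=; apply: eq_bigr => k _.
      by rewrite horner_coef szp mulr_sumr; apply: eq_bigr => l _; ring.
    by rewrite (bigD1 j)//= big1 ?addr0// => k kj; rewrite pj// mulr0.
  have dp : d ^+ m.-1 <= `|p.[x j]|.
    rewrite horner_prod normr_prod -szr.
    have : {in r, forall k, k != j} by move=> k; rewrite mem_filter => /andP[].
    elim: (r) => [|k s IH] rj; first by rewrite big_nil.
    rewrite big_cons exprS ler_pM ?exprn_ge0//; last first.
      by apply: IH => i si; apply: rj; rewrite inE si orbT.
    by rewrite hornerXsubC sep// eq_sym rj// mem_head.
  (* Each [|y l|] is at most [Num.sqrt Y], and the coefficients of [p] have absolute sum at most
     [2 ^+ m.-1] because the nodes lie in [[0, 1]]. *)
  have ub : `|w j * p.[x j]| <= 2 ^+ m.-1 * Num.sqrt Y.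
    rewrite -E (le_trans (ler_norm_sum _ _ _))//.
    apply: (@le_trans _ _ (\sum_(l < m) `|p`_l| * Num.sqrt Y)).
      apply: ler_sum => l _; rewrite normrM ler_wpM2l//.
      rewrite -sqrtr_sqr ler_sqrt// /Y (bigD1 l)//= lerDl.
      by apply: sumr_ge0 => *; exact: sqr_ge0.
    rewrite -mulr_suml ler_wpM2r ?sqrtr_ge0//.
    have -> : p = \prod_(a <- [seq x k | k <- r]) ('X - a%:P) by rewrite big_map.
    rewrite -szr -(size_map x); apply: sum_norm_coef_prod_XsubC.
    by apply/allP => _ /mapP[k _ ->]; have /andP[? ?] := x01 k; rewrite ger0_norm.
  have h : d ^+ m.-1 * `|w j| <= 2 ^+ m.-1 * Num.sqrt Y.
    by apply: le_trans ub; rewrite normrM mulrC ler_wpM2l.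
  have := @lerXn2r _ 2 _ _ _ _ h.
  rewrite !nnegrE !mulr_ge0 ?exprn_ge0 ?sqrtr_ge0// => /(_ isT isT).
  rewrite !exprMn sqr_sqrtr// real_normK ?num_real// mulnC exprM.
  by rewrite (_ : 4 = 2 ^+ 2) ?[(2 ^+ 2) ^+ _]exprAC//; ring.
rewrite mulr_sumr (le_trans (ler_sum _ (fun j _ => key j)))//.
by rewrite sumr_const card_ord -mulrA mulr_natl.
Qed.

(** [x ^+ m - y ^+ m] is [x - y] times a sum of [m] monomials, each at most 1 on [[0, 1]]. This
    carries a gap [delta] between symbol values to a gap [delta / m] between their [m]-th roots. *)
Lemma norm_subX_le (F : realFieldType) (m : nat) (x y : F) :
  0 <= x <= 1 -> 0 <= y <= 1 -> `|x ^+ m - y ^+ m| <= m%:R * `|x - y|.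
Proof.
move=> /andP[x0 x1] /andP[y0 y1]; rewrite subrXX normrM mulrC ler_wpM2r//.
rewrite ger0_norm; last first.
  by apply: sumr_ge0 => i _; rewrite mulr_ge0// exprn_ge0.
rewrite -[m in _ <= m%:R]card_ord -sumr_const; apply: ler_sum => i _.
by rewrite mulr_ile1 ?exprn_ge0// exprn_ile1.
Qed.

(** Trades the constant of the interpolation argument for the one in the theorem, with [e] standing
    for [expR 1]. The power of [d] may be raised because [d <= 1]; the powers of [m] are compared
    through [m ^ 2 = 2 * m.-1 + 1 + m.-1 ^ 2]. *)
Lemma vandermonde_const (F : realFieldType) (m : nat) (d e : F) :
  (2 <= m)%N -> 0 <= d -> d <= 1 -> 2 <= e ->
  m%:R * 4 ^+ m.-1 * (d ^+ (m * (m - 1)) / (e * m%:R ^+ (m ^ 2))) <=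
  (d / m%:R) ^+ (2 * m.-1).
Proof.
move=> m2 d0 d1 e2.
have m0 : 0 < m%:R :> F by rewrite ltr0n; lia.
have e0 : 0 < e by lra.
rewrite exprMn exprVn mulrA [_ * d ^+ _]mulrC -mulrA ler_pM//.
- exact: exprn_ge0.
- by rewrite divr_ge0 ?mulr_ge0 ?exprn_ge0 ?ltW.
- by apply: ler_wiXn2l => //; nia.
rewrite ler_pdivrMr ?mulr_gt0 ?exprn_gt0// [leRHS]mulrC ler_pdivlMr ?exprn_gt0//.
have -> : (m ^ 2 = 2 * m.-1 + 1 + m.-1 ^ 2)%N by nia.
rewrite 2!exprD expr1.
suff h : 4 ^+ m.-1 <= e * m%:R ^+ (m.-1 ^ 2).
  have := ler_wpM2l (ltW (mulr_gt0 m0 (exprn_gt0 (2 * m.-1) m0))) h.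
  by congr (_ <= _); ring.
apply: (@le_trans _ _ (2 * m%:R ^+ (m.-1 ^ 2))); last first.
  by rewrite ler_wpM2r ?exprn_ge0// ltW.
(* For [m = 2] the claim is [4 <= 2 * 2], the only case that uses up the factor 2; from 3 on,
   [4 <= m ^+ 2 <= m ^+ m.-1] suffices. *)
case: m m2 {m0} => [|[|[|m]]]// _; first by rewrite /= expr1; lra.
apply: (@le_trans _ _ (m.+3%:R ^+ (m.+2 ^ 2))); last first.
  by rewrite ler_peMl ?exprn_ge0//; lra.
rewrite (_ : (m.+2 ^ 2 = m.+2 * m.+2)%N)//= exprM lerXn2r ?nnegrE ?exprn_ge0//.
apply: (@le_trans _ _ (m.+3%:R ^+ 2)).
  by rewrite -natrX (ler_nat _ 4); nia.
by rewrite ler_weXn2l// ler1n.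
Qed.

(** * Integrable real functions and the Fejer kernel *)

Section RealIntegrable.
Context d (T : measurableType d) (R : realType) (mu : {measure set T -> \bar R}).
Variables (D : set T) (mD : measurable D).
Implicit Types f g h : T -> R.

Lemma Rintegrable_measurable f :
  mu.-integrable D (EFin \o f) -> measurable_fun D f.
Proof. by move=> /(measurable_int mu)/measurable_EFinP. Qed.

Lemma eq_Rintegrable f g : (forall x, D x -> f x = g x) ->
  mu.-integrable D (EFin \o f) -> mu.-integrable D (EFin \o g).
Proof.
by move=> fg; apply: eq_integrable => // x /set_mem Dx; rewrite /= fg.
Qed.

Lemma RintegrableD f g : mu.-integrable D (EFin \o f) ->
  mu.-integrable D (EFin \o g) -> mu.-integrable D (EFin \o (fun x => f x + g x)).
Proof. by move=> hf hg; apply: (eq_integrable mD _ _ _ (integrableD mD hf hg)). Qed.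

Lemma RintegrableB f g : mu.-integrable D (EFin \o f) ->
  mu.-integrable D (EFin \o g) -> mu.-integrable D (EFin \o (fun x => f x - g x)).
Proof. by move=> hf hg; apply: (eq_integrable mD _ _ _ (integrableB mD hf hg)). Qed.

Lemma RintegrableZl (k : R) f : mu.-integrable D (EFin \o f) ->
  mu.-integrable D (EFin \o (fun x => k * f x)).
Proof. by move=> hf; apply: (eq_integrable mD _ _ _ (integrableZl mD k hf)). Qed.

Lemma Rintegrable_sum I (s : seq I) (F : I -> T -> R) :
  (forall i, mu.-integrable D (EFin \o F i)) ->
  mu.-integrable D (EFin \o (fun x => \sum_(i <- s) F i x)).
Proof.
move=> hF; elim: s => [|i s IH].
  by apply: (@eq_Rintegrable (fun=> 0)) => [x _|]; [rewrite big_nil|exact: integrable0].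
by apply: (eq_Rintegrable _ (RintegrableD (hF i) IH)) => x _; rewrite big_cons.
Qed.

Lemma Rintegral_sum I (s : seq I) (F : I -> T -> R) :
  (forall i, mu.-integrable D (EFin \o F i)) ->
  \int[mu]_(x in D) (\sum_(i <- s) F i x) =
  \sum_(i <- s) \int[mu]_(x in D) F i x.
Proof.
move=> hF; elim: s => [|i s IH].
  rewrite big_nil; under eq_Rintegral do rewrite big_nil.
  by rewrite Rintegral_cst// mul0r.
rewrite big_cons -IH -RintegralD//; last exact: Rintegrable_sum.
by apply: eq_Rintegral => x _; rewrite big_cons.
Qed.

Lemma le_Rintegrable f g : measurable_fun D f ->
  (forall x, D x -> `|f x| <= g x) -> mu.-integrable D (EFin \o g) ->
  mu.-integrable D (EFin \o f).
Proof.
move=> mf fg hg; apply: (le_integrable mD _ _ hg); first exact/measurable_EFinP.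
by move=> x Dx; rewrite /= lee_fin (le_trans (fg _ Dx))// ler_norm.
Qed.

Lemma RintegrableMb f h (M : R) : mu.-integrable D (EFin \o f) ->
  measurable_fun D h -> (forall x, D x -> `|h x| <= M) ->
  mu.-integrable D (EFin \o (fun x => f x * h x)).
Proof.
move=> hf mh hM; apply: (@le_Rintegrable _ (fun x => M * `|f x|)).
- by apply: measurable_funM => //; exact: Rintegrable_measurable.
- by move=> x Dx; rewrite normrM mulrC ler_wpM2r// hM.
- apply: RintegrableZl.
  exact: (eq_integrable mD _ _ _ (integrable_abse hf)).
Qed.

Lemma RintegrableM f g : measurable_fun D f -> measurable_fun D g ->
  mu.-integrable D (EFin \o (fun x => f x ^+ 2)) ->
  mu.-integrable D (EFin \o (fun x => g x ^+ 2)) ->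
  mu.-integrable D (EFin \o (fun x => f x * g x)).
Proof.
move=> mf mg hf hg.
apply: (@le_Rintegrable _ (fun x => 2^-1 * (f x ^+ 2 + g x ^+ 2))).
- exact: measurable_funM.
- move=> x _; rewrite normrM.
  have := sqr_ge0 (`|f x| - `|g x|); rewrite sqrrB !real_normK ?num_real//.
  by lra.
- by apply: RintegrableZl; exact: RintegrableD.
Qed.

Lemma Rintegrable_sqrD f g : measurable_fun D f -> measurable_fun D g ->
  mu.-integrable D (EFin \o (fun x => f x ^+ 2)) ->
  mu.-integrable D (EFin \o (fun x => g x ^+ 2)) ->
  mu.-integrable D (EFin \o (fun x => (f x + g x) ^+ 2)).
Proof.
move=> mf mg hf hg; have hfg := RintegrableM mf mg hf hg.
apply: (eq_Rintegrable _ (RintegrableD (RintegrableD hf (RintegrableZl 2 hfg)) hg)).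
by move=> x _; ring.
Qed.

Lemma Rintegrable_sqrB f g : measurable_fun D f -> measurable_fun D g ->
  mu.-integrable D (EFin \o (fun x => f x ^+ 2)) ->
  mu.-integrable D (EFin \o (fun x => g x ^+ 2)) ->
  mu.-integrable D (EFin \o (fun x => (f x - g x) ^+ 2)).
Proof.
move=> mf mg hf hg; have hfg := RintegrableM mf mg hf hg.
apply: (eq_Rintegrable _ (RintegrableD (RintegrableB hf (RintegrableZl 2 hfg)) hg)).
by move=> x _; ring.
Qed.

Lemma Rintegrable_cst (k : R) : (mu D < +oo)%E ->
  mu.-integrable D (EFin \o (fun=> k)).
Proof.
move=> Doo; apply/integrableP; split; first by apply/measurable_EFinP; exact: measurable_cst.
rewrite (eq_integral (cst `|k|%:E))//.
rewrite integral_cst// lte_mul_pinfty//.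
Qed.

(** On a set of finite measure, [|f| <= 1 + f ^ 2] makes square integrable functions integrable. *)
Lemma Rintegrable_sqr f : (mu D < +oo)%E -> measurable_fun D f ->
  mu.-integrable D (EFin \o (fun x => f x ^+ 2)) -> mu.-integrable D (EFin \o f).
Proof.
move=> Doo mf hf.
apply: (@le_Rintegrable _ (fun x => 1 + f x ^+ 2)) => //.
  move=> x _; have := sqr_ge0 (`|f x| - 1); rewrite sqrrB real_normK ?num_real//.
  by have := sqr_ge0 (f x); lra.
by apply: RintegrableD => //; exact: Rintegrable_cst.
Qed.

Lemma Rintegral_sqr_ge0 f : 0 <= \int[mu]_(x in D) (f x ^+ 2).
Proof. by apply: Rintegral_ge0 => *; exact: sqr_ge0. Qed.

Lemma EFin_Rintegral f : mu.-integrable D (EFin \o f) ->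
  (\int[mu]_(x in D) f x)%:E = (\int[mu]_(x in D) (f x)%:E)%E.
Proof. by move=> hf; rewrite /Rintegral fineK// integrable_fin_num. Qed.

End RealIntegrable.

(** * The Fejer kernel and integrals of cosines over a period *)

Section Fejer.
Context {R : realType}.
Implicit Types (x y z t : R) (n : nat).

(** The squared modulus of the sum of [e^{ijt}] over [j < n], that is, [n] times the usual Fejer
    kernel. *)
Definition fejer n t : R :=
  (\sum_(j < n) cos (j%:R * t)) ^+ 2 + (\sum_(j < n) sin (j%:R * t)) ^+ 2.

Lemma fejer_ge0 n t : 0 <= fejer n t.
Proof. by rewrite addr_ge0 ?sqr_ge0. Qed.

Lemma fejerE n t : fejer n t = \sum_(j < n) \sum_(l < n) cos ((j%:Z - l%:Z)%:~R * t).
Proof.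
rewrite /fejer !expr2 !mulr_suml -big_split/=; apply: eq_bigr => j _.
rewrite !mulr_sumr -big_split/=; apply: eq_bigr => l _.
by rewrite rmorphB/= mulrBl cosB.
Qed.

(* Telescoping [(1 - e^{it}) * sum_(j < n) e^{ijt} = 1 - e^{int}]. *)
Lemma fejer_telescope n t : fejer n t * (1 - cos t) = 1 - cos (n%:R * t).
Proof.
pose C := \sum_(j < n) cos (j%:R * t); pose S := \sum_(j < n) sin (j%:R * t).
have EC : C * (1 - cos t) + S * sin t = 1 - cos (n%:R * t).
  rewrite /C /S; elim: n {C S} => [|n IH].
    by rewrite !big_ord0 !mul0r cos0; ring.
  rewrite !big_ord_recr/= (_ : n.+1%:R * t = n%:R * t + t) ?cosD; last first.
    by rewrite -natr1; ring.
  by move: IH; lra.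
have ES : S * (1 - cos t) - C * sin t = - sin (n%:R * t).
  rewrite /C /S; elim: n {C S EC} => [|n IH].
    by rewrite !big_ord0 !mul0r sin0; ring.
  rewrite !big_ord_recr/= (_ : n.+1%:R * t = n%:R * t + t) ?sinD; last first.
    by rewrite -natr1; ring.
  by move: IH; lra.
(* Squared moduli of both sides of the telescoped identity. Each factor [|1 - e^{is}|^2] equals
   [2 * (1 - cos s)], so nothing is divided by [1 - cos t], which may vanish. *)
have h : (C ^+ 2 + S ^+ 2) * ((1 - cos t) ^+ 2 + sin t ^+ 2) =
    (1 - cos (n%:R * t)) ^+ 2 + sin (n%:R * t) ^+ 2.
  rewrite -EC -[in sin (n%:R * t)](opprK (sin (n%:R * t))) -ES; ring.
move: h; rewrite !sin2cos2 -/(fejer n t).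
have -> : (1 - cos t) ^+ 2 + (1 - cos t ^+ 2) = 2 * (1 - cos t) by ring.
have -> : (1 - cos (n%:R * t)) ^+ 2 + (1 - cos (n%:R * t) ^+ 2) =
  2 * (1 - cos (n%:R * t)) by ring.
by rewrite /fejer -/C -/S; lra.
Qed.

Lemma cosD2pin x (n : nat) : cos (x + n%:R * (2 * pi)) = cos x.
Proof.
elim: n => [|n IH]; first by rewrite mul0r addr0.
have -> : x + n.+1%:R * (2 * pi) = x + n%:R * (2 * pi) + pi *+ 2.
  by rewrite -natr1 mulr2n; ring.
by rewrite cosD2pi.
Qed.

Lemma sinD2pin x (n : nat) : sin (x + n%:R * (2 * pi)) = sin x.
Proof.
elim: n => [|n IH]; first by rewrite mul0r addr0.
have -> : x + n.+1%:R * (2 * pi) = x + n%:R * (2 * pi) + pi *+ 2.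
  by rewrite -natr1 mulr2n; ring.
by rewrite sinD2pi.
Qed.

Lemma cosD2piz x (k : int) : cos (x + k%:~R * (2 * pi)) = cos x.
Proof.
case: k => n; first exact: cosD2pin.
by rewrite -(cosD2pin (x + _) n.+1) NegzE mulrNz mulNr subrK.
Qed.

Lemma sinD2piz x (k : int) : sin (x + k%:~R * (2 * pi)) = sin x.
Proof.
case: k => n; first exact: sinD2pin.
by rewrite -(sinD2pin (x + _) n.+1) NegzE mulrNz mulNr subrK.
Qed.

Local Notation mu := (@lebesgue_measure R).

Lemma measurable_cosM (a b : R) D : measurable_fun D (fun x => cos (a * (b * x))).
Proof.
apply: (measurable_funS measurableT) => //; apply: continuous_measurable_fun => x.
apply: continuous_comp; last exact: continuous_cos.
by do 2!apply: cvgMr; exact: cvg_id.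
Qed.

Lemma measurable_sinM (a b : R) D : measurable_fun D (fun x => sin (a * (b * x))).
Proof.
apply: (measurable_funS measurableT) => //; apply: continuous_measurable_fun => x.
apply: continuous_comp; last exact: continuous_sin.
by do 2!apply: cvgMr; exact: cvg_id.
Qed.

Lemma Rintegral_cos (a b w x : R) : a < b -> w != 0 ->
  \int[mu]_(y in `[a, b]) cos (w * (x - y)) =
  (sin (w * (x - a)) - sin (w * (x - b))) / w.
Proof.
move=> ab w0; pose F y : R := - (sin (w * (x - y)) / w).
have dF y : is_derive y 1 F (cos (w * (x - y))).
  rewrite /F; apply: is_derive_eq.
  by rewrite /GRing.scale/=; field.
have cF : continuous F.
  by move=> y; apply: differentiable_continuous; apply/derivable1_diffP; case: (dF y).
rewrite /Rintegral (@continuous_FTC2 _ _ F)//.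
- by rewrite /= /F; field.
- apply: continuous_subspaceT => y; apply: continuous_comp; last exact: continuous_cos.
  by apply: cvgMr; apply: cvgB; [exact: cvg_cst|exact: cvg_id].
- split; first by move=> y _; case: (dF y).
  + by apply: cvg_at_right_filter; exact: cF.
  + by apply: cvg_at_left_filter; exact: cF.
- by move=> y _; rewrite derive1E; case: (dF y).
Qed.

Lemma Rintegral_cos_period (a L x : R) (k : int) : 0 < L ->
  \int[mu]_(y in `[a, a + L]) cos (k%:~R * (2 * pi / L * (x - y))) =
  if k == 0 then L else 0.
Proof.
move=> L0; have [->|k0] := eqVneq k 0.
  under eq_Rintegral do rewrite mul0r cos0.
  rewrite Rintegral_cst//= lebesgue_measure_itv/= lte_fin ltrDl L0 -EFinD/=.
  by rewrite mul1r addrC addKr.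
have w0 : k%:~R * (2 * pi / L) != 0 :> R.
  by rewrite mulf_neq0 ?intr_eq0// gt_eqF// divr_gt0// mulr_gt0// pi_gt0.
under eq_Rintegral do rewrite mulrA.
rewrite Rintegral_cos ?ltrDl//.
have -> : k%:~R * (2 * pi / L) * (x - a) =
  k%:~R * (2 * pi / L) * (x - (a + L)) + k%:~R * (2 * pi).
  by field; rewrite gt_eqF.
by rewrite sinD2piz subrr mul0r.
Qed.

End Fejer.

(** * The Fejer defect *)

Section RintegralLinear.
Context d (T : measurableType d) (R : realType) (mu : {measure set T -> \bar R}).
Variables (D : set T) (mD : measurable D).

Lemma Rintegrable_lin2 (p q : R) (f g : T -> R) : mu.-integrable D (EFin \o f) ->
  mu.-integrable D (EFin \o g) ->
  mu.-integrable D (EFin \o (fun x => p * f x + q * g x)).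
Proof. by move=> hf hg; apply: RintegrableD => //; exact: RintegrableZl. Qed.

Lemma Rintegral_lin2 (p q : R) (f g : T -> R) : mu.-integrable D (EFin \o f) ->
  mu.-integrable D (EFin \o g) ->
  \int[mu]_(x in D) (p * f x + q * g x) =
  p * \int[mu]_(x in D) f x + q * \int[mu]_(x in D) g x.
Proof.
move=> hf hg; rewrite RintegralD//; [|exact: RintegrableZl..].
by rewrite !RintegralZl.
Qed.

End RintegralLinear.

Section FourierCoef.
Context {R : realType}.
Variables (a L : R) (L0 : 0 < L).
Local Notation mu := (@lebesgue_measure R).
Local Notation I := (`[a, a + L]%classic : set (measurableTypeR R)).
Local Notation w := (2 * pi / L).
Implicit Types (k : int) (G : R -> R).

(** Unnormalised Fourier coefficients on a period: for real [G], [coef_energy] is the squared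
    modulus of the integral of [G y * e^{-ikwy}]. Hence the factor [L] in Parseval's identity. *)
Definition coef_cos k G : R := \int[mu]_(y in I) (G y * cos (k%:~R * (w * y))).
Definition coef_sin k G : R := \int[mu]_(y in I) (G y * sin (k%:~R * (w * y))).
Definition coef_energy k G : R := coef_cos k G ^+ 2 + coef_sin k G ^+ 2.

Let mI : measurable I. Proof. exact: measurable_itv. Qed.

Lemma lebesgue_measure_period : mu I = L%:E.
Proof. by rewrite lebesgue_measure_itv/= lte_fin ltrDl L0 -EFinD addrC addKr. Qed.

Let Ioo : (mu I < +oo)%E. Proof. by rewrite lebesgue_measure_period ltry. Qed.

Lemma coef_energy_ge0 k G : 0 <= coef_energy k G.
Proof. by rewrite addr_ge0 ?sqr_ge0. Qed.

Lemma coef_cosN k G : coef_cos (- k) G = coef_cos k G.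
Proof. by apply: eq_Rintegral => y _; rewrite mulrNz mulNr cosN. Qed.

Lemma Rintegrable_cosM k G : mu.-integrable I (EFin \o G) ->
  mu.-integrable I (EFin \o (fun y => G y * cos (k%:~R * (w * y)))).
Proof.
move=> hG.
apply: (RintegrableMb mI (h := fun y => cos (k%:~R * (w * y))) (M := 1) hG) => //;
  last by move=> *; exact: cos_max.
exact: measurable_cosM.
Qed.

Lemma Rintegrable_sinM k G : mu.-integrable I (EFin \o G) ->
  mu.-integrable I (EFin \o (fun y => G y * sin (k%:~R * (w * y)))).
Proof.
move=> hG.
apply: (RintegrableMb mI (h := fun y => sin (k%:~R * (w * y))) (M := 1) hG) => //;
  last by move=> *; exact: sin_max.
exact: measurable_sinM.
Qed.

Lemma coef_sinN k G : mu.-integrable I (EFin \o G) ->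
  coef_sin (- k) G = - coef_sin k G.
Proof.
move=> hG; rewrite -[RHS]mulN1r -RintegralZl//; last exact: Rintegrable_sinM.
by apply: eq_Rintegral => y _; rewrite mulrNz mulNr sinN; ring.
Qed.

Let int1 : mu.-integrable I (EFin \o (fun=> 1 : R)).
Proof. exact: Rintegrable_cst. Qed.

Lemma coef_cos1 k : coef_cos k (fun=> 1) = if k == 0 then L else 0.
Proof.
rewrite -(Rintegral_cos_period a 0 k L0); apply: eq_Rintegral => y _.
by rewrite mul1r sub0r !mulrN cosN.
Qed.

Lemma coef_sin1 k : coef_sin k (fun=> 1) = 0.
Proof.
have [->|k0] := eqVneq k 0.
  rewrite -[RHS](mul0r (fine (mu I))) -Rintegral_cst//.
  by apply: eq_Rintegral => y _; rewrite mul0r sin0 mulr0.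
(* With this value of [x] the phase is [pi / 2] minus [k w y], so the cosine integral over a period
   is the sine integral sought. *)
have := Rintegral_cos_period a (L / (4 * k%:~R)) k L0; rewrite (negbTE k0) => <-.
apply: eq_Rintegral => y _; rewrite mul1r -cosBpihalf -cosN; congr cos.
by field; rewrite intr_eq0 k0 gt_eqF.
Qed.

Lemma Rintegrable_cos k x :
  mu.-integrable I (EFin \o (fun y => cos (k%:~R * (w * (x - y))))).
Proof.
apply: (eq_Rintegrable mI _ (Rintegrable_lin2 mI (cos (k%:~R * (w * x)))
  (sin (k%:~R * (w * x))) (Rintegrable_cosM k int1) (Rintegrable_sinM k int1))).
by move=> y _; rewrite !mul1r 2!mulrBr cosB.
Qed.

Section inner.
Variables (G : R -> R) (iG : mu.-integrable I (EFin \o G))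
  (iG2 : mu.-integrable I (EFin \o (fun y => G y ^+ 2))).

(** The literal factors 1 put the expansion in the form of nested combinations [p * f + q * g], to
    which the linearity lemmas apply repeatedly. *)
Let inner_expand k x y : (G x - G y) ^+ 2 * cos (k%:~R * (w * (x - y))) =
  1 * (G x ^+ 2 * cos (k%:~R * (w * (x - y))) + (-2 * G x) *
      (cos (k%:~R * (w * x)) * (G y * cos (k%:~R * (w * y))) +
       sin (k%:~R * (w * x)) * (G y * sin (k%:~R * (w * y))))) +
  1 * (cos (k%:~R * (w * x)) * (G y ^+ 2 * cos (k%:~R * (w * y))) +
       sin (k%:~R * (w * x)) * (G y ^+ 2 * sin (k%:~R * (w * y)))).
Proof. by rewrite 2!mulrBr cosB; ring. Qed.

Lemma Rintegrable_inner k x :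
  mu.-integrable I (EFin \o (fun y => (G x - G y) ^+ 2 * cos (k%:~R * (w * (x - y))))).
Proof.
have icos := Rintegrable_cos k x.
apply: (@eq_Rintegrable _ _ _ _ _ mI); first by move=> y _; rewrite inner_expand.
by do !(apply: Rintegrable_lin2 => //);
  solve [exact: Rintegrable_cosM|exact: Rintegrable_sinM].
Qed.

Lemma Rintegral_inner k x :
  \int[mu]_(y in I) ((G x - G y) ^+ 2 * cos (k%:~R * (w * (x - y)))) =
  1 * ((if k == 0 then L else 0) * G x ^+ 2 + (-2) *
     (coef_cos k G * (G x * cos (k%:~R * (w * x))) +
      coef_sin k G * (G x * sin (k%:~R * (w * x))))) +
  1 * (coef_cos k (fun y => G y ^+ 2) * (1 * cos (k%:~R * (w * x))) +
     coef_sin k (fun y => G y ^+ 2) * (1 * sin (k%:~R * (w * x)))).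
Proof.
under eq_Rintegral do rewrite inner_expand.
have ic := Rintegrable_cosM k iG; have is' := Rintegrable_sinM k iG.
have ic2 := Rintegrable_cosM k iG2; have is2 := Rintegrable_sinM k iG2.
have i1 := Rintegrable_lin2 mI (cos (k%:~R * (w * x))) (sin (k%:~R * (w * x))) ic is'.
have i2 := Rintegrable_lin2 mI (cos (k%:~R * (w * x))) (sin (k%:~R * (w * x))) ic2 is2.
have icos := Rintegrable_cos k x.
rewrite Rintegral_lin2//; last exact: Rintegrable_lin2.
rewrite !Rintegral_lin2// Rintegral_cos_period//.
by rewrite -/(coef_cos _ _) -/(coef_sin _ _) -/(coef_cos k (fun y => G y ^+ 2))
  -/(coef_sin k (fun y => G y ^+ 2)); ring.
Qed.

Lemma Rintegrable_outer k : mu.-integrable I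
  (EFin \o (fun x => \int[mu]_(y in I) ((G x - G y) ^+ 2 * cos (k%:~R * (w * (x - y)))))).
Proof.
apply: (@eq_Rintegrable _ _ _ _ _ mI); first by move=> x _; rewrite Rintegral_inner.
by do !(apply: Rintegrable_lin2 => //);
  solve [exact: Rintegrable_cosM|exact: Rintegrable_sinM].
Qed.

(** Of the expanded square, the terms [G x ^+ 2] and [G y ^+ 2] survive only at frequency 0, since a
    nonzero frequency integrates to 0 over a period; the cross term separates into a product of
    coefficients, which is [coef_energy]. *)
Lemma Rintegral_outer k :
  \int[mu]_(x in I) \int[mu]_(y in I) ((G x - G y) ^+ 2 * cos (k%:~R * (w * (x - y)))) =
  2 * ((if k == 0 then L * \int[mu]_(x in I) (G x ^+ 2) else 0) - coef_energy k G).
Proof.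
under eq_Rintegral do rewrite Rintegral_inner.
have ic := Rintegrable_cosM k iG; have is' := Rintegrable_sinM k iG.
have ic1 := Rintegrable_cosM k int1; have is1 := Rintegrable_sinM k int1.
have i1 := Rintegrable_lin2 mI (coef_cos k G) (coef_sin k G) ic is'.
have i2 := Rintegrable_lin2 mI (coef_cos k (fun y => G y ^+ 2))
  (coef_sin k (fun y => G y ^+ 2)) ic1 is1.
rewrite Rintegral_lin2//; last exact: Rintegrable_lin2.
rewrite !Rintegral_lin2//.
rewrite -/(coef_cos _ _) -/(coef_sin _ _) -/(coef_cos k (fun=> 1))
  -/(coef_sin k (fun=> 1)) coef_cos1 coef_sin1 /coef_energy.
have [->|_] := eqVneq k 0; last by ring.
have -> : coef_cos 0 (fun y => G y ^+ 2) = \int[mu]_(x in I) (G x ^+ 2).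
  by apply: eq_Rintegral => y _; rewrite mul0r cos0 mulr1.
by ring.
Qed.

(** The double sum weights frequency [k] by [n - |k|], as in Cesaro means. Only the [n] diagonal
    pairs have frequency 0, so the first summand totals [n] times the full energy. *)
Definition fejer_defect n : R :=
  \sum_(j < n) \sum_(l < n)
    ((if j%:Z - l%:Z == 0 then L * \int[mu]_(x in I) (G x ^+ 2) else 0)
     - coef_energy (j%:Z - l%:Z) G).

Let fejer_expand n x y : (G x - G y) ^+ 2 * fejer n (w * (x - y)) =
  \sum_(j < n) \sum_(l < n)
    (G x - G y) ^+ 2 * cos ((j%:Z - l%:Z)%:~R * (w * (x - y))).
Proof.
by rewrite fejerE mulr_sumr; apply: eq_bigr => j _; rewrite mulr_sumr.
Qed.

Lemma Rintegrable_fejer_inner n x : mu.-integrable I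
  (EFin \o (fun y => (G x - G y) ^+ 2 * fejer n (w * (x - y)))).
Proof.
apply: (@eq_Rintegrable _ _ _ _ _ mI); first by move=> y _; rewrite fejer_expand.
by do 2!(apply: Rintegrable_sum => // ?); exact: Rintegrable_inner.
Qed.

Lemma Rintegral_fejer_inner n x :
  \int[mu]_(y in I) ((G x - G y) ^+ 2 * fejer n (w * (x - y))) =
  \sum_(j < n) \sum_(l < n)
    \int[mu]_(y in I) ((G x - G y) ^+ 2 * cos ((j%:Z - l%:Z)%:~R * (w * (x - y)))).
Proof.
under eq_Rintegral do rewrite fejer_expand.
rewrite Rintegral_sum//; last first.
  by move=> j; apply: Rintegrable_sum => // l; exact: Rintegrable_inner.
apply: eq_bigr => j _; rewrite Rintegral_sum// => l; exact: Rintegrable_inner.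
Qed.

Lemma Rintegrable_fejer_outer n : mu.-integrable I
  (EFin \o (fun x => \int[mu]_(y in I) ((G x - G y) ^+ 2 * fejer n (w * (x - y))))).
Proof.
apply: (@eq_Rintegrable _ _ _ _ _ mI).
  by move=> y _; rewrite Rintegral_fejer_inner.
by do 2!(apply: Rintegrable_sum => // ?); exact: Rintegrable_outer.
Qed.

Lemma fejer_defectE n : 2 * fejer_defect n =
  \int[mu]_(x in I) \int[mu]_(y in I) ((G x - G y) ^+ 2 * fejer n (w * (x - y))).
Proof.
under [RHS]eq_Rintegral do rewrite Rintegral_fejer_inner.
rewrite Rintegral_sum//; last first.
  by move=> j; apply: Rintegrable_sum => // l; exact: Rintegrable_outer.
rewrite mulr_sumr; apply: eq_bigr => j _; rewrite Rintegral_sum//; last first.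
  by move=> l; exact: Rintegrable_outer.
by rewrite mulr_sumr; apply: eq_bigr => l _; rewrite Rintegral_outer.
Qed.

Lemma fejer_defect_ge0 n : 0 <= fejer_defect n.
Proof.
suff : 0 <= 2 * fejer_defect n by lra.
rewrite fejer_defectE; do 2!(apply: Rintegral_ge0 => ? _).
by rewrite mulr_ge0 ?sqr_ge0 ?fejer_ge0.
Qed.

Lemma fejer_defect_energy n : fejer_defect n =
  n%:R * (L * \int[mu]_(x in I) (G x ^+ 2)) -
  \sum_(j < n) \sum_(l < n) coef_energy (j%:Z - l%:Z) G.
Proof.
rewrite /fejer_defect; under eq_bigr do rewrite sumrB.
rewrite sumrB; congr (_ - _).
transitivity (\sum_(j < n) (L * \int[mu]_(x in I) (G x ^+ 2))).
  apply: eq_bigr => j _; rewrite (bigD1 j)//= subrr eqxx big1 ?addr0// => l lj.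
  by rewrite subr_eq0 eqz_nat eq_sym val_eqE (negbTE lj).
by rewrite sumr_const card_ord mulr_natl.
Qed.

(** A crude bound, linear in [n], that will absorb the part of a function that is small in mean
    square. *)
Lemma fejer_defect_le n :
  fejer_defect n <= n%:R * (L * \int[mu]_(x in I) (G x ^+ 2)).
Proof.
rewrite fejer_defect_energy gerBl; do 2!(apply: sumr_ge0 => ? _).
exact: coef_energy_ge0.
Qed.

End inner.

Lemma Rintegrable_fejer n x :
  mu.-integrable I (EFin \o (fun y => fejer n (w * (x - y)))).
Proof.
apply: (@eq_Rintegrable _ _ _ _ _ mI); first by move=> y _; rewrite fejerE.
by do 2!(apply: Rintegrable_sum => // ?); exact: Rintegrable_cos.
Qed.

Lemma Rintegral_fejer n x : \int[mu]_(y in I) fejer n (w * (x - y)) = n%:R * L.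
Proof.
under eq_Rintegral do rewrite fejerE.
rewrite Rintegral_sum//; last first.
  by move=> j; apply: Rintegrable_sum => // l; exact: Rintegrable_cos.
transitivity (\sum_(j < n) L); last by rewrite sumr_const card_ord mulr_natl.
apply: eq_bigr => j _; rewrite Rintegral_sum//; last by move=> l; exact: Rintegrable_cos.
rewrite (bigD1 j)//= Rintegral_cos_period// subrr eqxx big1 ?addr0// => l lj.
by rewrite Rintegral_cos_period// subr_eq0 eqz_nat eq_sym val_eqE (negbTE lj).
Qed.

(** Under the double integral with nonnegative kernel, [(u + v) ^ 2 <= 2 * u ^ 2 + 2 * v ^ 2]. This
    allows a continuous part and a small remainder to be treated separately. *)
Lemma fejer_defect_quasinorm (g h : R -> R) n :
  measurable_fun I g -> measurable_fun I h ->
  mu.-integrable I (EFin \o (fun y => g y ^+ 2)) ->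
  mu.-integrable I (EFin \o (fun y => h y ^+ 2)) ->
  fejer_defect (fun x => g x + h x) n <= 2 * fejer_defect g n + 2 * fejer_defect h n.
Proof.
move=> mg mh ig2 ih2; have mgh : measurable_fun I (fun x => g x + h x).
  exact: measurable_funD.
have igh2 := Rintegrable_sqrD mI mg mh ig2 ih2.
have ig := Rintegrable_sqr mI Ioo mg ig2.
have ih := Rintegrable_sqr mI Ioo mh ih2.
have igh := Rintegrable_sqr mI Ioo mgh igh2.
suff : 2 * fejer_defect (fun x => g x + h x) n <=
  2 * (2 * fejer_defect g n) + 2 * (2 * fejer_defect h n) by lra.
rewrite !fejer_defectE//.
have i1 := Rintegrable_fejer_outer ig ig2 n.
have i2 := Rintegrable_fejer_outer ih ih2 n.
rewrite -Rintegral_lin2//; apply: le_Rintegral => //.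
- exact: Rintegrable_fejer_outer.
- exact: Rintegrable_lin2.
move=> x _.
have j1 := Rintegrable_fejer_inner ig ig2 n x.
have j2 := Rintegrable_fejer_inner ih ih2 n x.
rewrite -Rintegral_lin2//; apply: le_Rintegral => //.
- exact: (Rintegrable_fejer_inner igh igh2 n x).
- exact: Rintegrable_lin2.
move=> y _; rewrite !mulrA -mulrDl ler_wpM2r ?fejer_ge0//.
by have := sqr_ge0 ((g x - g y) - (h x - h y)); nra.
Qed.

End FourierCoef.

(** * The defect of a continuous function is negligible against [n] *)

Lemma cos_le_far (R : realType) (s t : R) :
  0 <= s <= pi -> s <= t <= 2 * pi - s -> cos t <= cos s.
Proof.
move=> /andP[s0 spi] /andP[st ts].
have h (u : R) : s <= u -> u <= pi -> cos u <= cos s.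
  rewrite le_eqVlt => /predU1P[->//|su] upi; apply/ltW.
  by rewrite ltr_cos// in_itv/=; apply/andP; split; lra.
have [tpi|tpi] := leP t pi; first exact: h.
(* Beyond [pi], the reflection [t |-> 2 * pi - t] returns to the interval where [cos] decreases. *)
rewrite -cosN -(cosD2pin _ 1) mul1r; apply: h; lra.
Qed.

(** Only [x] is confined to [K]; [y] may lie outside it. The near-covering form of compactness turns
    the local radii into a single one. *)
Lemma compact_uniformly_continuous (R : realType) (G : R -> R) (K : set R) (e : R) :
  continuous G -> compact K -> 0 < e ->
  exists2 r, 0 < r & forall x y, K x -> `|x - y| <= r -> `|G x - G y| < e.
Proof.
move=> cG /compact_near_coveringP cK e0.
have e20 : 0 < e / 2 by rewrite divr_gt0.
pose P r x := forall y, `|x - y| <= r -> `|G x - G y| < e.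
have key : \forall r \near 0^'+, K `<=` P r.
  apply: cK => x _.
  have /cvgrPdist_lt/(_ _ e20) := cG x.
  move=> /nbhs_ballP[s /= s0 hs].
  exists (ball x (s / 2), [set r | r < s / 2]) => /=.
    split; first by apply: nbhsx_ballx; rewrite divr_gt0.
    by apply: nbhs_right_lt; rewrite divr_gt0.
  move=> [z r] /= [zx rs] y zy.
  have h1 : `|G x - G z| < e / 2.
    by apply: hs; move: zx; rewrite /ball/= => /lt_trans; apply; lra.
  have h2 : `|G x - G y| < e / 2.
    apply: hs; rewrite /ball/= -[x](subrK z) -addrA (le_lt_trans (ler_normD _ _))//.
    by move: zx; rewrite /ball/=; lra.
  rewrite -[G z](subrK (G x)) -addrA (le_lt_trans (ler_normD _ _))// distrC.
  by lra.
near (0:R)^'+ => r; exists r; first by near: r; exact: nbhs_right_gt.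
have KP : K `<=` P r by near: r.
by move=> x y Kx; exact: KP.
Unshelve. all: by end_near. Qed.

Section FejerContinuous.
Context {R : realType}.
Variables (a L : R) (L0 : 0 < L).
Local Notation mu := (@lebesgue_measure R).
Local Notation I := (`[a, a + L]%classic : set (measurableTypeR R)).
Local Notation w := (2 * pi / L).

Let mI : measurable I. Proof. exact: measurable_itv. Qed.

Let Ioo : (mu I < +oo)%E. Proof. by rewrite lebesgue_measure_period// ltry. Qed.

Lemma bounded_continuous_sqr_integrable (G : R -> R) (M : R) :
  continuous G -> (forall x, `|G x| <= M) ->
  mu.-integrable I (EFin \o (fun y => G y ^+ 2)).
Proof.
move=> cG bG; apply: (@le_Rintegrable _ _ _ _ _ mI _ (fun=> M ^+ 2)).
- apply: measurable_funX; apply: (@measurable_funS _ _ _ _ setT) => //.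
  exact: continuous_measurable_fun.
- move=> x _; rewrite ger0_norm ?sqr_ge0// -real_normK ?num_real//.
  by rewrite lerXn2r// nnegrE// (le_trans _ (bG x)).
- exact: Rintegrable_cst.
Qed.

Lemma Rintegral_indic_le (b : R) (s : R) : 0 <= s ->
  mu.-integrable I (EFin \o (fun x => \1_(`[b, b + s]%classic) x : R)) /\
  \int[mu]_(x in I) (\1_(`[b, b + s]%classic) x : R) <= s.
Proof.
move=> s0; have iJ : mu.-integrable I (EFin \o (fun x => \1_(`[b, b + s]%classic) x : R)).
  apply: (@le_Rintegrable _ _ _ _ _ mI _ (fun=> 1)).
  - by apply: (@measurable_funS _ _ _ _ setT) => //; exact: measurable_indic.
  - by move=> x _; rewrite indicE; case: (_ \in _); rewrite ?normr1 ?normr0.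
  - exact: Rintegrable_cst.
split=> //; rewrite -lee_fin EFin_Rintegral// integral_indic//.
apply: (@le_trans _ _ (mu `[b, b + s]%classic)).
  by apply: le_measure; rewrite ?inE//; apply: measurableI.
rewrite lebesgue_measure_itv/= lte_fin ltrDl; case: ifPn => _.
  by rewrite -EFinD addrC addKr.
by rewrite lee_fin.
Qed.

(* Near the diagonal [G] varies little and away from it the kernel is bounded in [n];
   the remaining pairs, close modulo [L] only, have [x] near an endpoint of [I]. *)
Lemma fejer_pointwise (G : R -> R) (M e r : R) n (x y : R) :
  (forall x, `|G x| <= M) -> 0 <= e -> 0 < r -> r <= L / 4 ->
  (forall x y, I x -> `|x - y| <= r -> `|G x - G y| <= e) ->
  I x -> I y ->
  (G x - G y) ^+ 2 * fejer n (w * (x - y)) <=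
  (e ^+ 2 + 4 * M ^+ 2 * (1 * \1_(`[a, a + r]%classic) x +
     1 * \1_(`[a + L - r, a + L - r + r]%classic) x)) * fejer n (w * (x - y)) +
  (4 * M ^+ 2) * (2 / (1 - cos (w * r))) * 1.
Proof.
move=> bG e0 r0 rL uG Ix Iy.
have pi0 : 0 < pi :> R := pi_gt0 R.
have w0 : 0 < w by rewrite divr_gt0 ?mulr_gt0.
have wL : w * L = 2 * pi by field; rewrite gt_eqF.
have wr0 : 0 < w * r by exact: mulr_gt0.
have wr : w * r <= pi / 2 by have := ler_wpM2l (ltW w0) rL; rewrite mulrA wL; lra.
have cr : cos (w * r) < 1.
  have z0 : 0 \in `[0, pi : R] by rewrite in_itv/= lexx ltW.
  have z1 : w * r \in `[0, pi] by rewrite in_itv/=; apply/andP; split; lra.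
  by rewrite -[ltRHS]cos0 ltr_cos.
have K0 := fejer_ge0 n (w * (x - y)).
have d4 : (G x - G y) ^+ 2 <= 4 * M ^+ 2.
  have := bG x; have := bG y; rewrite !ler_norml => /andP[? ?] /andP[? ?].
  by nra.
have c0 : 0 <= 4 * M ^+ 2 * (2 / (1 - cos (w * r))) * 1.
  have q0 : 0 <= 2 / (1 - cos (w * r)) by rewrite divr_ge0// subr_ge0 ltW.
  by rewrite mulr1 mulr_ge0// mulr_ge0 ?sqr_ge0.
have i1 : 0 <= \1_(`[a, a + r]%classic) x :> R by [].
have i2 : 0 <= \1_(`[a + L - r, a + L - r + r]%classic) x :> R by [].
move: Ix Iy; rewrite /= !in_itv/= => /andP[ax xb] /andP[ay yb].
have [xy|xy] := leP `|x - y| r.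
  rewrite -[leLHS]addr0 lerD// ler_wpM2r//.
  have : (G x - G y) ^+ 2 <= e ^+ 2.
    rewrite -[leLHS]real_normK ?num_real// lerXn2r ?nnegrE// uG//=.
    by rewrite in_itv/= ax.
  have : 0 <= M ^+ 2 by exact: sqr_ge0.
  by nra.
have [xyL|xyL] := leP `|x - y| (L - r).
  (* Here [x - y] stays at distance [r] from every multiple of [L], so the telescoped identity
     bounds the kernel by [2 / (1 - cos (w * r))] for all [n]. *)
  have ck : cos (w * (x - y)) <= cos (w * r).
    rewrite -[leLHS]cos_norm normrM (gtr0_norm w0); apply: cos_le_far.
      by apply/andP; split; lra.
    apply/andP; split; first by rewrite ler_pM2l// ltW.
    by have := ler_wpM2l (ltW w0) xyL; rewrite mulrBr wL.
  have Kb : fejer n (w * (x - y)) * (1 - cos (w * r)) <= 2.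
    apply: (@le_trans _ _ (fejer n (w * (x - y)) * (1 - cos (w * (x - y))))).
      by rewrite ler_wpM2l//; lra.
    by rewrite fejer_telescope; have := cos_geN1 (n%:R * (w * (x - y))); lra.
  have Kb' : fejer n (w * (x - y)) <= 2 / (1 - cos (w * r)).
    by rewrite ler_pdivlMr//; lra.
  rewrite -[leLHS]add0r lerD//; last by rewrite mulr1 ler_pM// sqr_ge0.
  have M40 : 0 <= 4 * M ^+ 2 by rewrite mulr_ge0// sqr_ge0.
  by rewrite mulr_ge0// addr_ge0 ?sqr_ge0// mulr_ge0//; lra.
rewrite -[leLHS]addr0 lerD// ler_wpM2r//.
(* In an interval of length [L], two points more than [L - r] apart lie near opposite ends, so [x]
   is in one of the two end strips of length [r]. *)
have h : 1 <= \1_(`[a, a + r]%classic) x + \1_(`[a + L - r, a + L - r + r]%classic) x :> R.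
  have [h|h] := leP 0 (x - y).
    rewrite [X in _ + X]indicE mem_set ?lerDr//= in_itv/=.
    by move: xyL; rewrite ger0_norm//; lra.
  rewrite indicE mem_set ?lerDl//= in_itv/=.
  by move: xyL; rewrite ltr0_norm//; lra.
have : 0 <= M ^+ 2 by exact: sqr_ge0.
have : 0 <= e ^+ 2 by exact: sqr_ge0.
by nra.
Qed.

(** Integrating the pointwise bound: the kernel has integral [n * L] in [y], so the near-diagonal
    part is governed by the oscillation of [G], the end strips by their total length [2 * r], and
    the rest is a constant independent of [n]. *)
Lemma fejer_defect_continuous (G : R -> R) (M e : R) :
  continuous G -> (forall x, `|G x| <= M) -> 0 < e ->
  exists C, forall n, fejer_defect a L G n <= e * n%:R + C.
Proof.
move=> cG bG e0.
have pi0 : 0 < pi :> R := pi_gt0 R.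
have L20 : 0 < L * L by exact: mulr_gt0.
have e10 : 0 < e / (L * L + 1) by rewrite divr_gt0// addr_gt0.
set e1 := e / _ in e10.
pose e2 := Num.min 1 e1; have e20 : 0 < e2 by rewrite lt_min ltr01.
have [s s0 uG] := compact_uniformly_continuous cG (@segment_compact R a (a + L)) e20.
(* [L / 4] keeps [w * r] at most [pi / 2]; the last bound makes the strips cost
   [n * L * 4 M ^ 2 * 2 r <= n * e]. The added 1s keep the denominator positive. *)
pose r := Num.min s (Num.min (L / 4) (e / (8 * (M ^+ 2 + 1) * (L + 1)))).
have M0 : 0 <= M ^+ 2 by exact: sqr_ge0.
have D0 : 0 < 8 * (M ^+ 2 + 1) * (L + 1).
  by rewrite mulr_gt0 ?addr_gt0// mulr_gt0// ltr_wpDl.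
have r0 : 0 < r by rewrite !lt_min s0/= !divr_gt0.
have rs : r <= s by rewrite ge_min lexx.
have rL : r <= L / 4 by rewrite !ge_min lexx orbT.
have rM : r * (8 * (M ^+ 2 + 1) * (L + 1)) <= e.
  by rewrite -ler_pdivlMr// !ge_min lexx !orbT.
have e2L : e2 ^+ 2 * (L * L + 1) <= e.
  rewrite -ler_pdivlMr ?addr_gt0//.
  have h1 : e2 <= 1 by rewrite ge_min lexx.
  have h2 : e2 <= e1 by rewrite ge_min lexx orbT.
  by apply: le_trans h2; rewrite expr2; nra.
have uG' x y : I x -> `|x - y| <= r -> `|G x - G y| <= e2.
  by move=> Ix xy; apply/ltW/uG => //; exact: le_trans rs.
have iG2 := bounded_continuous_sqr_integrable cG bG.
have mG : measurable_fun I G.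
  by apply: (@measurable_funS _ _ _ _ setT) => //; exact: continuous_measurable_fun.
have iG := Rintegrable_sqr mI Ioo mG iG2.
pose Q := (4 * M ^+ 2) * (2 / (1 - cos (w * r))).
exists (Q * L * L) => n.
have [iJ1 J1] := Rintegral_indic_le a (ltW r0).
have [iJ2 J2] := Rintegral_indic_le (a + L - r) (ltW r0).
pose J x : R := 1 * \1_(`[a, a + r]%classic) x +
     1 * \1_(`[a + L - r, a + L - r + r]%classic) x.
have iJ : mu.-integrable I (EFin \o J) by exact: Rintegrable_lin2.
have JE : \int[mu]_(x in I) J x <= 2 * r by rewrite Rintegral_lin2//; lra.
have i1 : mu.-integrable I (EFin \o (fun=> 1 : R)) by exact: Rintegrable_cst.
have i1E : \int[mu]_(x in I) (1 : R) = L 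
  by rewrite Rintegral_cst// mul1r; exact: (congr1 fine (lebesgue_measure_period a L0)).
have inner x : I x ->
    \int[mu]_(y in I) ((G x - G y) ^+ 2 * fejer n (w * (x - y))) <=
    (n%:R * L * (4 * M ^+ 2)) * J x + (n%:R * L * e2 ^+ 2 + Q * L) * 1.
  move=> Ix; have iF := Rintegrable_fejer a L0 n x.
  apply: (@le_trans _ _ (\int[mu]_(y in I)
      ((e2 ^+ 2 + 4 * M ^+ 2 * J x) * fejer n (w * (x - y)) + Q * 1))).
    apply: le_Rintegral => //.
    - exact: (Rintegrable_fejer_inner L0 iG iG2 n x).
    - exact: Rintegrable_lin2.
    - by move=> y Iy; exact: fejer_pointwise (ltW e20) r0 rL uG' Ix Iy.
  by rewrite Rintegral_lin2// Rintegral_fejer// i1E le_eqVlt; apply/predU1P; left; ring.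
suff : 2 * fejer_defect a L G n <= 2 * (e * n%:R + Q * L * L).
  by rewrite ler_pM2l.
rewrite fejer_defectE//; apply: (@le_trans _ _ (\int[mu]_(x in I)
  ((n%:R * L * (4 * M ^+ 2)) * J x + (n%:R * L * e2 ^+ 2 + Q * L) * 1))).
  apply: le_Rintegral => //; last exact: Rintegrable_lin2.
  exact: (Rintegrable_fejer_outer L0 iG iG2 n).
rewrite Rintegral_lin2// i1E.
have Q0 : 0 <= Q * L * L.
  have c1 : 0 <= (1 - cos (w * r))^-1 by rewrite invr_ge0 subr_ge0 cos_le1.
  have L0' := ltW L0; have Mp : 0 <= M := le_trans (normr_ge0 _) (bG 0).
  by rewrite /Q !mulr_ge0.
have n0 : 0 <= n%:R :> R by [].
have h1 : n%:R * L * (4 * M ^+ 2) * \int[mu]_(x in I) J x <= n%:R * e.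
  apply: (@le_trans _ _ (n%:R * L * (4 * M ^+ 2) * (2 * r))).
    by apply: ler_wpM2l => //; apply: mulr_ge0; apply: mulr_ge0 => //; exact: ltW.
  rewrite -2!mulrA ler_wpM2l//; apply: le_trans rM.
  have : L * M ^+ 2 <= (L + 1) * (M ^+ 2 + 1) by nra.
  by move=> /(ler_wpM2l (ltW r0)); lra.
have h2 : n%:R * L * e2 ^+ 2 * L <= n%:R * e.
  rewrite -2!mulrA ler_wpM2l//; apply: le_trans e2L.
  by have := sqr_ge0 e2; lra.
by lra.
Qed.

End FejerContinuous.

(** * Parseval on an interval *)

Lemma cvge0_lt (R : realType) (u : (\bar R)^nat) (e : R) : 0 < e ->
  u n @[n --> \oo] --> 0%E -> \forall n \near \oo, (u n < e%:E)%E.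
Proof.
move=> e0 /fine_cvgP[ufin /cvgrPdist_lt/(_ _ e0) ue].
near=> n.
have ufn : u n \is a fin_num by near: n.
have : `|0 - fine (u n)| < e by near: n.
by rewrite sub0r normrN -(fineK ufn) lte_fin; exact: le_lt_trans (ler_norm _).
Unshelve. all: by end_near. Qed.

(** * Truncation of values, mean-square density and Parseval's identity *)

Section Clamp.
Context {R : realType}.
Implicit Types (M x y : R).

Definition clamp M x := Num.max (- M) (Num.min M x).

Lemma clamp_norm M x : 0 <= M -> `|clamp M x| <= M.
Proof.
move=> M0; rewrite /clamp ler_norml le_max lexx/= ge_max ge_min lexx/= andbT; lra.
Qed.

Lemma clamp_lip M x y : `|clamp M x - clamp M y| <= `|x - y|.
Proof.
rewrite /clamp; have [?|?] := leP M x; have [?|?] := leP M y;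
  rewrite !maxEle; repeat (case: ifPn; rewrite -?ltNge => ?);
  by have [?|?] := ger0P (x - y); rewrite ?ler_norml; lra.
Qed.

Lemma clamp_sub M x : 0 <= M -> `|x - clamp M x| <= `|x|.
Proof.
move=> M0; rewrite /clamp; have [?|?] := leP M x; rewrite !maxEle;
  repeat (case: ifPn; rewrite -?ltNge => ?);
  by have [?|?] := ger0P x; rewrite ?ler_norml; lra.
Qed.

Lemma clamp_id M x : `|x| <= M -> clamp M x = x.
Proof. by rewrite ler_norml => /andP[? ?]; rewrite /clamp min_r// max_r. Qed.

Lemma clamp_continuous M : continuous (clamp M).
Proof.
move=> x; apply: (@continuous_max _ _ (fun=> - M)); first exact: cvg_cst.
by apply: (@continuous_min _ _ (fun=> M)); [exact: cvg_cst|exact: cvg_id].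
Qed.

End Clamp.

Section Parseval.
Context {R : realType}.
Variables (a L : R) (L0 : 0 < L).
Local Notation mu := (@lebesgue_measure R).
Local Notation I := (`[a, a + L]%classic : set (measurableTypeR R)).
Local Notation w := (2 * pi / L).

Let mI : measurable I. Proof. exact: measurable_itv. Qed.

Let Ioo : (mu I < +oo)%E. Proof. by rewrite lebesgue_measure_period// ltry. Qed.

(** Density in [L^2] is derived from density in [L^1]. Dominated convergence lets [G] be clamped at
    a level [N]; the clamped function is approximated in [L^1] by a continuous one, which is clamped
    too. Both being bounded by [N], [(h - g) ^ 2 <= 2 * N * |h - g|]. *)
Lemma continuous_dense_L2 (G : R -> R) (e : R) : measurable_fun I G ->
  mu.-integrable I (EFin \o (fun y => G y ^+ 2)) -> 0 < e ->
  exists g M, [/\ continuous g, forall x, `|g x| <= M &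
    \int[mu]_(x in I) ((G x - g x) ^+ 2) <= e].
Proof.
move=> mG iG2 e0.
have aux (p q : R) : p <= e / 4 -> q <= e / 4 -> 2 * p + 2 * q <= e by lra.
have mcl (M : R) (f : R -> R) : measurable_fun I f -> measurable_fun I (fun x => clamp M (f x)).
  move=> mf; apply: measurableT_comp => //.
  by apply: continuous_measurable_fun; exact: clamp_continuous.
have e4 : 0 < e / 4 by rewrite divr_gt0.
have iG := Rintegrable_sqr mI Ioo mG iG2.
pose f n x := ((G x - clamp n%:R (G x)) ^+ 2)%:E.
have mf n : measurable_fun I (f n).
  apply/measurable_EFinP; apply: measurable_funX; apply: measurable_funB => //.
  exact: mcl.
have f0 : {ae mu, forall x, I x -> f n x @[n --> \oo] --> (cst 0%E : R -> \bar R) x}.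
  apply: aeW => x _ /=; apply: cvg_near_cst; near=> n.
  rewrite /f clamp_id ?subrr ?expr0n//.
  by near: n; exact: nbhs_infty_ger.
have fG : {ae mu, forall x n, I x -> (`|f n x| <= (G x ^+ 2)%:E)%E}.
  apply: aeW => x n _; rewrite /f/= lee_fin ger0_norm ?sqr_ge0//.
  rewrite -[leLHS]real_normK ?num_real// -[leRHS]real_normK ?num_real//.
  by rewrite lerXn2r ?nnegrE// clamp_sub.
have [_ _] := dominated_convergence mI mf (measurable_cst _) f0 iG2 fG.
rewrite integral0 => /(cvge0_lt e4)[N _ /(_ N (leqnn N))] /= hN.
pose h x := clamp N%:R (G x).
have mh : measurable_fun I h by exact: mcl.
have ih2 : mu.-integrable I (EFin \o (fun y => h y ^+ 2)).
  apply: (@le_Rintegrable _ _ _ _ _ mI _ (fun=> N%:R ^+ 2)).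
  - exact: measurable_funX.
  - move=> x _; rewrite ger0_norm ?sqr_ge0// -real_normK ?num_real//.
    by rewrite lerXn2r// ?nnegrE// clamp_norm.
  - exact: Rintegrable_cst.
have ih := Rintegrable_sqr mI Ioo mh ih2.
have iGh2 := Rintegrable_sqrB mI mG mh iG2 ih2.
have [g_ [cg ig]] := approximation_continuous_integrable mI Ioo ih.
(* Chosen so that multiplication by [2 * N] leaves at most [e / 4]; [N + 1] covers [N = 0]. *)
have e8 : 0 < e / (8 * (N%:R + 1)) by rewrite divr_gt0// mulr_gt0// ltr_wpDl.
move=> /(cvge0_lt e8)[n _ /(_ n (leqnn n))] /= hn.
pose g x := clamp N%:R (g_ n x).
have cgg : continuous g.
  move=> x; apply: (@continuous_comp R R R (g_ n) (clamp N%:R)); last exact: clamp_continuous.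
  exact: (cg n x).
have gN x : `|g x| <= N%:R by exact: clamp_norm.
have mg : measurable_fun I g.
  by apply: (@measurable_funS _ _ _ _ setT) => //; exact: continuous_measurable_fun.
have ig2 := bounded_continuous_sqr_integrable a L0 cgg gN.
have ihg2 := Rintegrable_sqrB mI mh mg ih2 ig2.
have ihg : mu.-integrable I (EFin \o (fun x => h x - g_ n x)) by exact: RintegrableB.
have inhg : mu.-integrable I (EFin \o (fun x => `|h x - g_ n x|)).
  exact: (integrable_norm ihg).
exists g, N%:R; split => //.
have A1 : \int[mu]_(x in I) ((G x - h x) ^+ 2) <= e / 4.
  by rewrite -lee_fin EFin_Rintegral// ltW.
have A2 : \int[mu]_(x in I) ((h x - g x) ^+ 2) <= e / 4.
  apply: (@le_trans _ _ (\int[mu]_(x in I) (2 * N%:R * `|h x - g_ n x|))).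
    apply: le_Rintegral => //; first exact: RintegrableZl.
    move=> x _; rewrite -real_normK ?num_real// expr2 ler_pM//.
      by rewrite (le_trans (ler_normB _ _))// mulr_natl mulr2n lerD// clamp_norm.
    rewrite [X in `|X - _|](_ : h x = clamp N%:R (h x)); last first.
      by rewrite clamp_id// clamp_norm.
    exact: clamp_lip.
  rewrite RintegralZl//.
  have A3 : \int[mu]_(x in I) `|h x - g_ n x| <= e / (8 * (N%:R + 1)).
    by rewrite -lee_fin EFin_Rintegral// ltW.
  apply: (@le_trans _ _ (2 * N%:R * (e / (8 * (N%:R + 1))))); first by rewrite ler_wpM2l.
  rewrite mulrA ler_pdivrMr ?mulr_gt0 ?ltr_wpDl//.
  by have : 0 <= N%:R :> R by []; nra.
apply: (@le_trans _ _ (\int[mu]_(x in I) (2 * (G x - h x) ^+ 2 + 2 * (h x - g x) ^+ 2))).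
  apply: le_Rintegral => //.
  - exact: Rintegrable_sqrB.
  - exact: Rintegrable_lin2.
  - by move=> x _; have := sqr_ge0 ((G x - h x) - (h x - g x)); nra.
by rewrite Rintegral_lin2//; exact: aux.
Unshelve. all: by end_near. Qed.

(** Write [G = g + (G - g)] with [g] continuous. The part [g] contributes [e / 4 * n + C], the
    remainder at most [n * L * (e / (4 * L))], and the quasinorm inequality doubles both. *)
Lemma fejer_defect_small (G : R -> R) (e : R) : measurable_fun I G ->
  mu.-integrable I (EFin \o (fun y => G y ^+ 2)) -> 0 < e ->
  exists C, forall n, fejer_defect a L G n <= e * n%:R + C.
Proof.
move=> mG iG2 e0.
have e1 : 0 < e / (4 * L) by rewrite divr_gt0// mulr_gt0.
have e2 : 0 < e / 4 by rewrite divr_gt0.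
have [g [M [cg gM Gg]]] := continuous_dense_L2 mG iG2 e1.
have [C hC] := fejer_defect_continuous a L0 cg gM e2.
have mg : measurable_fun I g.
  by apply: (@measurable_funS _ _ _ _ setT) => //; exact: continuous_measurable_fun.
have ig2 := bounded_continuous_sqr_integrable a L0 cg gM.
have iGg2 := Rintegrable_sqrB mI mG mg iG2 ig2.
have mGg : measurable_fun I (fun x => G x - g x) by exact: measurable_funB.
have iGg := Rintegrable_sqr mI Ioo mGg iGg2.
exists (2 * C) => n.
have -> : G = (fun x => g x + (G x - g x)) by apply/funext => x; rewrite addrC subrK.
apply: (le_trans (fejer_defect_quasinorm L0 n mg mGg ig2 iGg2)).
have D1 := hC n.
have D2 : fejer_defect a L (fun x => G x - g x) n <= n%:R * (e / 4).
  rewrite (le_trans (fejer_defect_le a L _ n))// ler_wpM2l//.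
  rewrite (le_trans (ler_wpM2l (ltW L0) Gg))// le_eqVlt; apply/predU1P; left.
  by field; rewrite gt_eqF.
by lra.
Qed.

Lemma esum_le_subset (T : choiceType) (A B : set T) (u : T -> \bar R) :
  (forall i, 0 <= u i)%E -> A `<=` B ->
  (\esum_(i in A) u i <= \esum_(i in B) u i)%E.
Proof.
move=> u0 AB; rewrite esum_mkcond [leRHS]esum_mkcond; apply: le_esum => i _.
case: ifPn => iA; case: ifPn => // iB.
by move: iB; rewrite mem_set//; apply: AB; exact: set_mem.
Qed.

(** Row [j] of the double sum in [fejer_defect] runs over the window of [n] consecutive frequencies
    ending at [j]; seen as a sum over a set, it can be compared with other sets of frequencies. *)
Lemma sum_shift_esum (s : int -> R) (j : int) (n : nat) : (forall k, 0 <= s k) ->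
  (\sum_(l < n) s (j - l%:Z))%:E =
  \esum_(k in [set j - l%:Z | l in `I_n]) (s k)%:E.
Proof.
move=> s0; rewrite (reindex_esum `I_n _ (fun l : nat => j - l%:Z)); last first.
  split; first by move=> l; exists l.
    by move=> l l' _ _ /addrI/oppr_inj[].
  by move=> _ [l ln <-]; exists l.
rewrite esum_fset; [|exact: finite_II|by move=> *; rewrite lee_fin].
by rewrite -fsbig_ord/= sumEFin.
Qed.

(** Divide the defect by [n]: nonnegativity gives Bessel's inequality, and smallness gives the
    converse. Both limits are taken by contradiction with an Archimedean choice of [n]. *)
Lemma parseval (G : R -> R) : measurable_fun I G ->
  mu.-integrable I (EFin \o (fun y => G y ^+ 2)) ->
  \esum_(k in [set: int]) (coef_energy a L k G)%:E =
  (L * \int[mu]_(x in I) (G x ^+ 2))%:E.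
Proof.
move=> mG iG2; set N := L * _.
have iG := Rintegrable_sqr mI Ioo mG iG2.
pose s k := coef_energy a L k G.
have s0 k : 0 <= s k by exact: coef_energy_ge0.
have DE n : fejer_defect a L G n = n%:R * N - \sum_(j < n) \sum_(l < n) s (j%:Z - l%:Z).
  by rewrite fejer_defect_energy.
have D0 n : 0 <= fejer_defect a L G n by exact: fejer_defect_ge0.
have ub : (\esum_(k in [set: int]) (s k)%:E <= N%:E)%E.
  apply: ub_ereal_sup => _ [F [finF _] <-].
  have [B FB] : exists B : nat, forall k, F k -> (`|k| <= B)%N.
    move/finite_seqP : finF => [X FX].
    exists (\max_(k <- X) `|k|)%N => k; rewrite FX /= => kX.
    exact: (@leq_bigmax_seq _ _ predT (fun k : int => `|k|%N)).
  have -> : (\sum_(i \in F) (s i)%:E)%E = (\sum_(i \in F) s i)%:E by rewrite fsumEFin.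
  set t := \sum_(i \in F) s i; rewrite lee_fin.
  (* Among [n + 2 B] rows, those with [B <= j < B + n] have a window covering [F], so each is at
     least [t]; the defect of order [n + 2 B] being nonnegative bounds all rows together. *)
  have key n : n%:R * t <= (n + B.*2)%:R * N.
    apply: (@le_trans _ _ (\sum_(j < n + B.*2) \sum_(l < n + B.*2) s (j%:Z - l%:Z))); last first.
      by rewrite -subr_ge0 -DE.
    have X0 (j : nat) : 0 <= \sum_(l < n + B.*2) s (j%:Z - l%:Z) by apply: sumr_ge0.
    rewrite -(big_mkord xpredT (fun j : nat => \sum_(l < n + B.*2) s (j%:Z - l%:Z))).
    rewrite (@big_cat_nat _ _ _ B)/=; [|by []|lia].
    rewrite [X in _ <= _ + X](@big_cat_nat _ _ _ (B + n))/=; [|lia|lia].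
    apply: (@le_trans _ _ (\sum_(B <= j < B + n) \sum_(l < n + B.*2) s (j%:Z - l%:Z))); last first.
      by rewrite addrCA lerDl addr_ge0//; apply: sumr_ge0.
    rewrite mulr_natl -[n in t *+ n](addKn B) -sumr_const_nat.
    apply: ler_sum_nat => j /andP[Bj jBn].
    rewrite -lee_fin sum_shift_esum// /t -fsumEFin// -esum_fset//; last first.
      by move=> *; rewrite lee_fin.
    apply: esum_le_subset => [k|k Fk]; first by rewrite lee_fin.
    have := FB _ Fk; exists `|j%:Z - k|%N; rewrite /=; lia.
  rewrite leNgt; apply/negP => Nt.
  have tN : 0 < t - N by rewrite subr_gt0.
  have N0 : 0 <= N by apply: mulr_ge0; [exact: ltW|exact: Rintegral_sqr_ge0].
  have h0 : 0 <= B.*2%:R * N / (t - N) by apply: divr_ge0; [exact: mulr_ge0|exact: ltW].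
  have := archi_boundP h0; rewrite ltr_pdivrMr//; set n := Num.bound _.
  by have := key n; rewrite natrD; lra.
apply/eqP; rewrite eq_le; apply/andP; split; first exact: ub.
have [t tE] : exists t, \esum_(k in [set: int]) (s k)%:E = t%:E.
  exists (fine (\esum_(k in [set: int]) (s k)%:E)); rewrite fineK//.
  rewrite ge0_fin_numE; first exact: le_lt_trans ub (ltry _).
  by apply: esum_ge0 => k _; rewrite lee_fin.
rewrite tE lee_fin; apply/ler_addgt0Pr => e e0.
have [C hC] := fejer_defect_small mG iG2 (divr_gt0 e0 (ltr0n _ 2)).
have inner (j : int) n : \sum_(l < n) s (j - l%:Z) <= t.
  rewrite -lee_fin -tE sum_shift_esum//; apply: esum_le_subset => k.
    by rewrite lee_fin.
  by [].
(* Every row is at most the full sum [t], so a small defect leaves little room between [n * N] and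
   [n * t]. *)
have key n : n%:R * N <= n%:R * t + e / 2 * n%:R + C.
  have := hC n; rewrite DE.
  have : \sum_(j < n) \sum_(l < n) s (j%:Z - l%:Z) <= n%:R * t.
    by rewrite mulr_natl -[n in t *+ n]card_ord -sumr_const; apply: ler_sum.
  lra.
rewrite leNgt; apply/negP => Nt.
have e2 : 0 < e / 2 by rewrite divr_gt0.
have h0 : 0 <= `|C| / (e / 2) by apply: divr_ge0 => //; exact: ltW.
have := archi_boundP h0; rewrite ltr_pdivrMr//; set n := Num.bound _.
have := key n; have := ler_norm C.
have : n%:R * (t + e) <= n%:R * N by rewrite ler_wpM2l// ltW.
by rewrite mulrDr; lra.
Qed.

End Parseval.

(** * Translations *)

Section Shift.
Context {R : realType}.
Local Notation TR := (measurableTypeR R).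
Local Notation mu := (@lebesgue_measure R).

Definition translate (s : R) : TR -> TR := fun x => (x : R) + s.

Lemma measurable_translate s : measurable_fun [set: TR] (translate s).
Proof.
apply: continuous_measurable_fun => x.
by apply: (@cvgD _ R^o); [exact: cvg_id|exact: cvg_cst].
Qed.

HB.instance Definition _ s :=
  isMeasurableFun.Build _ _ _ _ (translate s) (measurable_translate s).

(** By uniqueness of Lebesgue measure it is enough to compare lengths of half-open intervals. *)
Lemma lebesgue_measure_translate s (A : set TR) : measurable A ->
  pushforward mu (translate s) A = mu A.
Proof.
move=> mA; apply/esym/lebesgue_measure_unique => //= _ [[a b]] _ <-.
rewrite /pushforward/=.
have -> : translate s @^-1` `]a, b] = `]a - s, b - s]%classic.
  by apply/seteqP; split => x /=; rewrite !in_itv/= /translate ltrBlDr lerBrDr.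
rewrite !lebesgue_measure_itv/= !lte_fin ltrD2r; case: ifPn => // _.
by rewrite -!EFinD; congr (_%:E); ring.
Qed.

Lemma ge0_integral_translate (s : R) (D : set TR) (f : R -> \bar R) :
  measurable D -> measurable_fun D f -> (forall x, D x -> 0 <= f x)%E ->
  (\int[mu]_(x in D) f x = \int[mu]_(x in [set x | D (x + s)%R]) f (x + s)%R)%E.
Proof.
move=> mD mf f0.
have := @ge0_integral_pushforward _ _ _ _ R _ (measurable_translate s) mu D f mD mf.
rewrite (_ : [set x | D (x + s)%R] = translate s @^-1` D)// => <-; last first.
  by move=> x /set_mem; exact: f0.
by apply: eq_measure_integral => A mA _; exact/esym/lebesgue_measure_translate.
Qed.

Lemma measurable_fun_translate d (U : measurableType d) (s : R) (D : set TR) (f : R -> U) :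
  measurable D -> measurable_fun D f ->
  measurable_fun ([set x : R | D (x + s)] : set TR) (fun x : R => f (x + s)).
Proof.
move=> mD mf; apply: (measurable_comp mD (g := translate s)) => //.
  by move=> _ [x Dx <-].
by apply: measurable_funTS; exact: measurable_translate.
Qed.

Lemma Rintegrable_translate (s : R) (D : set TR) (f : R -> R) : measurable D ->
  mu.-integrable D (EFin \o f) ->
  mu.-integrable ([set x : R | D (x + s)] : set TR) (EFin \o (fun x => f (x + s))).
Proof.
move=> mD /integrableP[/measurable_EFinP mf fi]; apply/integrableP; split.
  by apply/measurable_EFinP; exact: measurable_fun_translate.
move: fi; rewrite (ge0_integral_translate s)//.
by apply: measurableT_comp => //; exact/measurable_EFinP.
Qed.

Lemma Rintegral_translate (s : R) (D : set TR) (f : R -> R) : measurable D ->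
  measurable_fun D f ->
  \int[mu]_(x in D) f x = \int[mu]_(x in [set x : R | D (x + s)]) f (x + s).
Proof.
move=> mD mf; rewrite /Rintegral; congr fine.
rewrite integralE [RHS]integralE; congr (_ - _)%E.
  rewrite (ge0_integral_translate s)//; first by apply: eq_integral => x _; rewrite !funeposE.
  exact/measurable_funepos/measurable_EFinP.
rewrite (ge0_integral_translate s)//; first by apply: eq_integral => x _; rewrite !funenegE.
exact/measurable_funeneg/measurable_EFinP.
Qed.

Lemma Rintegral_opp (f : R -> R) : measurable_fun [set: R] f ->
  \int[mu]_x f (- x) = \int[mu]_x f x.
Proof.
have ge0 (g : R -> \bar R) : measurable_fun [set: R] g -> (forall x, 0 <= g x)%E ->
    (\int[mu]_x g (- x)%R = \int[mu]_x g x)%E.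
  move=> mg g0.
  have mN : measurable_fun [set: TR] (-%R : TR -> TR).
    by apply: continuous_measurable_fun; exact: opp_continuous.
  have := @ge0_integral_pushforward _ _ _ _ R _ mN mu setT g measurableT mg.
  rewrite preimage_setT => <-; last by move=> x _; exact: g0.
  by apply: eq_measure_integral => A mA _; exact: lebesgue_measureN.
move=> mf; rewrite /Rintegral; congr fine.
have h : measurable_fun [set: R] (EFin \o f) by exact/measurable_EFinP.
rewrite integralE [RHS]integralE; congr (_ - _)%E.
  transitivity (\int[mu]_x ((EFin \o f)^\+ (- x)%R))%E; last first.
    by apply: ge0 => //; exact: measurable_funepos.
  by apply: eq_integral => x _; rewrite !funeposE.
transitivity (\int[mu]_x ((EFin \o f)^\- (- x)%R))%E; last first.
  by apply: ge0 => //; exact: measurable_funeneg.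
by apply: eq_integral => x _; rewrite !funenegE.
Qed.

End Shift.

(** * Abel and Poisson kernels *)

Section Poisson.
Context {R : realType}.
Local Notation TR := (measurableTypeR R).
Local Notation mu := (@lebesgue_measure R).

Let mT : measurable [set: TR]. Proof. exact: measurableT. Qed.

Lemma measurable_cos1 (y : R) : measurable_fun [set: TR] (fun x : R => cos (y * x)).
Proof.
have := @measurable_cosM R y 1 [set: TR].
by congr measurable_fun; apply/funext => x; rewrite mul1r.
Qed.

Lemma measurable_sin1 (y : R) : measurable_fun [set: TR] (fun x : R => sin (y * x)).
Proof.
have := @measurable_sinM R y 1 [set: TR].
by congr measurable_fun; apply/funext => x; rewrite mul1r.
Qed.

Section abel.
Variables (e : R) (e0 : 0 < e).

Definition abel (x : R) : R := expR (- (e * `|x|)).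

Lemma abel_gt0 x : 0 < abel x. Proof. exact: expR_gt0. Qed.

Lemma abel_le1 x : abel x <= 1.
Proof. by rewrite expR_le1 oppr_le0 mulr_ge0// ltW. Qed.

Lemma abelN x : abel (- x) = abel x. Proof. by rewrite /abel normrN. Qed.

Lemma continuous_abel : continuous abel.
Proof.
move=> x; apply: continuous_comp; last exact: continuous_expR.
by apply: cvgN; apply: cvgMr; exact: norm_continuous.
Qed.

Lemma measurable_abel : measurable_fun [set: TR] abel.
Proof. by apply: continuous_measurable_fun; exact: continuous_abel. Qed.

(** Adding 1 to the cosine makes the integrand nonnegative, so the fundamental theorem on a
    half-line applies without prior integrability. The cosine integral is recovered later by
    subtracting the integral of [abel], itself the case [y = 0]. *)
Lemma integral_1Dcos_abel (y : R) :
  (\int[mu]_x ((1 + cos (y * x)) * abel x)%:E =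
   (2 * (e^-1 + e / (e ^+ 2 + y ^+ 2)))%:E)%E.
Proof.
have e20 : 0 < e ^+ 2 + y ^+ 2 by rewrite ltr_pwDl ?exprn_gt0// sqr_ge0.
have cosn t : 0 <= 1 + cos t :> R by have := cos_geN1 t; lra.
rewrite ge0_symfun_integralT; last 3 first.
- by move=> x; rewrite mulr_ge0// ltW// abel_gt0.
- move=> x; apply: (@cvgM _ R^o); last exact: continuous_abel.
  apply: (@cvgD _ R^o); first exact: cvg_cst.
  apply: continuous_comp; last exact: continuous_cos.
  by apply: cvgMr; exact: cvg_id.
- by move=> x /=; rewrite abelN mulrN cosN.
pose f (x : R) : R := (1 + cos (y * x)) * expR (- (e * x)).
(* The antiderivative that tends to 0 at infinity, so the half-line integral is [- F 0]. *)
pose F (x : R) : R := expR (- (e * x)) *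
  ((y * sin (y * x) - e * cos (y * x)) / (e ^+ 2 + y ^+ 2) - e^-1).
have dF (x : R) : is_derive x 1 F (f x).
  rewrite /F; apply: is_derive_eq.
  rewrite /GRing.scale/= /f; field.
  by rewrite !gt_eqF.
have cF : continuous F.
  by move=> x; apply: differentiable_continuous; apply/derivable1_diffP; case: (dF x).
rewrite -set_itvcy [X in (_ * X)%E](_ : _ = \int[mu]_(x in `[0%R, +oo[) (f x)%:E)%E; last first.
  apply: eq_integral => x; rewrite inE/= in_itv/= andbT => x0.
  by rewrite /f /abel ger0_norm.
rewrite (@ge0_continuous_FTC2y _ f F 0 0).
- rewrite /F !mulr0 oppr0 expR0 sin0 cos0 -EFinB -EFinM; congr (_%:E).
  by field; rewrite !gt_eqF.
- by move=> x _; rewrite mulr_ge0// ltW// expR_gt0.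
- apply: continuous_subspaceT => x; apply: (@cvgM _ R^o).
    apply: (@cvgD _ R^o); first exact: cvg_cst.
    apply: continuous_comp; last exact: continuous_cos.
    by apply: cvgMr; exact: cvg_id.
  apply: continuous_comp; last exact: continuous_expR.
  by apply: cvgN; apply: cvgMr; exact: cvg_id.
- pose K := (`|y| + e) / (e ^+ 2 + y ^+ 2) + e^-1.
  have hE : expR (- (e * x)) @[x --> +oo] --> 0.
    apply: (@cvg_comp _ _ _ (fun x => e * x) (fun x => expR (- x)) _ +oo); last exact: cvgr_expR.
    by apply: gt0_cvgMry => //; exact: cvg_id.
  have hK k : k * expR (- (e * x)) @[x --> +oo] --> 0.
    by rewrite -[X in _ --> X](mulr0 k); apply: cvgMr.
  apply: (@squeeze_cvgr _ _ _ _ (fun x => - K * expR (- (e * x)))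
    (fun x => K * expR (- (e * x)))); [|exact: hK..].
  near=> x.
  have : `|F x| <= K * expR (- (e * x)).
    rewrite /F normrM ger0_norm ?expR_ge0// mulrC ler_wpM2r ?expR_ge0//.
    rewrite (le_trans (ler_normB _ _))// lerD//; last by rewrite gtr0_norm// invr_gt0.
    rewrite normrM [`|_^-1|]gtr0_norm ?invr_gt0// ler_wpM2r ?invr_ge0 ?(ltW e20)//.
    rewrite (le_trans (ler_normB _ _))// !normrM lerD//.
      by rewrite ler_piMr// sin_max.
    by rewrite gtr0_norm// ler_piMr ?(ltW e0)// cos_max.
  by rewrite ler_norml mulNr.
- by move=> x _; case: (dF x).
- by apply: cvg_at_right_filter; exact: cF.
- by move=> x _; rewrite derive1E; case: (dF x).
Unshelve. all: by end_near. Qed.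

Lemma Rintegrable_abel : mu.-integrable [set: TR] (EFin \o abel).
Proof.
have h := integral_1Dcos_abel 0.
apply/integrableP; split; first by apply/measurable_EFinP; exact: measurable_abel.
under eq_integral do rewrite /= gtr0_norm ?abel_gt0//.
apply: (@le_lt_trans _ _ (\int[mu]_x ((1 + cos (0 * x)) * abel x)%:E)%E).
  apply: ge0_le_integral => //.
  - by move=> x _; rewrite lee_fin ltW// abel_gt0.
  - by apply/measurable_EFinP; exact: measurable_abel.
  - apply/measurable_EFinP; apply: measurable_funM; last exact: measurable_abel.
  - by apply: measurable_funD => //; exact: measurable_cos1.
  - move=> x _; rewrite lee_fin mul0r cos0.
    by rewrite ler_peMl ?ltW ?abel_gt0//; lra.
by rewrite h ltry.
Qed.

Lemma Rintegrable_Mabel (k : R -> R) : measurable_fun [set: TR] k ->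
  (forall x, `|k x| <= 1) ->
  mu.-integrable [set: TR] (EFin \o (fun x => k x * abel x)).
Proof.
move=> mk k1; apply: (eq_Rintegrable mT (f := fun x => abel x * k x)).
  by move=> x _; rewrite mulrC.
exact: (RintegrableMb mT Rintegrable_abel mk (fun x _ => k1 x)).
Qed.

Lemma Rintegrable_cos_abel (y : R) :
  mu.-integrable [set: TR] (EFin \o (fun x => cos (y * x) * abel x)).
Proof.
by apply: Rintegrable_Mabel; [exact: measurable_cos1|move=> x; exact: cos_max].
Qed.

Lemma Rintegral_cos_abel (y : R) :
  \int[mu]_x (cos (y * x) * abel x) = 2 * e / (e ^+ 2 + y ^+ 2).
Proof.
have e20 z : 0 < e ^+ 2 + z ^+ 2 by rewrite ltr_pwDl ?exprn_gt0// sqr_ge0.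
have h z : \int[mu]_x ((1 + cos (z * x)) * abel x) = 2 * (e^-1 + e / (e ^+ 2 + z ^+ 2)).
  by rewrite /Rintegral integral_1Dcos_abel.
have ia := Rintegrable_abel; have ic := Rintegrable_cos_abel y.
have h0 : \int[mu]_x abel x = 2 / e.
  have := h 0; under eq_Rintegral do rewrite mul0r cos0.
  rewrite RintegralZl// => h0.
  have -> : \int[mu]_x abel x = 2^-1 * ((1 + 1) * \int[mu]_x abel x) by field.
  by rewrite h0; field; rewrite !gt_eqF// -[X in X + _](expr2 e).
have := h y; under eq_Rintegral do rewrite mulrDl mul1r.
rewrite RintegralD// h0 => h1; apply: (addrI (2 / e)); rewrite h1; field.
by rewrite !gt_eqF.
Qed.

Lemma Rintegral_sin_abel (y : R) : \int[mu]_x (sin (y * x) * abel x) = 0.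
Proof.
have ms : measurable_fun [set: R] (fun x => sin (y * x) * abel x).
  by apply: measurable_funM; [exact: measurable_sin1|exact: measurable_abel].
have is' : mu.-integrable [set: TR] (EFin \o (fun x => sin (y * x) * abel x)).
  by apply: Rintegrable_Mabel; [exact: measurable_sin1|move=> x; exact: sin_max].
have := Rintegral_opp ms; under eq_Rintegral do rewrite abelN mulrN sinN mulNr -mulN1r.
by rewrite RintegralZl//; lra.
Qed.

End abel.

(** The transform of [abel e]: the Poisson kernel of the half-plane scaled by [2 * pi], hence of
    total integral [2 * pi]. *)
Definition poisson (e y : R) : R := 2 * e / (e ^+ 2 + y ^+ 2).

Section poisson.
Variables (e x0 : R) (e0 : 0 < e).

Let den y : 0 < e ^+ 2 + y ^+ 2.
Proof. by rewrite ltr_pwDl ?exprn_gt0// sqr_ge0. Qed.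

Lemma poisson_ge0 y : 0 <= poisson e y.
Proof. by rewrite divr_ge0// ltW// mulr_gt0. Qed.

Lemma continuous_poisson : continuous (poisson e).
Proof.
move=> x; apply: cvgMr; apply: (@cvgV _ R^o); first by rewrite gt_eqF.
apply: (@cvgD _ R^o); first exact: cvg_cst.
by apply: exprn_continuous.
Qed.

Lemma measurable_poisson : measurable_fun [set: TR] (fun x : R => poisson e (x - x0)).
Proof.
apply: continuous_measurable_fun => x; apply: (@continuous_comp _ _ _ (fun x => x - x0)).
  by apply: (@cvgB _ R^o); [exact: cvg_id|exact: cvg_cst].
exact: continuous_poisson.
Qed.

Lemma integral_poisson0 : (\int[mu]_x (poisson e x)%:E = (2 * pi)%:E)%E.
Proof.
rewrite ge0_symfun_integralT; last 3 first.
- exact: poisson_ge0.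
- exact: continuous_poisson.
- by move=> x; rewrite /poisson/= sqrrN.
pose F (x : R) : R := 2 * atan (x / e).
have dF (x : R) : is_derive x 1 F (poisson e x).
  rewrite /F; apply: is_derive_eq.
  rewrite /GRing.scale/= /poisson; field.
  by rewrite !gt_eqF.
have cF : continuous F.
  by move=> x; apply: differentiable_continuous; apply/derivable1_diffP; case: (dF x).
rewrite -set_itvcy (@ge0_continuous_FTC2y _ (poisson e) F 0 pi).
- by rewrite /F mul0r atan0 mulr0 sube0 EFinM.
- by move=> x _; exact: poisson_ge0.
- by apply: continuous_subspaceT => x; exact: continuous_poisson.
- rewrite (_ : pi = 2 * (pi / 2)); last by field.
  apply: cvgMr; apply: (@cvg_comp _ _ _ (fun x => x / e) atan _ +oo); last exact: cvgy_atan.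
  by apply: gt0_cvgMly; [rewrite invr_gt0|exact: cvg_id].
- by move=> x _; case: (dF x).
- by apply: cvg_at_right_filter; exact: cF.
- by move=> x _; rewrite derive1E; case: (dF x).
Qed.

Lemma integral_poisson : (\int[mu]_x (poisson e (x - x0))%:E = (2 * pi)%:E)%E.
Proof.
rewrite (ge0_integral_translate x0)//.
- rewrite -integral_poisson0; rewrite (_ : [set x : R | _] = setT); last by apply/seteqP.
  by apply: eq_integral => x _; rewrite addrK.
- by apply/measurable_EFinP; exact: measurable_poisson.
- by move=> x _; rewrite lee_fin poisson_ge0.
Qed.

Lemma Rintegrable_poisson :
  mu.-integrable [set: TR] (EFin \o (fun x : R => poisson e (x - x0))).
Proof.
apply/integrableP; split; first by apply/measurable_EFinP; exact: measurable_poisson.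
under eq_integral do rewrite /= ger0_norm ?poisson_ge0//.
by rewrite integral_poisson ltry.
Qed.

Lemma Rintegral_poisson : \int[mu]_x poisson e (x - x0) = 2 * pi.
Proof. by rewrite /Rintegral integral_poisson. Qed.

End poisson.
End Poisson.

(** * Fourier inversion for band-limited functions *)

Section RealFubini.
Context {R : realType}.
Local Notation TR := (measurableTypeR R).
Local Notation mu := (@lebesgue_measure R).

Let mT : measurable [set: TR]. Proof. exact: measurableT. Qed.

(** Tonelli gives measurability of the integrals of the positive and negative parts; [fine] of their
    difference is then measurable. *)
Lemma measurable_Rintegral (F : TR * TR -> R) : measurable_fun [set: TR * TR] F ->
  measurable_fun [set: TR] (fun y : TR => \int[mu]_x F (x, y)).
Proof.
move=> mF; have mE : measurable_fun [set: TR * TR] (EFin \o F) by exact/measurable_EFinP.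
apply: measurableT_comp => //.
have -> : (fun y : TR => \int[mu]_x (F (x, y))%:E)%E =
  (fun y : TR => \int[mu]_x (EFin \o F)^\+ (x, y) - \int[mu]_x (EFin \o F)^\- (x, y))%E.
  apply/funext => y; rewrite integralE; congr (_ - _)%E.
    by apply: eq_integral => x _; rewrite !funeposE.
  by apply: eq_integral => x _; rewrite !funenegE.
apply: emeasurable_funB.
  apply: (@measurable_fun_fubini_tonelli_G _ _ TR TR R mu (EFin \o F)^\+)%E => //.
  exact: measurable_funepos.
apply: (@measurable_fun_fubini_tonelli_G _ _ TR TR R mu (EFin \o F)^\-)%E => //.
exact: measurable_funeneg.
Qed.

Section kernel.
Variables (p h : R -> R) (K : TR * TR -> R).
Hypotheses (ip : mu.-integrable [set: TR] (EFin \o p))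
  (ih : mu.-integrable [set: TR] (EFin \o h))
  (mK : measurable_fun [set: TR * TR] K) (K1 : forall z, `|K z| <= 1).

Let F (z : TR * TR) : R := p z.1 * K z * h z.2.

Let mF : measurable_fun [set: TR * TR] F.
Proof.
apply: measurable_funM; first apply: measurable_funM => //.
  by apply: measurableT_comp measurable_fst; exact: Rintegrable_measurable ip.
by apply: measurableT_comp measurable_snd; exact: Rintegrable_measurable ih.
Qed.

Let mK1 y : measurable_fun [set: TR] (fun x => K (x, y)).
Proof. by apply: (measurableT_comp mK); exact: pair2_measurable. Qed.

Let mK2 x : measurable_fun [set: TR] (fun y => K (x, y)).
Proof. by apply: (measurableT_comp mK); exact: pair1_measurable. Qed.

Lemma Rintegrable_kernel1 y : mu.-integrable [set: TR] (EFin \o (fun x => p x * K (x, y))).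
Proof. exact: (RintegrableMb mT ip (mK1 y) (fun x _ => K1 (x, y))). Qed.

Lemma Rintegrable_kernel2 x : mu.-integrable [set: TR] (EFin \o (fun y => K (x, y) * h y)).
Proof.
apply: (eq_Rintegrable mT (f := fun y => h y * K (x, y))); first by move=> y _; rewrite mulrC.
exact: (RintegrableMb mT ih (mK2 x) (fun y _ => K1 (x, y))).
Qed.

(** As [|K| <= 1], [F] is dominated by [|p x| * |h y|], whose double integral is a product of two
    finite ones. *)
Let iF : (mu \x mu)%E.-integrable [set: TR * TR] (EFin \o F).
Proof.
apply/integrable12ltyP; first exact/measurable_EFinP.
have mp := Rintegrable_measurable ip; have mh := Rintegrable_measurable ih.
have mE (f : TR -> R) : measurable_fun [set: TR] f ->
    measurable_fun [set: TR] (fun x => `|(f x)%:E|)%E.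
  by move=> mf; apply: measurableT_comp => //; exact/measurable_EFinP.
have hp : (\int[mu]_x `|(p x)%:E| < +oo)%E by case/integrableP : ip.
have hh : (\int[mu]_x `|(h x)%:E| < +oo)%E by case/integrableP : ih.
have H0 : (0 <= \int[mu]_x `|(h x)%:E|)%E by apply: integral_ge0.
apply: (@le_lt_trans _ _ (\int[mu]_x (\int[mu]_y `|(h y)%:E| * `|(p x)%:E|))%E).
  apply: ge0_le_integral => //.
  - by move=> x _; apply: integral_ge0.
  - have mEF : measurable_fun [set: TR * TR] (fun z => `|(F z)%:E|)%E.
      by apply: measurableT_comp => //; exact/measurable_EFinP.
    exact: (@measurable_fun_fubini_tonelli_F _ _ TR TR R mu (fun z => `|(F z)%:E|)%E mEF).
  - by apply: emeasurable_funM; [exact: measurable_cst|exact: mE].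
  move=> x _; rewrite -ge0_integralZr//; last exact: mE.
  apply: ge0_le_integral => //.
  - apply: (mE (fun y => F (x, y))).
    by apply: (measurableT_comp mF); exact: pair1_measurable.
  - by apply: emeasurable_funM; [exact: mE|exact: measurable_cst].
  move=> y _; rewrite /F/= lee_fin !normrM mulrC ler_wpM2l//.
  by rewrite ler_piMr.
rewrite ge0_integralZl//; last exact: mE.
rewrite lte_mul_pinfty// ge0_fin_numE//.
Qed.

Let mI1 : measurable_fun [set: TR] (fun y : TR => \int[mu]_x (p x * K (x, y))).
Proof.
apply: (measurable_Rintegral (F := fun z => p z.1 * K z)).
apply: measurable_funM => //.
by apply: measurableT_comp measurable_fst; exact: Rintegrable_measurable ip.
Qed.

Lemma kernel_integral_bounded y :
  `|\int[mu]_x (p x * K (x, y))| <= \int[mu]_x `|p x|.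
Proof.
apply: (le_trans (le_normr_Rintegral mT (Rintegrable_kernel1 y))).
apply: le_Rintegral => //.
- exact: (integrable_norm (Rintegrable_kernel1 y)).
- exact: (integrable_norm ip).
- by move=> x _; rewrite normrM ler_piMr.
Qed.

Lemma Rintegrable_kernel : mu.-integrable [set: TR]
  (EFin \o (fun y : TR => (\int[mu]_x (p x * K (x, y))) * h y)).
Proof.
apply: (eq_Rintegrable mT (f := fun y => h y * \int[mu]_x (p x * K (x, y)))).
  by move=> y _; rewrite mulrC.
exact: (RintegrableMb mT ih mI1 (fun y _ => kernel_integral_bounded y)).
Qed.

Lemma Rfubini : \int[mu]_y ((\int[mu]_x (p x * K (x, y))) * h y) =
  \int[mu]_x (p x * \int[mu]_y (K (x, y) * h y)).
Proof.
rewrite /Rintegral; congr fine.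
transitivity (\int[mu]_y \int[mu]_x (EFin \o F) (x, y))%E.
  apply: eq_integral => y _.
  rewrite -[LHS]/(((\int[mu]_x (p x * K (x, y))) * h y)%:E) -RintegralZr//; last first.
    exact: Rintegrable_kernel1.
  rewrite EFin_Rintegral//.
  apply: (eq_Rintegrable mT (f := fun x => h y * (p x * K (x, y)))).
    by move=> x _; rewrite mulrC.
  by apply: RintegrableZl => //; exact: Rintegrable_kernel1.
rewrite -(Fubini iF); apply: eq_integral => x _.
rewrite -[RHS]/((p x * \int[mu]_y (K (x, y) * h y))%:E) -RintegralZl//; last first.
  exact: Rintegrable_kernel2.
rewrite EFin_Rintegral//; last by apply: RintegrableZl => //; exact: Rintegrable_kernel2.
by apply: eq_integral => y _; rewrite /F/= mulrA.
Qed.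

End kernel.
End RealFubini.

Section Inversion.
Context {R : realType}.
Local Notation TR := (measurableTypeR R).
Local Notation mu := (@lebesgue_measure R).

Let mT : measurable [set: TR]. Proof. exact: measurableT. Qed.

Let measurable_cos : measurable_fun [set: R] (@cos R).
Proof. by apply: continuous_measurable_fun; exact: continuous_cos. Qed.

Let measurable_sin : measurable_fun [set: R] (@sin R).
Proof. by apply: continuous_measurable_fun; exact: continuous_sin. Qed.

Lemma measurable_cos_kernel (x0 : R) :
  measurable_fun [set: TR * TR] (fun z : TR * TR => cos (((z.1 : R) - x0) * z.2)).
Proof.
apply: (measurableT_comp measurable_cos); apply: measurable_funM; last exact: measurable_snd.
by apply: measurable_funB => //; exact: measurable_fst.
Qed.

Lemma measurable_sin_kernel (x0 : R) :
  measurable_fun [set: TR * TR] (fun z : TR * TR => sin (((z.1 : R) - x0) * z.2)).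
Proof.
apply: (measurableT_comp measurable_sin); apply: measurable_funM; last exact: measurable_snd.
by apply: measurable_funB => //; exact: measurable_fst.
Qed.

(** Together with [fourier_im], the transform of [p + i q] in real coordinates. *)
Definition fourier_re (p q : R -> R) (y : R) : R :=
  \int[mu]_x (p x * cos (x * y) + q x * sin (x * y)).

Definition fourier_im (p q : R -> R) (y : R) : R :=
  \int[mu]_x (q x * cos (x * y) - p x * sin (x * y)).

Section abel_poisson.
Variables (p q : R -> R).
Hypotheses (ip : mu.-integrable [set: TR] (EFin \o p))
  (iq : mu.-integrable [set: TR] (EFin \o q)).

Let mp := Rintegrable_measurable ip.
Let mq := Rintegrable_measurable iq.

Lemma measurable_fourier_re : measurable_fun [set: TR] (fourier_re p q).
Proof.
apply: (measurable_Rintegral (F := fun z : TR * TR =>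
  p z.1 * cos ((z.1 : R) * z.2) + q z.1 * sin ((z.1 : R) * z.2))).
have m12 : measurable_fun [set: TR * TR] (fun z : TR * TR => (z.1 : R) * z.2).
  by apply: measurable_funM; [exact: measurable_fst|exact: measurable_snd].
apply: measurable_funD; apply: measurable_funM.
- exact: (measurableT_comp mp measurable_fst).
- exact: (measurableT_comp measurable_cos m12).
- exact: (measurableT_comp mq measurable_fst).
- exact: (measurableT_comp measurable_sin m12).
Qed.

Lemma measurable_fourier_im : measurable_fun [set: TR] (fourier_im p q).
Proof.
apply: (measurable_Rintegral (F := fun z : TR * TR =>
  q z.1 * cos ((z.1 : R) * z.2) - p z.1 * sin ((z.1 : R) * z.2))).
have m12 : measurable_fun [set: TR * TR] (fun z : TR * TR => (z.1 : R) * z.2).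
  by apply: measurable_funM; [exact: measurable_fst|exact: measurable_snd].
apply: measurable_funB; apply: measurable_funM.
- exact: (measurableT_comp mq measurable_fst).
- exact: (measurableT_comp measurable_cos m12).
- exact: (measurableT_comp mp measurable_fst).
- exact: (measurableT_comp measurable_sin m12).
Qed.

(** The left side is the real part of the transform times [e^{i x0 y}]; modulation in frequency
    replaces [x] by [x - x0] in the phase. *)
Lemma fourier_modulate (x0 y : R) :
  fourier_re p q y * cos (x0 * y) - fourier_im p q y * sin (x0 * y) =
  \int[mu]_x (p x * cos ((x - x0) * y)) + \int[mu]_x (q x * sin ((x - x0) * y)).
Proof.
have ic (f : R -> R) : mu.-integrable [set: TR] (EFin \o f) ->
    mu.-integrable [set: TR] (EFin \o (fun x => f x * cos (x * y))).
  move=> hf; have := Rintegrable_kernel1 hf (measurable_cos_kernel 0) (fun _ => cos_max _) y.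
  by congr (integrable _ _ _); apply/funext => x /=; rewrite subr0.
have is' (f : R -> R) : mu.-integrable [set: TR] (EFin \o f) ->
    mu.-integrable [set: TR] (EFin \o (fun x => f x * sin (x * y))).
  move=> hf; have := Rintegrable_kernel1 hf (measurable_sin_kernel 0) (fun _ => sin_max _) y.
  by congr (integrable _ _ _); apply/funext => x /=; rewrite subr0.
have ipc := ic _ ip; have iqc := ic _ iq; have ips := is' _ ip; have iqs := is' _ iq.
rewrite /fourier_re /fourier_im RintegralD// RintegralB//.
have -> : \int[mu]_x (p x * cos ((x - x0) * y)) =
    cos (x0 * y) * \int[mu]_x (p x * cos (x * y)) + sin (x0 * y) * \int[mu]_x (p x * sin (x * y)).
  rewrite -Rintegral_lin2//; apply: eq_Rintegral => x _.
  by rewrite mulrBl cosB; ring.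
have -> : \int[mu]_x (q x * sin ((x - x0) * y)) =
    cos (x0 * y) * \int[mu]_x (q x * sin (x * y)) +
    (- sin (x0 * y)) * \int[mu]_x (q x * cos (x * y)).
  rewrite -Rintegral_lin2//; apply: eq_Rintegral => x _.
  by rewrite mulrBl sinB; ring.
ring.
Qed.

(** Fubini moves the transform onto [abel e]: its cosine transform is the Poisson kernel, and its
    sine transform vanishes by oddness, which eliminates [q]. *)
Lemma abel_poisson (e x0 : R) : 0 < e ->
  mu.-integrable [set: TR] (EFin \o (fun y =>
    (fourier_re p q y * cos (x0 * y) - fourier_im p q y * sin (x0 * y)) * abel e y)) /\
  \int[mu]_y ((fourier_re p q y * cos (x0 * y) - fourier_im p q y * sin (x0 * y)) * abel e y) =
  \int[mu]_x (p x * poisson e (x - x0)).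
Proof.
move=> e0; have ia := Rintegrable_abel e0.
have mc := measurable_cos_kernel x0; have ms := measurable_sin_kernel x0.
have i1 := Rintegrable_kernel ip ia mc (fun _ => cos_max _).
have i2 := Rintegrable_kernel iq ia ms (fun _ => sin_max _).
have E y : (fourier_re p q y * cos (x0 * y) - fourier_im p q y * sin (x0 * y)) * abel e y =
    (\int[mu]_x (p x * cos ((x - x0) * y))) * abel e y +
    (\int[mu]_x (q x * sin ((x - x0) * y))) * abel e y.
  by rewrite fourier_modulate mulrDl.
split.
  by apply: (eq_Rintegrable mT _ (RintegrableD mT i1 i2)) => y _; rewrite E.
under eq_Rintegral do rewrite E.
rewrite RintegralD//.
rewrite (Rfubini ip ia mc (fun _ => cos_max _)) (Rfubini iq ia ms (fun _ => sin_max _))/=.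
rewrite [X in _ + X](_ : _ = 0) ?addr0.
  by apply: eq_Rintegral => x _; rewrite Rintegral_cos_abel.
under eq_Rintegral do rewrite Rintegral_sin_abel// mulr0.
by rewrite /Rintegral integral0.
Qed.

End abel_poisson.

(** The Poisson kernels form an approximate identity. Near [x0] continuity of [p] controls the
    error; away from it the kernel is at most a multiple of [e * poisson 1], which is square
    integrable and so integrable against [p]. *)
Lemma poisson_approx (p : R -> R) (x0 : R) (d : R) :
  measurable_fun [set: TR] p -> mu.-integrable [set: TR] (EFin \o (fun x => p x ^+ 2)) ->
  {for x0, continuous p} -> 0 < d ->
  exists2 r, 0 < r & forall e, 0 < e -> e < r ->
    mu.-integrable [set: TR] (EFin \o (fun x => p x * poisson e (x - x0))) /\
    `|\int[mu]_x (p x * poisson e (x - x0)) - 2 * pi * p x0| <= d.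
Proof.
move=> mp ip2 cp d0.
have pi0 : 0 < pi :> R := pi_gt0 R.
have aux (u v w : R) : u <= d / 2 -> v <= d / 2 -> w <= u + v -> w <= d by lra.
have o0 : 0 < d / (4 * pi) by rewrite divr_gt0// mulr_gt0.
set o := d / (4 * pi) in o0.
have oE : o * (2 * pi) = d / 2.
  rewrite /o; move: (pi : R) pi0 => P P0.
  by field; rewrite gt_eqF.
have /cvgrPdist_lt/(_ _ o0) := cp.
move=> /nbhs_ballP[s /= s0 hs].
(* With [Y = (x - x0) ^+ 2 >= s ^+ 2] one has [1 + Y <= C * Y], hence
   [poisson e <= e * C * poisson 1] at distance at least [s] from [x0]. *)
pose C := 1 + s ^- 2.
have C0 : 0 < C by rewrite /C addr_gt0// invr_gt0 exprn_gt0.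
pose g (x : R) : R := poisson 1 (x - x0).
have ig : mu.-integrable [set: TR] (EFin \o g) by exact: Rintegrable_poisson.
have mg : measurable_fun [set: TR] g by exact: measurable_poisson.
have g0 x : 0 <= g x by exact: poisson_ge0.
have ig2 : mu.-integrable [set: TR] (EFin \o (fun x => g x ^+ 2)).
  apply: (@le_Rintegrable _ _ _ _ _ mT _ (fun x => 2 * g x)); first exact: measurable_funX.
    move=> x _; rewrite ger0_norm ?sqr_ge0// expr2 ler_wpM2r//.
    rewrite /g /poisson expr1n mulr1 ler_pdivrMr ?ltr_pwDl ?sqr_ge0//.
    by have := sqr_ge0 (x - x0); lra.
  exact: RintegrableZl.
have ipg : mu.-integrable [set: TR] (EFin \o (fun x => p x * g x)) by exact: RintegrableM.
have inpg : mu.-integrable [set: TR] (EFin \o (fun x => `|p x * g x|)).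
  exact: (integrable_norm ipg).
have iQ := Rintegrable_lin2 mT C (C * `|p x0|) inpg ig.
set Q := (fun x => _) in iQ.
have Q0 x : 0 <= Q x.
  by rewrite /Q addr_ge0// mulr_ge0// ?mulr_ge0// ltW.
pose J := \int[mu]_x Q x.
have J0 : 0 <= J by apply: Rintegral_ge0.
have r0 : 0 < d / (2 * (J + 1)) by rewrite divr_gt0// mulr_gt0// ltr_wpDl.
exists (Num.min 1 (d / (2 * (J + 1)))); first by rewrite lt_min ltr01.
move=> e e0; rewrite lt_min => /andP[e1 er].
have iP := Rintegrable_poisson x0 e0.
have mP := measurable_poisson x0 e0.
have key x : `|(p x - p x0) * poisson e (x - x0)| <= o * poisson e (x - x0) + e * Q x.
  rewrite normrM (ger0_norm (poisson_ge0 e0 _)).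
  have P0 := poisson_ge0 e0 (x - x0).
  have [xs|xs] := ltP `|x0 - x| s.
    rewrite -[leLHS]addr0 lerD//; last by rewrite mulr_ge0// ltW.
    by rewrite ler_wpM2r// ltW// distrC hs.
  rewrite -[leLHS]add0r lerD//; first by rewrite mulr_ge0// ltW.
  have y0 : 0 < (x - x0) ^+ 2.
    rewrite -real_normK ?num_real// exprn_gt0// distrC.
    exact: lt_le_trans xs.
  have hy : s ^+ 2 <= (x - x0) ^+ 2.
    by rewrite -[leRHS]real_normK ?num_real// distrC lerXn2r// ?nnegrE// ltW.
  have hP : poisson e (x - x0) <= e * C * g x.
    rewrite /poisson /g /poisson expr1n mulr1 /C.
    have den : 0 < e ^+ 2 + (x - x0) ^+ 2 by rewrite ltr_wpDl ?sqr_ge0.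
    rewrite ler_pdivrMr//.
    have s20 : 0 < s ^+ 2 by rewrite exprn_gt0.
    set Y := (x - x0) ^+ 2 in y0 hy *.
    have h1 : 1 + Y <= (1 + s ^- 2) * Y.
      rewrite mulrDl mul1r addrC lerD2l mulrC -ler_pdivrMr ?invr_gt0//.
      by rewrite invrK mul1r.
    have Y10 : 0 < 1 + Y by rewrite addr_gt0.
    have h2 : 1 <= (1 + s ^- 2) * (1 + Y)^-1 * Y.
      by rewrite mulrAC ler_pdivlMr// mul1r.
    have Z0 : 0 <= (1 + s ^- 2) * (1 + Y)^-1.
      by rewrite mulr_ge0 ?ltW// ?invr_gt0.
    have h3 : 1 <= (1 + s ^- 2) * (1 + Y)^-1 * (e ^+ 2 + Y).
      by apply: (le_trans h2); rewrite ler_wpM2l// lerDr sqr_ge0.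
    have := ler_wpM2l (ltW (mulr_gt0 (ltr0n R 2) e0)) h3.
    by congr (_ <= _); ring.
  apply: (@le_trans _ _ ((`|p x| + `|p x0|) * (e * C * g x))).
    by rewrite ler_pM// ler_normB.
  by rewrite /Q normrM (ger0_norm (g0 x)) le_eqVlt; apply/predU1P; left; ring.
have iK := Rintegrable_lin2 mT o e iP iQ.
have mpP : measurable_fun [set: TR] (fun x : R => (p x - p x0) * poisson e (x - x0)).
  by apply: measurable_funM => //; apply: measurable_funB.
have id : mu.-integrable [set: TR] (EFin \o (fun x : R => (p x - p x0) * poisson e (x - x0))).
  by apply: (@le_Rintegrable _ _ _ _ _ mT _ _ mpP _ iK) => x _; exact: key.
have iz := RintegrableZl mT (p x0) iP.
split.
  by apply: (eq_Rintegrable mT _ (RintegrableD mT id iz)) => x _; ring.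
have -> : \int[mu]_x (p x * poisson e (x - x0)) - 2 * pi * p x0 =
    \int[mu]_x ((p x - p x0) * poisson e (x - x0)).
  rewrite -(Rintegral_poisson x0 e0) mulrC -RintegralZl//.
  rewrite [LHS](_ : _ = \int[mu]_x ((p x - p x0) * poisson e (x - x0) + p x0 * poisson e (x - x0)) -
    \int[mu]_x (p x0 * poisson e (x - x0))); last first.
    by congr (_ - _); apply: eq_Rintegral => x _; ring.
  by rewrite RintegralD// addrK.
apply: (aux (o * (2 * pi)) (e * J)).
- by rewrite oE.
- rewrite (le_trans (ler_wpM2r J0 (ltW er)))// mulrAC ler_pdivrMr ?mulr_gt0 ?ltr_wpDl//.
  have : d * J <= d * (J + 1) by rewrite ler_wpM2l ?ltW// ltrDl.
  by lra.
rewrite -(Rintegral_poisson x0 e0) -Rintegral_lin2//.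
apply: (le_trans (le_normr_Rintegral mT id)); apply: le_Rintegral => //.
exact: (integrable_norm id).
Qed.

End Inversion.

Section Inversion.
Context {R : realType}.
Local Notation TR := (measurableTypeR R).
Local Notation mu := (@lebesgue_measure R).

Let mT : measurable [set: TR]. Proof. exact: measurableT. Qed.

(** The truncations of [is_fourier2]. They turn a square integrable function into an integrable one,
    to which [abel_poisson] applies. *)
Definition truncation (f : R -> R) (n : nat) (x : R) : R :=
  f x * \1_(`[- n%:R, n%:R]%classic) x.

Lemma measurable_truncation (f : R -> R) n : measurable_fun [set: TR] f ->
  measurable_fun [set: TR] (truncation f n).
Proof. by move=> mf; apply: measurable_funM => //; exact: measurable_indic. Qed.

Lemma le_truncation (f : R -> R) n x : `|truncation f n x| <= `|f x|.
Proof.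
rewrite /truncation normrM ler_piMr// indicE.
by case: (_ \in _); rewrite ?normr1 ?normr0.
Qed.

Lemma Rintegrable_truncation (f : R -> R) n : measurable_fun [set: TR] f ->
  mu.-integrable [set: TR] (EFin \o (fun x => f x ^+ 2)) ->
  mu.-integrable [set: TR] (EFin \o truncation f n).
Proof.
move=> mf if2.
pose g (x : R) : R := \1_(`[- n%:R, n%:R]%classic) x.
have mg : measurable_fun [set: TR] g by exact: measurable_indic.
have ig : mu.-integrable [set: TR] (EFin \o g).
  exact: (@integrable_indic_itv R (- n%:R) n%:R true false).
apply: (@RintegrableM _ _ _ _ _ mT f g) => //.
apply: (eq_Rintegrable mT _ ig) => x _.
by rewrite /g indicE; case: (_ \in _); rewrite ?expr1n ?expr0n.
Qed.

(** Both sides of [abel_poisson] for the truncations pass to the limit: the Poisson side by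
    dominated convergence, the frequency side because mean-square convergence survives pairing with
    the square integrable [abel e]. *)
Lemma abel_poisson_L2 (p q alpha beta : R -> R) (x0 e : R) :
  measurable_fun [set: TR] p -> measurable_fun [set: TR] q ->
  measurable_fun [set: TR] alpha -> measurable_fun [set: TR] beta ->
  mu.-integrable [set: TR] (EFin \o (fun x => p x ^+ 2)) ->
  mu.-integrable [set: TR] (EFin \o (fun x => q x ^+ 2)) ->
  mu.-integrable [set: TR] (EFin \o (fun x => alpha x ^+ 2)) ->
  mu.-integrable [set: TR] (EFin \o (fun x => beta x ^+ 2)) ->
  (\int[mu]_y ((alpha y - fourier_re (truncation p n) (truncation q n) y) ^+ 2 +
    (beta y - fourier_im (truncation p n) (truncation q n) y) ^+ 2)%:E)%E
    @[n --> \oo] --> 0%E ->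
  0 < e ->
  mu.-integrable [set: TR] (EFin \o (fun x => p x * poisson e (x - x0))) ->
  mu.-integrable [set: TR] (EFin \o (fun y =>
    (alpha y * cos (x0 * y) - beta y * sin (x0 * y)) * abel e y)) /\
  \int[mu]_y ((alpha y * cos (x0 * y) - beta y * sin (x0 * y)) * abel e y) =
  \int[mu]_x (p x * poisson e (x - x0)).
Proof.
move=> mp mq ma mb ip2 iq2 ia2 ib2 cv e0 ipP.
have aux (A B z d : R) : `|A - z| <= d / 2 -> `|B - z| <= d / 2 -> `|A - B| <= d.
  by rewrite !ler_norml => /andP[? ?] /andP[? ?]; apply/andP; split; lra.
have ih := Rintegrable_abel e0.
have mh := measurable_abel e.
have mP := measurable_poisson x0 e0.
have ih2 : mu.-integrable [set: TR] (EFin \o (fun y => abel e y ^+ 2)).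
  apply: (@le_Rintegrable _ _ _ _ _ mT _ (abel e)) => //; first exact: measurable_funX.
  move=> x _; rewrite ger0_norm ?sqr_ge0// expr2 ler_piMr ?abel_le1//.
  exact/ltW/abel_gt0.
have mc := measurable_cos1 x0; have ms := measurable_sin1 x0.
have icg (f : R -> R) : measurable_fun [set: TR] f ->
    mu.-integrable [set: TR] (EFin \o (fun x => f x ^+ 2)) ->
    mu.-integrable [set: TR] (EFin \o (fun y => f y * cos (x0 * y) * abel e y)).
  move=> mf if2; have ifh := RintegrableM mT mf mh if2 ih2.
  apply: (eq_Rintegrable mT _ (RintegrableMb mT ifh mc (fun x _ => cos_max _))).
  by move=> y _; ring.
have isg (f : R -> R) : measurable_fun [set: TR] f ->
    mu.-integrable [set: TR] (EFin \o (fun x => f x ^+ 2)) ->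
    mu.-integrable [set: TR] (EFin \o (fun y => f y * sin (x0 * y) * abel e y)).
  move=> mf if2; have ifh := RintegrableM mT mf mh if2 ih2.
  apply: (eq_Rintegrable mT _ (RintegrableMb mT ifh ms (fun x _ => sin_max _))).
  by move=> y _; ring.
have iG : mu.-integrable [set: TR] (EFin \o (fun y =>
    (alpha y * cos (x0 * y) - beta y * sin (x0 * y)) * abel e y)).
  apply: (eq_Rintegrable mT _ (RintegrableB mT (icg _ ma ia2) (isg _ mb ib2))).
  by move=> y _; ring.
split => //; apply/eqP; rewrite -subr_eq0 -normr_le0; apply/ler_addgt0Pr => d d0.
rewrite add0r.
have d20 : 0 < d / 2 by rewrite divr_gt0.
pose z n := \int[mu]_x (truncation p n x * poisson e (x - x0)).
pose H := \int[mu]_y abel e y.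
have H0 : 0 <= H by apply: Rintegral_ge0 => x _; exact/ltW/abel_gt0.
(* The weight of the coming inequality: [(4 * K)^-1 * H] is at most [d / 4], and the mean-square
   error is then asked to be below [d / (8 * K)] so that [2 * K] times it is also at most
   [d / 4]. *)
pose K := H / d + 1.
have K0 : 0 < K by rewrite ltr_wpDl// divr_ge0// ltW.
have HK : (4 * K)^-1 * H <= d / 4.
  rewrite mulrC ler_pdivrMr ?mulr_gt0// /K.
  have -> : d / 4 * (4 * (H / d + 1)) = H + d by field; rewrite gt_eqF.
  by rewrite lerDl ltW.
have K40 : 0 < d / (8 * K) by rewrite divr_gt0// mulr_gt0.
have zlim : \forall n \near \oo, `|\int[mu]_x (p x * poisson e (x - x0)) - z n| <= d / 2.
  have mz n : measurable_fun [set: TR] (fun x : TR => (truncation p n x * poisson e (x - x0))%:E).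
    by apply/measurable_EFinP; apply: measurable_funM => //; exact: measurable_truncation.
  have mpP : measurable_fun [set: TR] (fun x : TR => (p x * poisson e (x - x0))%:E).
    by apply/measurable_EFinP; apply: measurable_funM.
  have zc : {ae mu, forall x : TR, setT x ->
     (truncation p n x * poisson e (x - x0))%:E @[n --> \oo] --> (p x * poisson e (x - x0))%:E}.
    apply: aeW => x _; apply: cvg_near_cst; near=> n.
    rewrite /truncation indicE mem_set ?mulr1//= in_itv/= -ler_norml.
    by near: n; exact: nbhs_infty_ger.
  have zb : {ae mu, forall (x : TR) n, setT x ->
      (`|(truncation p n x * poisson e (x - x0))%:E| <= `|(p x * poisson e (x - x0))%:E|)%E}.
    apply: aeW => x n _; rewrite lee_fin normrM [leRHS]normrM ler_wpM2r//; exact: le_truncation.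
  have [_ _] := dominated_convergence mT mz mpP zc (integrable_abse ipP) zb.
  rewrite -(EFin_Rintegral mT ipP) => /fine_cvgP[_ /cvgrPdist_le/(_ _ d20)].
  by apply: filterS => n; rewrite /z /Rintegral.
have glim : \forall n \near \oo,
   `|\int[mu]_y ((alpha y * cos (x0 * y) - beta y * sin (x0 * y)) * abel e y) - z n| <= d / 2.
  have := cvge0_lt K40 cv; apply: filterS => n hn.
  have ipn := Rintegrable_truncation n mp ip2; have iqn := Rintegrable_truncation n mq iq2.
  have [iTU TUE] := abel_poisson ipn iqn x0 e0.
  rewrite /z -TUE -RintegralB//.
  set T := fourier_re _ _ in hn iTU TUE *; set U := fourier_im _ _ in hn iTU TUE *.
  have mTn : measurable_fun [set: TR] T by exact: measurable_fourier_re.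
  have mUn : measurable_fun [set: TR] U by exact: measurable_fourier_im.
  pose W y := (alpha y - T y) ^+ 2 + (beta y - U y) ^+ 2.
  have W0 y : 0 <= W y by rewrite addr_ge0 ?sqr_ge0.
  have mW : measurable_fun [set: TR] W.
    by apply: measurable_funD; apply: measurable_funX; exact: measurable_funB.
  have iW : mu.-integrable [set: TR] (EFin \o W).
    apply/integrableP; split; first exact/measurable_EFinP.
    under eq_integral do rewrite /= ger0_norm//.
    exact: lt_trans hn (ltry _).
  have WE : \int[mu]_y W y <= d / (8 * K) by rewrite -lee_fin EFin_Rintegral// ltW.
  have iK := Rintegrable_lin2 mT (2 * K) (4 * K)^-1 iW ih.
  set D := fun y => _ - _.
  have iD : mu.-integrable [set: TR] (EFin \o D) by exact: RintegrableB.
  apply: (le_trans (le_normr_Rintegral mT iD)).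
  (* AM-GM: [(a + b) * h <= 2 K (a ^ 2 + b ^ 2) + h ^ 2 / (4 K)], and [h ^ 2 <= h]. *)
  apply: (@le_trans _ _ (\int[mu]_y (2 * K * W y + (4 * K)^-1 * abel e y))).
    apply: le_Rintegral => //; first exact: (integrable_norm iD).
    move=> y _; rewrite /D -mulrBl.
    have -> : alpha y * cos (x0 * y) - beta y * sin (x0 * y) -
      (T y * cos (x0 * y) - U y * sin (x0 * y)) =
      (alpha y - T y) * cos (x0 * y) - (beta y - U y) * sin (x0 * y) by ring.
    have h0 := abel_gt0 e y; have h1 := abel_le1 e0 y.
    rewrite normrM (gtr0_norm h0).
    set u := alpha y - T y; set v := beta y - U y.
    have huv : `|u * cos (x0 * y) - v * sin (x0 * y)| <= `|u| + `|v|.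
      rewrite (le_trans (ler_normB _ _))// !normrM lerD// ler_piMr//.
        exact: cos_max.
      exact: sin_max.
    apply: (le_trans (ler_wpM2r (ltW h0) huv)).
    have WE' : W y = `|u| ^+ 2 + `|v| ^+ 2 by rewrite !real_normK ?num_real.
    rewrite WE'; move: `|u| `|v| (abel e y) h0 h1 => a b h h0 h1 {huv}.
    set c := (4 * K)^-1.
    have Kc : 4 * K * c = 1 by rewrite divff// gt_eqF// mulr_gt0.
    have hh : c * h ^+ 2 <= c * h.
      by rewrite ler_wpM2l ?invr_ge0 ?mulr_ge0 ?(ltW K0)// expr2 ler_piMr// ltW.
    apply: (@le_trans _ _ (2 * K * (a ^+ 2 + b ^+ 2) + c * h ^+ 2)); last by rewrite lerD2l.
    rewrite -subr_ge0.
    (* Completed squares at [a = b = c * h]; the correction term carries the factor [1 - 4 * K * c],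
       which is 0. *)
    have -> : 2 * K * (a ^+ 2 + b ^+ 2) + c * h ^+ 2 - (a + b) * h =
        2 * K * ((a - c * h) ^+ 2 + (b - c * h) ^+ 2) +
        (1 - 4 * K * c) * (c * h ^+ 2 - (a + b) * h) by ring.
    by rewrite Kc subrr mul0r addr0 mulr_ge0 ?addr_ge0 ?sqr_ge0// mulr_ge0 ?(ltW K0).
  rewrite Rintegral_lin2// -/H.
  have A1 : 2 * K * \int[mu]_y W y <= d / 4.
    have K20 : 0 <= 2 * K by rewrite mulr_ge0// ltW.
    apply: (le_trans (ler_wpM2l K20 WE)).
    by rewrite le_eqVlt; apply/predU1P; left; field; rewrite gt_eqF.
  apply: (le_trans (lerD A1 HK)).
  by rewrite le_eqVlt; apply/predU1P; left; field.
near \oo => n; apply: (aux _ _ (z n)); near: n; [exact: glim|exact: zlim].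
Unshelve. all: by end_near. Qed.

End Inversion.

Section Inversion.
Context {R : realType}.
Local Notation TR := (measurableTypeR R).
Local Notation mu := (@lebesgue_measure R).

Let mT : measurable [set: TR]. Proof. exact: measurableT. Qed.

(** Let [e] tend to 0 in [abel_poisson_L2]. The Poisson side tends to [2 * pi * p x0]; on the other
    side the integral lives on [[-c, c]], where [abel e] is uniformly within [e * c] of 1. *)
Lemma fourier_inversion_re (c : R) (p q alpha beta : R -> R) (x0 : R) :
  0 < c ->
  measurable_fun [set: TR] p -> measurable_fun [set: TR] q ->
  measurable_fun [set: TR] alpha -> measurable_fun [set: TR] beta ->
  mu.-integrable [set: TR] (EFin \o (fun x => p x ^+ 2)) ->
  mu.-integrable [set: TR] (EFin \o (fun x => q x ^+ 2)) ->
  mu.-integrable [set: TR] (EFin \o (fun x => alpha x ^+ 2)) ->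
  mu.-integrable [set: TR] (EFin \o (fun x => beta x ^+ 2)) ->
  {for x0, continuous p} ->
  {ae mu, forall y : TR, ~ (`|y : R| <= c) -> alpha y = 0 /\ beta y = 0} ->
  (\int[mu]_y ((alpha y - fourier_re (truncation p n) (truncation q n) y) ^+ 2 +
    (beta y - fourier_im (truncation p n) (truncation q n) y) ^+ 2)%:E)%E
    @[n --> \oo] --> 0%E ->
  2 * pi * p x0 = \int[mu]_(y in `[- c, c]) (alpha y * cos (x0 * y) - beta y * sin (x0 * y)).
Proof.
move=> c0 mp mq ma mb ip2 iq2 ia2 ib2 cp ab0 cv.
have aux (A B C d : R) : `|A - B| <= d / 2 -> `|A - C| <= d / 2 -> `|B - C| <= d.
  by rewrite !ler_norml => /andP[? ?] /andP[? ?]; apply/andP; split; lra.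
pose D := (`[- c, c]%classic : set TR).
have mD : measurable D by exact: measurable_itv.
have Doo : (mu D < +oo)%E.
  by rewrite lebesgue_measure_itv/=; case: ifP => _; rewrite -?EFinD ltry.
pose g y := alpha y * cos (x0 * y) - beta y * sin (x0 * y).
have mg : measurable_fun [set: TR] g.
  apply: measurable_funB; apply: measurable_funM => //.
    exact: measurable_cos1.
  exact: measurable_sin1.
have sub (f : R -> R) : mu.-integrable [set: TR] (EFin \o f) -> mu.-integrable D (EFin \o f).
  by apply: integrableS.
have mS (f : R -> R) : measurable_fun [set: TR] f -> measurable_fun D f.
  by move=> mf; apply: measurable_funS mf.
have ig : mu.-integrable D (EFin \o g).
  apply: RintegrableB => //.
    apply: (@RintegrableMb _ _ _ _ _ mD alpha (fun y => cos (x0 * y)) 1).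
    - exact: (Rintegrable_sqr mD Doo (mS _ ma) (sub _ ia2)).
    - exact: (mS _ (measurable_cos1 x0)).
    - by move=> *; exact: cos_max.
  apply: (@RintegrableMb _ _ _ _ _ mD beta (fun y => sin (x0 * y)) 1).
  - exact: (Rintegrable_sqr mD Doo (mS _ mb) (sub _ ib2)).
  - exact: (mS _ (measurable_sin1 x0)).
  - by move=> *; exact: sin_max.
have ing : mu.-integrable D (EFin \o (fun y => `|g y|)) by exact: (integrable_norm ig).
pose J := \int[mu]_(y in D) `|g y|.
have J0 : 0 <= J by apply: Rintegral_ge0.
apply/eqP; rewrite -subr_eq0 -normr_le0; apply/ler_addgt0Pr => d d0; rewrite add0r.
have d20 : 0 < d / 2 by rewrite divr_gt0.
have [r r0 hr] := poisson_approx mp ip2 cp d20.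
(* This threshold makes the error [e * c * J] at most [d / 2]. *)
have s0 : 0 < d / (2 * (c * J + 1)).
  by rewrite divr_gt0// mulr_gt0// ltr_wpDl// mulr_ge0// ltW.
set s := d / _ in s0.
pose e := Num.min r s / 2.
have m0 : 0 < Num.min r s by rewrite lt_min r0.
have e0 : 0 < e by rewrite divr_gt0.
have em : e < Num.min r s by rewrite /e; lra.
have [er es] : e < r /\ e < s by move: em; rewrite lt_min => /andP.
have [ipP hP] := hr e e0 er.
have [igh gE] := abel_poisson_L2 mp mq ma mb ip2 iq2 ia2 ib2 cv e0 ipP.
apply: (aux (\int[mu]_x (p x * poisson e (x - x0)))) => //.
rewrite -gE.
have mgh : measurable_fun [set: TR] (fun y => g y * abel e y).
  by apply: measurable_funM => //; exact: measurable_abel.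
have -> : \int[mu]_y (g y * abel e y) = \int[mu]_(y in D) (g y * abel e y).
  rewrite [RHS]Rintegral_mkcond /Rintegral; congr fine.
  apply: ae_eq_integral => //.
  - exact/measurable_EFinP.
  - by apply/measurable_EFinP/(measurable_restrictT _ mD); exact: (mS _ mgh).
  apply: filterS ab0 => y hy _; congr (_%:E).
  rewrite patchE; case: ifPn => // yD.
  have [|a0 b0] := hy; last by rewrite /g a0 b0 !mul0r subrr mul0r.
  by move: yD; rewrite notin_setE /D/= in_itv/= -ler_norml.
have igD : mu.-integrable D (EFin \o (fun y => g y * abel e y)) by exact: sub.
rewrite -RintegralB//.
have idf := RintegrableB mD igD ig.
apply: (le_trans (le_normr_Rintegral mD idf)).
apply: (@le_trans _ _ (\int[mu]_(y in D) (e * c * `|g y|))).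
  apply: le_Rintegral => //.
  - exact: (integrable_norm idf).
  - exact: RintegrableZl.
  move=> y; rewrite /D/= in_itv/= -ler_norml => yc.
  rewrite -[X in _ - X]mulr1 -mulrBr normrM mulrC ler_wpM2r//.
  rewrite distrC ger0_norm ?subr_ge0 ?abel_le1//.
  have := expR_ge1Dx (- (e * `|y|)); rewrite -/(abel e y).
  have : e * `|y| <= e * c by rewrite ler_wpM2l// ltW.
  by lra.
rewrite RintegralZl// -/J.
have cJ : 0 < c * J + 1 by rewrite ltr_wpDl// mulr_ge0// ltW.
have h1 : e * c * J <= s * (c * J).
  by rewrite -mulrA ler_wpM2r// ?mulr_ge0 ?(ltW c0)// ltW.
apply: (le_trans h1); rewrite /s mulrAC ler_pdivrMr ?mulr_gt0//.
have h2 : d * (c * J) <= d * (c * J + 1) by rewrite ler_wpM2l ?(ltW d0)// lerDl.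
apply: (le_trans h2); rewrite le_eqVlt; apply/predU1P; left.
by rewrite mulrA divfK.
Qed.

(** * From complex-valued functions and [norm2] to real integrals *)

Implicit Types f g h : R -> R[i]%C.

Definition Ref f (x : R) : R := complex.Re (f x).
Definition Imf f (x : R) : R := complex.Im (f x).

Lemma sqr_normc (z : R[i]%C) : Normc.normc z ^+ 2 = complex.Re z ^+ 2 + complex.Im z ^+ 2.
Proof. by case: z => a b /=; rewrite sqr_sqrtr// addr_ge0 ?sqr_ge0. Qed.

(** Valid also when the norm is infinite, which is why the natural power and the real power are
    first reconciled by cases on the extended real. *)
Lemma norm2_sqr f : (norm2 f ^+ 2 = \int[mu]_x (Ref f x ^+ 2 + Imf f x ^+ 2)%:E)%E.
Proof.
have n20 : (2 : R) != 0 by [].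
have -> : (norm2 f ^+ 2 = norm2 f `^ 2)%E.
  have : (0 <= norm2 f)%E by exact: Lnorm_ge0.
  case: (norm2 f) => [r|_|//]; last by rewrite poweRyr.
  by rewrite lee_fin => r0; rewrite poweR_EFin powR_mulrn.
rewrite poweR_Lnorm//; apply: eq_integral => x _.
by rewrite poweR_EFin powR_mulrn// real_normK ?num_real// sqr_normc.
Qed.

Lemma norm2_lty f : (norm2 f < +oo)%E ->
  (\int[mu]_x (Ref f x ^+ 2 + Imf f x ^+ 2)%:E < +oo)%E.
Proof.
rewrite -norm2_sqr; have : (0 <= norm2 f)%E by exact: Lnorm_ge0.
by case: (norm2 f) => [r _ _|//|//]; rewrite -EFin_expe ltry.
Qed.

Lemma L2_integrable f : L2 f ->
  [/\ measurable_fun [set: TR] (Ref f), measurable_fun [set: TR] (Imf f),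
    mu.-integrable [set: TR] (EFin \o (fun x => Ref f x ^+ 2)) &
    mu.-integrable [set: TR] (EFin \o (fun x => Imf f x ^+ 2))].
Proof.
move=> [[mr mi] /norm2_lty foo].
have mr' : measurable_fun [set: TR] (Ref f) by [].
have mi' : measurable_fun [set: TR] (Imf f) by [].
have i2 : mu.-integrable [set: TR] (EFin \o (fun x => Ref f x ^+ 2 + Imf f x ^+ 2)).
  apply/integrableP; split.
    by apply/measurable_EFinP; apply: measurable_funD; exact: measurable_funX.
  by under eq_integral do rewrite /= ger0_norm ?addr_ge0 ?sqr_ge0//.
split => //; apply: (le_Rintegrable mT _ _ i2).
- exact: measurable_funX.
- by move=> x _; rewrite ger0_norm ?sqr_ge0// lerDl sqr_ge0.
- exact: measurable_funX.
- by move=> x _; rewrite ger0_norm ?sqr_ge0// lerDr sqr_ge0.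
Qed.

Lemma Re_truncated_fourier f n y :
  complex.Re (cintegral `[- n%:R, n%:R] (fun x => f x * cis (- (x * y)))) =
  fourier_re (truncation (Ref f) n) (truncation (Imf f) n) y.
Proof.
rewrite -[LHS]/(\int[mu]_(x in `[- n%:R, n%:R]) complex.Re (f x * cis (- (x * y)))).
rewrite [LHS]Rintegral_mkcond; apply: eq_Rintegral => x _.
rewrite patchE /truncation indicE; case: ifPn => _; last by rewrite !mulr0 !mul0r addr0.
by rewrite !mulr1 /Ref /Imf /cis; case: (f x) => a b /=; rewrite cosN sinN; ring.
Qed.

Lemma Im_truncated_fourier f n y :
  complex.Im (cintegral `[- n%:R, n%:R] (fun x => f x * cis (- (x * y)))) =
  fourier_im (truncation (Ref f) n) (truncation (Imf f) n) y.
Proof.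
rewrite -[LHS]/(\int[mu]_(x in `[- n%:R, n%:R]) complex.Im (f x * cis (- (x * y)))).
rewrite [LHS]Rintegral_mkcond; apply: eq_Rintegral => x _.
rewrite patchE /truncation indicE; case: ifPn => _; last by rewrite !mulr0 !mul0r subrr.
by rewrite !mulr1 /Ref /Imf /cis; case: (f x) => a b /=; rewrite cosN sinN; ring.
Qed.

Lemma is_fourier2_cvg f g : is_fourier2 f g ->
  (\int[mu]_y ((Ref g y - fourier_re (truncation (Ref f) n) (truncation (Imf f) n) y) ^+ 2 +
    (Imf g y - fourier_im (truncation (Ref f) n) (truncation (Imf f) n) y) ^+ 2)%:E)%E
    @[n --> \oo] --> 0%E.
Proof.
move=> [_ _ cv].
have -> : (fun n => \int[mu]_y
    ((Ref g y - fourier_re (truncation (Ref f) n) (truncation (Imf f) n) y) ^+ 2 +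
    (Imf g y - fourier_im (truncation (Ref f) n) (truncation (Imf f) n) y) ^+ 2)%:E)%E =
  (fun n => (norm2 (fun xi => g xi -
    cintegral `[- n%:R, n%:R] (fun x => f x * cis (- (x * xi))))%R) ^+ 2)%E.
  apply/funext => n; rewrite norm2_sqr; apply: eq_integral => y _.
  rewrite -Re_truncated_fourier -Im_truncated_fourier /Ref /Imf; congr (_%:E).
  by case: (g y) => a b; case: (cintegral _ _).
have -> : (0 = 0 * 0 :> \bar R)%E by rewrite mule0.
by under eq_fun do rewrite expe2; exact: (cvgeM _ cv cv).
Qed.

(** Two mean-square limits of the same sequence agree almost everywhere. It is what transfers the
    support condition from the transform hidden in [PW] to the given [fhat]. *)
Lemma is_fourier2_unique f g h : is_fourier2 f g -> is_fourier2 f h ->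
  {ae mu, forall y : TR, g y = h y}.
Proof.
move=> fg fh; have [Lf Lg _] := fg; have [_ Lh _] := fh.
have [mf1 mf2 if1 if2] := L2_integrable Lf.
have [mg1 mg2 _ _] := L2_integrable Lg.
have [mh1 mh2 _ _] := L2_integrable Lh.
have cg := is_fourier2_cvg fg; have ch := is_fourier2_cvg fh.
pose W y := (Ref g y - Ref h y) ^+ 2 + (Imf g y - Imf h y) ^+ 2.
have mW : measurable_fun [set: TR] W.
  by apply: measurable_funD; apply: measurable_funX; exact: measurable_funB.
have W0 y : 0 <= W y by rewrite addr_ge0 ?sqr_ge0.
have IW : (\int[mu]_y `|(W y)%:E| = 0)%E.
  apply/eqP; rewrite eq_le integral_ge0 ?andbT//; apply/lee_addgt0Pr => e e0.
  have e4 : 0 < e / 4 by rewrite divr_gt0.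
  have [n _ /(_ n (leqnn n)) [hg hh]] := filterI (cvge0_lt e4 cg) (cvge0_lt e4 ch).
  set T := fourier_re (truncation (Ref f) n) (truncation (Imf f) n) in hg hh.
  set U := fourier_im (truncation (Ref f) n) (truncation (Imf f) n) in hg hh.
  have it1 := Rintegrable_truncation n mf1 if1; have it2 := Rintegrable_truncation n mf2 if2.
  have mTn : measurable_fun [set: TR] T by exact: measurable_fourier_re.
  have mUn : measurable_fun [set: TR] U by exact: measurable_fourier_im.
  have msq (u v : TR -> R) : measurable_fun [set: TR] u -> measurable_fun [set: TR] v ->
      measurable_fun [set: TR] (fun y => ((u y - T y) ^+ 2 + (v y - U y) ^+ 2)%:E).
    move=> mu mv; apply/measurable_EFinP.
    by apply: measurable_funD; apply: measurable_funX; exact: measurable_funB.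
  have n0 (u v : TR -> R) y : (0 <= ((u y - T y) ^+ 2 + (v y - U y) ^+ 2)%:E)%E.
    by rewrite lee_fin addr_ge0 ?sqr_ge0.
  apply: (@le_trans _ _ (\int[mu]_y (2%:E * ((Ref g y - T y) ^+ 2 + (Imf g y - U y) ^+ 2)%:E +
     2%:E * ((Ref h y - T y) ^+ 2 + (Imf h y - U y) ^+ 2)%:E))%E).
    apply: ge0_le_integral => //.
    - by apply: measurableT_comp => //; exact/measurable_EFinP.
    - by apply: emeasurable_funD; apply: emeasurable_funM; rewrite ?measurable_cst//; exact: msq.
    - move=> y _; rewrite /= lee_fin ger0_norm// /W.
      have := sqr_ge0 ((Ref g y - T y) + (Ref h y - T y)).
      have := sqr_ge0 ((Imf g y - U y) + (Imf h y - U y)).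
      nra.
  rewrite ge0_integralD//; last 4 first.
  - by move=> y _; rewrite mule_ge0// lee_fin.
  - by apply: emeasurable_funM; rewrite ?measurable_cst//; exact: msq.
  - by move=> y _; rewrite mule_ge0// lee_fin.
  - by apply: emeasurable_funM; rewrite ?measurable_cst//; exact: msq.
  rewrite !ge0_integralZl//; [|exact: msq|exact: msq].
  rewrite add0e.
  have -> : e%:E = (2%:E * (e / 4)%:E + 2%:E * (e / 4)%:E)%E.
    by rewrite -!EFinM -EFinD; congr EFin; field.
  by apply: leeD; apply: lee_wpmul2l => //; exact: ltW.
have mWE : measurable_fun [set: TR] (EFin \o W) by exact/measurable_EFinP.
have := (ae_eq_integral_abs mu mT mWE).1 IW.
apply: filterS => y /(_ I) /= [] Wy0.
have [r0 i0] : Ref g y = Ref h y /\ Imf g y = Imf h y.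
  have := sqr_ge0 (Ref g y - Ref h y); have := sqr_ge0 (Imf g y - Imf h y).
  move: Wy0; rewrite /W => Wy0 h1 h2.
  have z1 : (Ref g y - Ref h y) ^+ 2 = 0 by lra.
  have z2 : (Imf g y - Imf h y) ^+ 2 = 0 by lra.
  by split; apply/eqP; rewrite -subr_eq0 -sqrf_eq0; apply/eqP.
by move: r0 i0; rewrite /Ref /Imf; case: (g y) => a b; case: (h y) => a' b' /= -> ->.
Qed.

Lemma fourier_inversion (c : R) f g x0 : 0 < c -> ccontinuous f -> is_fourier2 f g ->
  {ae mu, forall y : TR, ~ (`|y : R| <= c) -> g y = 0} ->
  2 * pi * Ref f x0 =
    \int[mu]_(y in `[- c, c]) (Ref g y * cos (x0 * y) - Imf g y * sin (x0 * y)) /\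
  2 * pi * Imf f x0 =
    \int[mu]_(y in `[- c, c]) (Imf g y * cos (x0 * y) + Ref g y * sin (x0 * y)).
Proof.
move=> c0 [cr ci] fg g0; have [Lf Lg _] := fg.
have [mf1 mf2 if1 if2] := L2_integrable Lf.
have [mg1 mg2 ig1 ig2] := L2_integrable Lg.
have cg := is_fourier2_cvg fg.
split.
  apply: (@fourier_inversion_re c (Ref f) (Imf f) (Ref g) (Imf g)) => //; first exact: cr.
  by apply: filterS g0 => y /[apply]; rewrite /Ref /Imf => ->.
(* The imaginary part is the first statement applied to [-i f], whose real and imaginary parts are
   [Imf f] and [- Ref f]. *)
have h n : truncation (fun x => - Ref f x) n = (fun x => - truncation (Ref f) n x).
  by apply/funext => x; rewrite /truncation mulNr.
have h1 n y : fourier_re (truncation (Imf f) n) (truncation (fun x => - Ref f x) n) y =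
    fourier_im (truncation (Ref f) n) (truncation (Imf f) n) y.
  by apply: eq_Rintegral => x _; rewrite h mulNr.
have h2 n y : fourier_im (truncation (Imf f) n) (truncation (fun x => - Ref f x) n) y =
    - fourier_re (truncation (Ref f) n) (truncation (Imf f) n) y.
  have it1 := Rintegrable_truncation n mf1 if1; have it2 := Rintegrable_truncation n mf2 if2.
  have mc : measurable_fun [set: TR] (fun x : R => cos (x * y)).
    by under eq_fun do rewrite mulrC; exact: measurable_cos1.
  have ms : measurable_fun [set: TR] (fun x : R => sin (x * y)).
    by under eq_fun do rewrite mulrC; exact: measurable_sin1.
  have ic := RintegrableMb mT it1 mc (fun x _ => cos_max _).
  have is' := RintegrableMb mT it2 ms (fun x _ => sin_max _).
  rewrite -mulN1r /fourier_re -RintegralZl//; last exact: RintegrableD.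
  by apply: eq_Rintegral => x _; rewrite h; ring.
have cv' : (\int[mu]_y
    ((Imf g y - fourier_re (truncation (Imf f) n) (truncation (fun x => - Ref f x) n) y) ^+ 2 +
     (- Ref g y -
      fourier_im (truncation (Imf f) n) (truncation (fun x => - Ref f x) n) y) ^+ 2)%:E)%E
    @[n --> \oo] --> 0%E.
  apply: cvg_trans cg; apply: near_eq_cvg; near=> n.
  by apply: eq_integral => y _; rewrite h1 h2; congr (_%:E); ring.
have zae : {ae mu, forall y : TR, ~ (`|y : R| <= c) -> Imf g y = 0 /\ - Ref g y = 0}.
  by apply: filterS g0 => y /[apply]; rewrite /Ref /Imf => -> /=; rewrite oppr0.
have sqN (u : R -> R) : mu.-integrable [set: TR] (EFin \o (fun x => u x ^+ 2)) ->
    mu.-integrable [set: TR] (EFin \o (fun x => (- u x) ^+ 2)).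
  by apply: (eq_Rintegrable mT) => x _; rewrite sqrrN.
have E := @fourier_inversion_re c (Imf f) (fun x => - Ref f x) (Imf g) (fun x => - Ref g x) x0
  c0 mf2 (measurable_funN mf1) mg2 (measurable_funN mg1) if2 (sqN _ if1) ig2 (sqN _ ig1)
  (ci x0) zae cv'.
by rewrite E; apply: eq_Rintegral => y _; rewrite mulNr opprK.
Unshelve. all: by end_near. Qed.


End Inversion.

(** * Folding onto one period *)

Section Fold.
Context {R : realType}.
Local Notation TR := (measurableTypeR R).
Local Notation mu := (@lebesgue_measure R).

Lemma preimage_translate_itv (a b s : R) :
  [set x : R | `[a + s, b + s]%classic (x + s)] = `[a, b]%classic.
Proof. by apply/seteqP; split => x /=; rewrite !in_itv/= !lerD2r. Qed.

Lemma Rintegrable_fold (F : R -> R) (a L : R) (n : nat) (j : 'I_n) : 0 < L ->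
  mu.-integrable (`[a, a + n%:R * L]%classic : set TR) (EFin \o F) ->
  mu.-integrable (`[a, a + L]%classic : set TR) (EFin \o (fun u => F (u + j%:R * L))).
Proof.
move=> L0 iF; rewrite -(preimage_translate_itv a (a + L) (j%:R * L)).
apply: Rintegrable_translate => //.
apply: integrableS iF => // x /=; rewrite !in_itv/= => /andP[h1 h2].
have jn : (j%:R + 1) * L <= n%:R * L by rewrite ler_wpM2r ?(ltW L0)// natr1 ler_nat.
have j0 : 0 <= j%:R * L by rewrite mulr_ge0// ltW.
by move: jn; rewrite mulrDl mul1r => jn; apply/andP; split; lra.
Qed.

Lemma Rintegral_fold (F : R -> R) (a L : R) (n : nat) : 0 < L ->
  mu.-integrable (`[a, a + n%:R * L]%classic : set TR) (EFin \o F) ->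
  \int[mu]_(x in `[a, a + n%:R * L]) F x =
  \int[mu]_(u in `[a, a + L]) \sum_(j < n) F (u + j%:R * L).
Proof.
move=> L0 iF; rewrite Rintegral_sum//; last by move=> j; exact: (@Rintegrable_fold _ a L n j).
elim: n iF => [|n IH] iF.
  by rewrite big_ord0 mul0r addr0 set_itv1 Rintegral_set1.
have nL : a + n%:R * L <= a + n.+1%:R * L by rewrite lerD2l ler_wpM2r ?(ltW L0)// ler_nat.
have aL : a <= a + n%:R * L by rewrite lerDl mulr_ge0// ltW.
rewrite big_ord_recr/= -IH; last first.
  apply: integrableS iF => //; apply: subset_itvl; by rewrite bnd_simp.
have h := @Rintegral_itvB R F (BLeft a) (BRight (a + n.+1%:R * L)) (a + n%:R * L) iF.
rewrite !bnd_simp in h; move: (h aL nL) => /eqP; rewrite subr_eq addrC => /eqP ->.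
congr (_ + _).
have iG : mu.-integrable (`]a + n%:R * L, a + n.+1%:R * L]%classic : set TR) (EFin \o F).
  apply: integrableS iF => // x /=; rewrite !in_itv/= => /andP[h1 h2].
  by apply/andP; split => //; apply/ltW; exact: le_lt_trans h1.
rewrite Rintegral_itv_obnd_cbnd//.
have iG' : mu.-integrable (`[a + n%:R * L, a + n.+1%:R * L]%classic : set TR) (EFin \o F).
  apply: integrableS iF => // x /=; rewrite !in_itv/= => /andP[h1 h2].
  by apply/andP; split => //; exact: le_trans h1.
rewrite (Rintegral_translate (n%:R * L))//; last exact: Rintegrable_measurable iG'.
by rewrite (_ : a + n.+1%:R * L = a + L + n%:R * L) ?preimage_translate_itv// -natr1; ring.
Qed.

Section energy.
Variables (a L : R) (L0 : 0 < L).
Local Notation I := (`[a, a + L]%classic : set TR).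
Variables (A B : R -> R).
Hypotheses (mA : measurable_fun I A) (mB : measurable_fun I B)
  (iA : mu.-integrable I (EFin \o (fun u => A u ^+ 2)))
  (iB : mu.-integrable I (EFin \o (fun u => B u ^+ 2))).

Let mI : measurable I. Proof. exact: measurable_itv. Qed.

Let Ioo : (mu I < +oo)%E. Proof. by rewrite lebesgue_measure_period// ltry. Qed.

(* The Fourier coefficients of A + iB: their cross terms are odd in k. *)
Lemma complex_parseval :
  \esum_(k in [set: int])
    ((coef_cos a L k A - coef_sin a L k B) ^+ 2 +
     (coef_cos a L k B + coef_sin a L k A) ^+ 2)%:E =
  (L * \int[mu]_(u in I) (A u ^+ 2 + B u ^+ 2))%:E.
Proof.
have aux (r s : R) : r + r = s + s -> r = s by lra.
pose e k := (coef_cos a L k A - coef_sin a L k B) ^+ 2 +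
     (coef_cos a L k B + coef_sin a L k A) ^+ 2.
have e0 k : (0 <= (e k)%:E)%E by rewrite lee_fin addr_ge0 ?sqr_ge0.
have iA1 := Rintegrable_sqr mI Ioo mA iA; have iB1 := Rintegrable_sqr mI Ioo mB iB.
have ee k : e k + e (- k) =
    (coef_energy a L k A + coef_energy a L k A) + (coef_energy a L k B + coef_energy a L k B).
  by rewrite /e !coef_cosN !coef_sinN// /coef_energy; ring.
have eN : \esum_(k in [set: int]) (e k)%:E = \esum_(k in [set: int]) (e (- k))%:E.
  by apply: (reindex_esum setT setT (fun k : int => - k)).
have EA0 k : (0 <= (coef_energy a L k A)%:E)%E by rewrite lee_fin coef_energy_ge0.
have EB0 k : (0 <= (coef_energy a L k B)%:E)%E by rewrite lee_fin coef_energy_ge0.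
(* Pairing [e k] with [e (- k)] gives the identity only in doubled form; it is halved afterwards by
   cases on the extended real. *)
have h : (\esum_(k in [set: int]) (e k)%:E + \esum_(k in [set: int]) (e k)%:E =
   (L * \int[mu]_(u in I) (A u ^+ 2 + B u ^+ 2) +
    L * \int[mu]_(u in I) (A u ^+ 2 + B u ^+ 2))%:E)%E.
  rewrite [X in (_ + X)%E]eN -esumD//.
  pose EA k := (coef_energy a L k A)%:E; pose EB k := (coef_energy a L k B)%:E.
  rewrite (eq_esum (b := fun k => ((EA k + EA k) + (EB k + EB k))%E)); last first.
    by move=> k _; rewrite -EFinD ee /EA /EB -!EFinD.
  have EA2 k : (0 <= EA k + EA k)%E by apply: adde_ge0; exact: EA0.
  have EB2 k : (0 <= EB k + EB k)%E by apply: adde_ge0; exact: EB0.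
  rewrite esumD; [|by move=> k _; exact: EA2|by move=> k _; exact: EB2].
  rewrite [X in (X + _)%E]esumD; [|by move=> k _; exact: EA0|by move=> k _; exact: EA0].
  rewrite [X in (_ + X)%E]esumD; [|by move=> k _; exact: EB0|by move=> k _; exact: EB0].
  rewrite /EA /EB.
  rewrite !parseval// RintegralD// -!EFinD; congr (_%:E); ring.
rewrite -[LHS]/(\esum_(k in [set: int]) (e k)%:E); move: h.
case: (\esum_(k in [set: int]) (e k)%:E) => [r [h]|//|//].
by congr (_%:E); exact: aux.
Qed.

End energy.

End Fold.

(** * Separation of the symbol *)

Section Separation.
Context {R : realType}.
Implicit Types (c t u : R) (phi : R -> R[i]%C).

Definition symbol phi (y : R) : R := complex.Re (fourier phi y).

Lemma kernel_bound_symbol c phi (kappa y : R) : kernel_bound c phi kappa -> `|y| <= c ->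
  complex.Im (fourier phi y) = 0 /\ kappa <= symbol phi y <= 1.
Proof.
move=> kb yc; have := kb y yc; rewrite /symbol.
case: (fourier phi y) => r i; rewrite !lecE/= => /andP[/andP[/eqP <- ->] /andP[_ ->]].
by [].
Qed.

Lemma phat_pE c phi (y : R) (N : int) : 0 < c -> - c <= y < c ->
  phat_p c phi (y + 2 * c * N%:~R) = fourier phi y.
Proof.
move=> c0 yc; rewrite /phat_p.
have h (k : int) : k != N ->
    fourier phi (y + 2 * c * N%:~R - 2 * c * k%:~R) *
    ((\1_(`[- c, c[%classic) (y + 2 * c * N%:~R - 2 * c * k%:~R) : R)%:C)%C = 0.
  move=> kN; rewrite indicE memNset ?mulr0// /= in_itv/= => /andP[h1 h2].
  move/andP: yc => [y1 y2].
  have [kN'|kN'] := ltP k N.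
    have : (1 : R) <= N%:~R - k%:~R by rewrite -rmorphB/= -[1]/(1%:~R) ler_int; lia.
    by nra.
  have : (1 : R) <= k%:~R - N%:~R.
    by rewrite -rmorphB/= -[1]/(1%:~R) ler_int; move/eqP: kN => kN; lia.
  by nra.
rewrite -(@fsbig_widen _ _ _ _ [set N] setT)//; last first.
  by move=> k [_ kN]; apply: h; apply/eqP => kE; apply: kN; rewrite kE.
by rewrite fsbig_set1 addrK indicE mem_set ?mulr1//= in_itv.
Qed.

(** One point of the fibre over [u] being [L * (y + K)] with [y] in [Et], the points [u + j * L]
    are, modulo [2 * c = m * L], the points [L * (y + r)] with [0 <= r < m] in another order, so
    separation along [Et] applies to all pairs. The half-open range of [u] keeps every point in
    [[-c, c)], where the periodization is the transform itself. *)
Lemma symbol_separation c phi (kappa delta : R) (m : nat) (Et : set R) (u : R) (j0 : nat) :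
  0 < c -> kernel_bound c phi kappa -> (0 < m)%N ->
  (forall j k : nat, (j < k <= m - 1)%N -> forall xi : R, Et xi ->
     delta <= Normc.normc (phat_p c phi (2 * c / m%:R * (xi + j%:R))
                                  - phat_p c phi (2 * c / m%:R * (xi + k%:R)))) ->
  - c <= u < - c + 2 * c / m%:R -> (j0 < m)%N ->
  lifted_set c m Et (u + j0%:R * (2 * c / m%:R)) ->
  forall j k : 'I_m, j != k ->
    delta <= `|symbol phi (u + j%:R * (2 * c / m%:R)) -
              symbol phi (u + k%:R * (2 * c / m%:R))|.
Proof.
move=> c0 kb m0 sep /andP[u1 u2] j0m [[y Ety [K uE]] _].
have m0R : 0 < m%:R :> R by rewrite ltr0n.
have mL : m%:R * (2 * c / m%:R) = 2 * c by field; rewrite gt_eqF.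
set L := 2 * c / m%:R in uE u2 mL sep *.
have L0 : 0 < L by rewrite divr_gt0// mulr_gt0.
have inc (j : nat) : (j < m)%N -> - c <= u + j%:R * L < c.
  move=> jm; have j0' : 0 <= j%:R * L by rewrite mulr_ge0// ltW.
  have : (j%:R + 1) * L <= m%:R * L by rewrite ler_wpM2r ?(ltW L0)// natr1 ler_nat.
  by rewrite mulrDl mul1r mL => h; apply/andP; split; lra.
(* [u + j * L = L * (y + n j)]; the remainder of [n j] modulo [m] is the index used in the
   hypothesis, and the quotient is a shift by periods. *)
have [n nE] : exists n : nat -> int, forall j, n j = K + j%:Z - j0%:Z by eexists.
pose r (j : nat) : nat := `|(n j %% m)%Z|%N.
have rE (j : nat) : (r j)%:Z = (n j %% m)%Z.
  by rewrite /r gez0_abs// modz_ge0//; lia.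
have rm (j : nat) : (r j < m)%N by rewrite -ltz_nat rE ltz_pmod.
have step (j : nat) : (j < m)%N ->
    phat_p c phi (L * (y + (r j)%:R)) = fourier phi (u + j%:R * L).
  move=> jm; rewrite -(@phat_pE c phi _ (- (n j %/ m)%Z) c0 (inc _ jm)); congr (phat_p _ _ _).
  have -> : (r j)%:R = (n j)%:~R - (n j %/ m)%Z%:~R * m%:R :> R.
    have := congr1 (fun z : int => z%:~R : R) (divz_eq (n j) m).
    rewrite intrD intrM -rE => ->.
    by rewrite addrAC subrr add0r.
  rewrite nE !rmorphD/= !rmorphN/= -mL.
  have -> : u = L * (y + K%:~R) - j0%:R * L by rewrite -uE; ring.
  rewrite -!pmulrn; ring.
have main (j k : 'I_m) : j != k -> (r j < r k)%N ->
    delta <= `|symbol phi (u + j%:R * L) - symbol phi (u + k%:R * L)|.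
  move=> jk rjk; have := sep (r j) (r k) _ y Ety; rewrite !step//.
  have rk : (r j < r k <= m - 1)%N by rewrite rjk/=; have := rm k; lia.
  move=> /(_ rk)/le_trans; apply.
  have nc (i : 'I_m) : `|u + i%:R * L| <= c.
    by have /andP[h1 h2] := inc i (ltn_ord i); rewrite ler_norml h1 ltW.
  have [Ij _] := kernel_bound_symbol kb (nc j).
  have [Ik _] := kernel_bound_symbol kb (nc k).
  rewrite -(sqrtr_sqr (symbol _ _ - _)) /symbol.
  move: Ij Ik; case: (fourier phi _) => a b; case: (fourier phi _) => a' b' /= -> ->.
  by rewrite subrr expr0n addr0.
move=> j k jk; have [rjk|rkj|rr] := ltngtP (r j) (r k); first exact: main.
  by rewrite distrC; apply: main => //; rewrite eq_sym.
exfalso; move/negP: jk; apply; apply/eqP/val_inj => /=.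
(* Equal remainders make [m] divide [j - k], which is smaller than [m] in absolute value. *)
have : (n j = n k %[mod m])%Z by rewrite -!rE rr.
move/eqP; rewrite eqz_mod_dvd !nE => /dvdzP[z].
have := ltn_ord j; have := ltn_ord k; set J := nat_of_ord j; set K' := nat_of_ord k.
move=> h1 h2 h3.
have z0 : z = 0 by nia.
by move: h3; rewrite z0 mul0r; lia.
Qed.

End Separation.

(** With nodes [lam j ^ (1 / m)] and weights [al j * lam j ^ t], the value at time [t + l / m] is
    the [l]-th power sum of a Vandermonde system. The weights retain at least [kappa ^ (2 t)] of the
    squared coefficients. *)
Lemma time_samples_lower_bound (R : realType) (m : nat) (lam al : 'I_m -> R)
    (kappa delta t : R) :
  (2 <= m)%N -> 0 < kappa -> (forall j, kappa <= lam j <= 1) ->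
  0 < delta -> (forall j k, j != k -> delta <= `|lam j - lam k|) -> 0 <= t ->
  delta ^+ (m * (m - 1)) / (expR 1 * m%:R ^+ (m ^ 2)) * expR (2 * t * ln kappa) *
    \sum_j al j ^+ 2 <=
  \sum_(l < m) (\sum_j al j * expR ((t + l%:R * m%:R^-1) * ln (lam j))) ^+ 2.
Proof.
move=> m2 k0 lam01 d0 sep t0.
have m0 : 0 < m%:R :> R by rewrite ltr0n; lia.
have lam0 j : 0 < lam j by have /andP[h _] := lam01 j; exact: lt_le_trans h.
have ln0 j : ln (lam j) <= 0 by have /andP[_ h] := lam01 j; exact: ln_le0.
pose x j := expR (m%:R^-1 * ln (lam j)).
have x01 j : 0 <= x j <= 1.
  by rewrite expR_ge0 expR_le1/= mulr_ge0_le0.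
have xm j : x j ^+ m = lam j.
  by rewrite /x -expRM_natl mulrA mulfV ?gt_eqF// mul1r lnK ?posrE.
have sepx j k : j != k -> delta / m%:R <= `|x j - x k|.
  move=> jk; rewrite ler_pdivrMr// mulrC (le_trans (sep j k jk))//.
  by rewrite -!xm norm_subX_le.
(* Since [m >= 2] there are two values in [[0, 1]] that are [delta] apart; [vandermonde_const] needs
   this. *)
have d1 : delta <= 1.
  have l0 : (0 < m)%N by lia.
  have l1 : (1 < m)%N by lia.
  have := sep (Ordinal l0) (Ordinal l1) isT; move/le_trans; apply.
  have /andP[h1 h2] := lam01 (Ordinal l0); have /andP[h3 h4] := lam01 (Ordinal l1).
  by rewrite ler_norml; apply/andP; split; lra.
pose w j := al j * expR (t * ln (lam j)).
have dm0 : 0 <= delta / m%:R by rewrite divr_ge0 ?ltW.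
have V := vandermonde_lower_bound w dm0 x01 sepx.
have e2 : 2 <= expR 1 :> R by have := expR_ge1Dx (1 : R); lra.
have CC := vandermonde_const m2 (ltW d0) d1 e2.
set C0 := delta ^+ _ / _ in CC *.
have C00 : 0 <= C0.
  by rewrite divr_ge0 ?exprn_ge0 ?(ltW d0)// mulr_ge0 ?expR_ge0// exprn_ge0// ltW.
have -> : \sum_(l < m) (\sum_j al j * expR ((t + l%:R * m%:R^-1) * ln (lam j))) ^+ 2 =
    \sum_(l < m) (\sum_j w j * x j ^+ l) ^+ 2.
  apply: eq_bigr => l _; congr (_ ^+ 2); apply: eq_bigr => j _.
  by rewrite /w /x -expRM_natl -mulrA -expRD mulrDl mulrA.
set S := \sum_(l < m) _ in V *.
have W : expR (2 * t * ln kappa) * \sum_j al j ^+ 2 <= \sum_j w j ^+ 2.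
  rewrite mulr_sumr; apply: ler_sum => j _.
  rewrite /w exprMn mulrC ler_wpM2l ?sqr_ge0// -expRM_natl ler_expR.
  rewrite mulrA ler_wpM2l ?mulr_ge0// ler_ln ?posrE//.
  by have /andP[] := lam01 j.
have P0 : 0 < m%:R * 4 ^+ m.-1 :> R by rewrite mulr_gt0// exprn_gt0.
rewrite -(ler_pM2l P0) -mulrA; apply: le_trans V.
apply: (le_trans (ler_wpM2l (ltW P0) (ler_wpM2l C00 W))).
rewrite mulrA ler_wpM2r//.
by apply: sumr_ge0 => j _; exact: sqr_ge0.
Qed.

Lemma sqr_sum_le (R : realDomainType) (m : nat) (b : 'I_m -> R) :
  (\sum_j b j) ^+ 2 <= m%:R * \sum_j b j ^+ 2.
Proof.
rewrite expr2 mulr_suml mulr_natl -[m in _ *+ m]card_ord -sumr_const.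
rewrite -(ler_pM2l (ltr0n R 2)).
have -> : 2 * \sum_(i < m) \sum_j b j ^+ 2 = \sum_(i < m) \sum_(j < m) (b i ^+ 2 + b j ^+ 2).
  under [RHS]eq_bigr do rewrite big_split/=.
  rewrite big_split/= [X in _ = X + _]exchange_big/= -mulr2n mulr_natl.
  by [].
rewrite mulr_sumr; apply: ler_sum => i _; rewrite !mulr_sumr; apply: ler_sum => j _.
by have := sqr_ge0 (b i - b j); nra.
Qed.

(** * The energy of the flow *)

Section FlowEnergy.
Context {R : realType}.
Local Notation TR := (measurableTypeR R).
Local Notation mu := (@lebesgue_measure R).
Variables (c kappa : R) (m : nat) (al be lam : R -> R).
Hypotheses (c0 : 0 < c) (m2 : (2 <= m)%N) (k01 : 0 < kappa < 1).
Hypotheses (mal : measurable_fun [set: TR] al) (mbe : measurable_fun [set: TR] be)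
  (mlam : measurable_fun [set: TR] lam).
Local Notation D := (`[- c, c]%classic : set TR).
Hypotheses (ial : mu.-integrable D (EFin \o (fun x => al x ^+ 2)))
  (ibe : mu.-integrable D (EFin \o (fun x => be x ^+ 2)))
  (lam01 : forall x : R, `|x| <= c -> kappa <= lam x <= 1).
Local Notation L := (2 * c / m%:R).
Local Notation I := (`[- c, - c + L]%classic : set TR).

(* [lam x ^ t] when [0 < lam x]; this form is jointly measurable for all real [t]. *)
Definition flow_multiplier (t x : R) : R := expR (t * ln (lam x)).

Definition folded (g : R -> R) (t u : R) : R :=
  \sum_(j < m) g (u + j%:R * L) * flow_multiplier t (u + j%:R * L).

(** Parseval's value for the energy of the samples at time [t], an identification made in
    [flow_sample_energy]. *)
Definition flow_energy (t : R) : R :=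
  L * \int[mu]_(u in I) (folded al t u ^+ 2 + folded be t u ^+ 2).

Let m0 : (0 < m)%N. Proof. exact: ltn_trans m2. Qed.
Let m0R : 0 < m%:R :> R. Proof. by rewrite ltr0n. Qed.
Lemma fold_length_gt0 : 0 < L. Proof. by rewrite divr_gt0// mulr_gt0. Qed.
Let L0 := fold_length_gt0.
Lemma fold_lengthE : m%:R * L = 2 * c. Proof. by field; rewrite gt_eqF. Qed.
Let mI : measurable I. Proof. exact: measurable_itv. Qed.
Let mD : measurable D. Proof. exact: measurable_itv. Qed.
Let Ioo : (mu I < +oo)%E. Proof. by rewrite lebesgue_measure_period// ltry. Qed.

Lemma fold_interval : `[- c, - c + m%:R * L]%classic = `[- c, c]%classic.
Proof. by rewrite fold_lengthE (_ : - c + 2 * c = c)//; ring. Qed.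

Lemma fold_point (u : R) (j : 'I_m) : - c <= u <= - c + L -> `|u + j%:R * L| <= c.
Proof.
move=> /andP[u1 u2].
have jm : (j%:R + 1) * L <= m%:R * L by rewrite ler_wpM2r ?(ltW L0)// natr1 ler_nat.
have j0 : 0 <= j%:R * L by rewrite mulr_ge0// ltW.
have mL := fold_lengthE.
by rewrite ler_norml; apply/andP; split; lra.
Qed.

Lemma flow_multiplier01 (t x : R) : 0 <= t -> `|x| <= c -> 0 <= flow_multiplier t x <= 1.
Proof.
move=> t0 xc; have /andP[h1 h2] := lam01 xc.
by rewrite /flow_multiplier expR_ge0 expR_le1/= mulr_ge0_le0// ln_le0.
Qed.

Lemma measurable_translateT (s : R) (g : R -> R) : measurable_fun [set: TR] g ->
  measurable_fun [set: TR] (fun x : R => g (x + s)).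
Proof. by move=> mg; apply: (measurableT_comp mg); exact: measurable_translate. Qed.

Lemma measurable_flow_multiplier :
  measurable_fun [set: TR * TR] (fun z : TR * TR => flow_multiplier z.2 z.1).
Proof.
have mexp : measurable_fun [set: R] (@expR R).
  by apply: continuous_measurable_fun; exact: continuous_expR.
apply: (measurableT_comp mexp); apply: measurable_funM; first exact: measurable_snd.
have mln : measurable_fun [set: R] (@ln R) by exact: measurable_ln.
exact: (measurableT_comp mln (measurableT_comp mlam measurable_fst)).
Qed.

Lemma measurable_folded_joint (g : R -> R) : measurable_fun [set: TR] g ->
  measurable_fun [set: TR * TR] (fun z : TR * TR => folded g z.2 z.1).
Proof.
move=> mg; apply: measurable_sum => j; apply: measurable_funM.
  exact: (measurableT_comp (measurable_translateT (j%:R * L) mg) measurable_fst).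
have msh : measurable_fun [set: TR * TR] (fun z : TR * TR => (((z.1 : R) + j%:R * L : TR), z.2)).
  apply: measurable_fun_pair; last exact: measurable_snd.
  exact: (measurableT_comp (measurable_translate (j%:R * L)) measurable_fst).
exact: (measurableT_comp measurable_flow_multiplier msh).
Qed.

Lemma measurable_folded (g : R -> R) t : measurable_fun [set: TR] g ->
  measurable_fun [set: TR] (folded g t).
Proof.
by move=> mg; exact: (measurableT_comp (measurable_folded_joint mg) (pair2_measurable t)).
Qed.

Lemma measurable_flow_energy : measurable_fun [set: TR] flow_energy.
Proof.
apply: measurable_funM => //.
have -> : (fun t : TR => \int[mu]_(u in I) (folded al t u ^+ 2 + folded be t u ^+ 2)) =
  (fun t : TR => \int[mu]_u ((folded al t u ^+ 2 + folded be t u ^+ 2) * \1_I u)).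
  apply/funext => t; rewrite Rintegral_mkcond; apply: eq_Rintegral => u _.
  by rewrite patchE indicE; case: ifPn; rewrite ?mulr1 ?mulr0.
apply: (measurable_Rintegral (F := fun z : TR * TR =>
   (folded al z.2 z.1 ^+ 2 + folded be z.2 z.1 ^+ 2) * \1_I z.1)).
apply: measurable_funM.
  by apply: measurable_funD; apply: measurable_funX; exact: measurable_folded_joint.
have mi : measurable_fun [set: TR] (\1_I : TR -> R) by exact: measurable_indic.
exact: (measurableT_comp mi measurable_fst).
Qed.

Lemma Rintegrable_fold_sqr (g : R -> R) :
  mu.-integrable D (EFin \o (fun x => g x ^+ 2)) ->
  mu.-integrable I (EFin \o (fun u => \sum_(j < m) g (u + j%:R * L) ^+ 2)).
Proof.
move=> ig; apply: Rintegrable_sum => // j.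
apply: (@Rintegrable_fold _ (fun x => g x ^+ 2) (- c) L m j L0).
by rewrite fold_interval.
Qed.

Lemma folded_sqr_le (g : R -> R) (t u : R) : 0 <= t -> - c <= u <= - c + L ->
  folded g t u ^+ 2 <= m%:R * \sum_(j < m) g (u + j%:R * L) ^+ 2.
Proof.
move=> t0 uI; apply: (le_trans (sqr_sum_le _)); rewrite ler_wpM2l// ler_sum// => j _.
have /andP[h1 h2] := flow_multiplier01 t0 (fold_point j uI).
by rewrite exprMn ler_piMr ?sqr_ge0// exprn_ile1.
Qed.

Lemma Rintegrable_folded_sqr (g : R -> R) (t : R) : 0 <= t ->
  measurable_fun [set: TR] g -> mu.-integrable D (EFin \o (fun x => g x ^+ 2)) ->
  mu.-integrable I (EFin \o (fun u => folded g t u ^+ 2)).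
Proof.
move=> t0 mg ig.
have mF : measurable_fun I (fun u => folded g t u ^+ 2).
  by apply: measurable_funX; apply: measurable_funTS; exact: measurable_folded.
apply: (le_Rintegrable mI mF _ (RintegrableZl mI m%:R (Rintegrable_fold_sqr ig))).
move=> u; rewrite /= in_itv/= => uI.
by rewrite ger0_norm ?sqr_ge0// folded_sqr_le.
Qed.

Lemma flow_energy_ge0 t : 0 <= flow_energy t.
Proof.
rewrite mulr_ge0 ?(ltW L0)//; apply: Rintegral_ge0 => u _.
by rewrite addr_ge0 ?sqr_ge0.
Qed.

(** The multipliers are at most 1 and Cauchy-Schwarz over the [m] folds costs a factor [m], which
    combines with [L] into [2 * c]. *)
Lemma flow_energy_le t : 0 <= t ->
  flow_energy t <= 2 * c * \int[mu]_(x in D) (al x ^+ 2 + be x ^+ 2).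
Proof.
move=> t0.
have i1 := Rintegrable_folded_sqr t0 mal ial; have i2 := Rintegrable_folded_sqr t0 mbe ibe.
have j1 := Rintegrable_fold_sqr ial; have j2 := Rintegrable_fold_sqr ibe.
have iD : mu.-integrable D (EFin \o (fun x => al x ^+ 2 + be x ^+ 2)) by exact: RintegrableD.
have -> (J : R) : 2 * c * J = L * (m%:R * J) by rewrite mulrA [L * _]mulrC fold_lengthE.
rewrite ler_wpM2l ?(ltW L0)//.
rewrite -fold_interval Rintegral_fold//; last by rewrite fold_interval.
rewrite -RintegralZl//; last first.
  by apply: (eq_Rintegrable mI _ (RintegrableD mI j1 j2)) => u _; rewrite -big_split.
apply: le_Rintegral => //.
- exact: RintegrableD.
- apply: RintegrableZl => //.
  by apply: (eq_Rintegrable mI _ (RintegrableD mI j1 j2)) => u _; rewrite -big_split.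
move=> u; rewrite /= in_itv/= => uI; rewrite big_split/= mulrDr.
by rewrite lerD// folded_sqr_le.
Qed.

Lemma Rintegrable_flow_energy :
  mu.-integrable (`[0, 1]%classic : set TR) (EFin \o flow_energy).
Proof.
apply: (@le_Rintegrable _ _ _ _ _ _ _
  (fun=> 2 * c * \int[mu]_(x in D) (al x ^+ 2 + be x ^+ 2))) => //.
- by apply: measurable_funTS; exact: measurable_flow_energy.
- move=> t; rewrite /= in_itv/= => /andP[t0 _].
  by rewrite ger0_norm ?flow_energy_ge0// flow_energy_le.
- apply: Rintegrable_cst => //.
  by rewrite /= lebesgue_measure_itv/=; case: ifP => _; rewrite -?EFinD ltry.
Qed.

Lemma Rintegral_flow_energy_le : \int[mu]_(t in `[0, 1]) flow_energy t <=
  2 * c * \int[mu]_(x in D) (al x ^+ 2 + be x ^+ 2).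
Proof.
have m1 : mu `[0, 1]%classic = 1%:E.
  by rewrite lebesgue_measure_itv/= lte_fin ltr01 sube0.
apply: (@le_trans _ _ (\int[mu]_(t in `[0, 1])
  (2 * c * \int[mu]_(x in D) (al x ^+ 2 + be x ^+ 2)))); last first.
  rewrite Rintegral_cst// [X in _ * X <= _](_ : _ = 1) ?mulr1//.
  exact: (congr1 fine m1).
apply: le_Rintegral => //.
- exact: Rintegrable_flow_energy.
- apply: Rintegrable_cst => //; rewrite (le_lt_trans _ (ltry 1))// le_eqVlt.
  by apply/predU1P; left; exact: m1.
by move=> t; rewrite /= in_itv/= => /andP[t0 _]; exact: flow_energy_le.
Qed.

(** * Lower bound by grouping times *)

Section lower.
Variables (E : set TR) (delta : R).
Hypotheses (mE : measurable E) (d0 : 0 < delta).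
Hypothesis sep : forall (u : R) (j0 : 'I_m), - c <= u < - c + L -> E (u + j0%:R * L) ->
  forall j k : 'I_m, j != k ->
    delta <= `|lam (u + j%:R * L) - lam (u + k%:R * L)|.

Let C0 := delta ^+ (m * (m - 1)) / (expR 1 * m%:R ^+ (m ^ 2)).

Let C00 : 0 <= C0.
Proof.
by rewrite divr_ge0 ?exprn_ge0 ?(ltW d0)// mulr_ge0 ?expR_ge0// exprn_ge0.
Qed.

Let dens (x : R) : R := (al x ^+ 2 + be x ^+ 2) * \1_E x.

Let idens : mu.-integrable D (EFin \o dens).
Proof.
have iD : mu.-integrable D (EFin \o (fun x => al x ^+ 2 + be x ^+ 2)) by exact: RintegrableD.
apply: (RintegrableMb mD iD (h := \1_E) (M := 1)).
  by apply: measurable_funTS; exact: measurable_indic.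
by move=> x _; rewrite indicE; case: (_ \in _); rewrite ?normr1 ?normr0.
Qed.

Lemma folded_time_samples_lower (t u : R) : 0 <= t -> - c <= u < - c + L ->
  C0 * expR (2 * t * ln kappa) * \sum_(j < m) dens (u + j%:R * L) <=
  \sum_(l < m) (folded al (t + l%:R * m%:R^-1) u ^+ 2 +
                folded be (t + l%:R * m%:R^-1) u ^+ 2).
Proof.
move=> t0 uI; have P0 : 0 <= C0 * expR (2 * t * ln kappa) by rewrite mulr_ge0// expR_ge0.
have uI' : - c <= u <= - c + L by move/andP: uI => [h1 h2]; rewrite h1 ltW.
(* If no point above [u] lies in [E], the left side is 0. If one does, all the nodes above [u] are
   separated and every coefficient there is controlled, inside [E] or not. *)
have [[j0 Ej0]|nE] := pselect (exists j0 : 'I_m, E (u + j0%:R * L)); last first.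
  rewrite big1 ?mulr0; last first.
    by move=> j _; rewrite /dens indicE memNset ?mulr0// => Ej; apply: nE; exists j.
  by apply: sumr_ge0 => l _; rewrite addr_ge0 ?sqr_ge0.
have sp := sep uI Ej0; have /andP[k0 k1] := k01.
have lm (j : 'I_m) : kappa <= lam (u + j%:R * L) <= 1 by apply: lam01; exact: fold_point.
have h1 := time_samples_lower_bound (fun j : 'I_m => al (u + j%:R * L)) m2 k0 lm d0 sp t0.
have h2 := time_samples_lower_bound (fun j : 'I_m => be (u + j%:R * L)) m2 k0 lm d0 sp t0.
rewrite [leRHS]big_split/=; apply: le_trans (lerD h1 h2).
rewrite -mulrDr ler_wpM2l// -big_split/= ler_sum// => j _.
by rewrite /dens ler_piMr ?addr_ge0 ?sqr_ge0// indicE; case: (_ \in _).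
Qed.

Lemma flow_energy_time_samples (t : R) : 0 <= t ->
  L * (C0 * expR (2 * t * ln kappa)) * \int[mu]_(x in D) dens x <=
  \sum_(l < m) flow_energy (t + l%:R * m%:R^-1).
Proof.
move=> t0.
have tl (l : 'I_m) : 0 <= t + l%:R * m%:R^-1 by rewrite addr_ge0// mulr_ge0// invr_ge0.
have iS (l : 'I_m) : mu.-integrable I (EFin \o (fun u => folded al (t + l%:R * m%:R^-1) u ^+ 2 +
                folded be (t + l%:R * m%:R^-1) u ^+ 2)).
  apply: RintegrableD => //; first exact: (Rintegrable_folded_sqr (tl l) mal ial).
  exact: (Rintegrable_folded_sqr (tl l) mbe ibe).
rewrite -mulr_sumr -mulrA ler_wpM2l ?(ltW L0)//.
rewrite -Rintegral_sum//.
rewrite -fold_interval Rintegral_fold//; last by rewrite fold_interval.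
have id : mu.-integrable I (EFin \o (fun u => \sum_(j < m) dens (u + j%:R * L))).
  apply: Rintegrable_sum => // j.
  by apply: (@Rintegrable_fold _ dens (- c) L m j L0); rewrite fold_interval.
rewrite -RintegralZl//.
have IS (F : R -> R) : mu.-integrable I (EFin \o F) ->
    mu.-integrable (`[- c, - c + L[%classic : set TR) (EFin \o F).
  by apply: integrableS => // x /=; rewrite !in_itv/= => /andP[-> /ltW ->].
(* Separation is known only on the half-open interval; the right endpoint is null. *)
rewrite -!Rintegral_itv_bndo_bndc; last 2 first.
- apply: IS; exact: Rintegrable_sum.
- by apply: IS; exact: RintegrableZl.
apply: le_Rintegral => //.
- by apply: IS; exact: RintegrableZl.
- by apply: IS; exact: Rintegrable_sum.
by move=> u; rewrite /= in_itv/= => uI; exact: folded_time_samples_lower.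
Qed.

(** The integral of [kappa ^ (2 t)] for [b = ln kappa]; the bound [0 + s] matches the shape
    [[a, a + L]] produced by [Rintegral_fold]. *)
Lemma Rintegral_expR_line (b s : R) : 0 < s -> b != 0 ->
  \int[mu]_(t in `[0, 0 + s]) expR (2 * t * b) = (expR (2 * s * b) - 1) / (2 * b).
Proof.
move=> s0 b0; pose F (t : R) : R := expR (2 * t * b) / (2 * b).
have dF (t : R) : is_derive t 1 F (expR (2 * t * b)).
  rewrite /F; apply: is_derive_eq.
  by rewrite /GRing.scale/=; field.
have cF : continuous F.
  by move=> x; apply: differentiable_continuous; apply/derivable1_diffP; case: (dF x).
rewrite add0r /Rintegral (@continuous_FTC2 _ _ F)//.
- by rewrite /= /F mulr0 mul0r expR0; field.
- apply: continuous_subspaceT => y; apply: continuous_comp; last exact: continuous_expR.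
  by apply: cvgMl; apply: cvgMr; exact: cvg_id.
- split; first by move=> y _; case: (dF y).
  + by apply: cvg_at_right_filter; exact: cF.
  + by apply: cvg_at_left_filter; exact: cF.
- by move=> y _; rewrite derive1E; case: (dF y).
Qed.

Lemma Rintegral_flow_energy_ge :
  L * C0 * ((kappa `^ (2 / m%:R) - 1) / (2 * ln kappa)) *
     \int[mu]_(x in D) ((al x ^+ 2 + be x ^+ 2) * \1_E x) <=
  \int[mu]_(t in `[0, 1]) flow_energy t.
Proof.
have /andP[k0 k1] := k01.
have lk : ln kappa != 0 by rewrite lt_eqF// ln_lt0// k0.
have i0 : 0 < m%:R^-1 :> R by rewrite invr_gt0.
have t01 : `[0, 0 + m%:R * m%:R^-1]%classic = `[0, 1]%classic :> set R.
  by rewrite add0r divff// gt_eqF.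
(* The folding lemma used in time, with step [1 / m]: it brings the times [t + l / m] under one
   integral. *)
rewrite -t01 Rintegral_fold//; last by rewrite t01; exact: Rintegrable_flow_energy.
set N := \int[mu]_(x in D) _.
rewrite /powR gt_eqF//.
rewrite -(Rintegral_expR_line i0 lk).
pose J := (`[0, 0 + m%:R^-1]%classic : set TR).
have mJ : measurable J by exact: measurable_itv.
have iexp : mu.-integrable J (EFin \o (fun t => expR (2 * t * ln kappa))).
  apply: continuous_compact_integrable; first exact: segment_compact.
  apply: continuous_subspaceT => y; apply: continuous_comp; last exact: continuous_expR.
  by apply: cvgMl; apply: cvgMr; exact: cvg_id.
have iS : mu.-integrable J (EFin \o (fun t => \sum_(l < m) flow_energy (t + l%:R * m%:R^-1))).
  apply: Rintegrable_sum => // l.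
  apply: (@Rintegrable_fold _ flow_energy 0 m%:R^-1 m l i0).
  by rewrite t01; exact: Rintegrable_flow_energy.
have -> (z : R) : L * C0 * z * N = (L * C0 * N) * z by ring.
rewrite -RintegralZl//; apply: le_Rintegral => //; first exact: RintegrableZl.
move=> t; rewrite /J/= in_itv/= => /andP[t0 _].
apply: le_trans (flow_energy_time_samples t0).
by rewrite le_eqVlt; apply/predU1P; left; rewrite -/N; ring.
Qed.

End lower.
End FlowEnergy.

(** * Samples of the flow *)

Section SampleEnergy.
Context {R : realType}.
Local Notation TR := (measurableTypeR R).
Local Notation mu := (@lebesgue_measure R).

Let mT : measurable [set: TR]. Proof. exact: measurableT. Qed.

Lemma measurable_symbol (phi : R -> R[i]%C) : cintegrable phi ->
  measurable_fun [set: TR] (symbol phi).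
Proof.
move=> [ir ii]; have := @measurable_fourier_re R (Ref phi) (Imf phi) ir ii.
congr measurable_fun; apply/funext => y; apply: eq_Rintegral => x _.
by rewrite /Ref /Imf /cis; case: (phi x) => a b /=; rewrite cosN sinN; ring.
Qed.

(** Solving for [y] shows a countable union, over [k], of affine preimages of the compact set
    [Et]. *)
Lemma measurable_lifted_set (c : R) (m : nat) (Et : set R) : 0 < c -> (0 < m)%N ->
  compact Et -> measurable (lifted_set c m Et : set TR).
Proof.
move=> c0 m0 cE; apply: measurableI; last exact: measurable_itv.
have mE : measurable (Et : set TR) by exact: compact_measurable.
have m0R : 0 < m%:R :> R by rewrite ltr0n.
have L0 : 0 < 2 * c / m%:R by rewrite divr_gt0// mulr_gt0.
have -> : [set x | exists2 y, Et y & exists k : int, x = 2 * c / m%:R * (y + k%:~R)] =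
    \bigcup_(k in [set: int]) [set x : R | Et (x / (2 * c / m%:R) - k%:~R)].
  apply/seteqP; split => x /=.
    move=> [y Ey [k ->]]; exists k => //=.
    by rewrite [2 * c / _ * _]mulrC mulfK ?gt_eqF// addrK.
  move=> [k _ Ex]; exists (x / (2 * c / m%:R) - k%:~R) => //; exists k.
  by rewrite subrK mulrC divfK// gt_eqF.
apply: countable_bigcupT_measurable => // k.
rewrite -[X in measurable X]setTI.
have mf : measurable_fun [set: TR] (fun x : R => x / (2 * c / m%:R) - k%:~R : TR).
  apply: continuous_measurable_fun => x; apply: (@cvgB _ R^o); last exact: cvg_cst.
  by apply: cvgMl; exact: cvg_id.
exact: (mf mT Et mE).
Qed.

Section flow.
Variables (c kappa : R) (m : nat) (phi f fhat : R -> R[i]%C) (ft : R -> R -> R[i]%C).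
Hypotheses (c0 : 0 < c) (m2 : (2 <= m)%N) (k01 : 0 < kappa < 1)
  (iphi : cintegrable phi) (kb : kernel_bound c phi kappa)
  (Pf : PW c f) (ff : is_fourier2 f fhat) (flow : is_flow c phi fhat ft).
Local Notation L := (2 * c / m%:R).
Local Notation D := (`[- c, c]%classic : set TR).
Local Notation I := (`[- c, - c + L]%classic : set TR).

(** The factor [1 / (2 * pi)] of Fourier inversion is absorbed here, and produces the [pi ^+ 2] of
    both final constants. *)
Let al (x : R) : R := (2 * pi)^-1 * Ref fhat x.
Let be (x : R) : R := (2 * pi)^-1 * Imf fhat x.
Let lam := symbol phi.

Let pi0 : 0 < pi :> R. Proof. exact: pi_gt0. Qed.
Let p20 : 0 < 2 * pi :> R. Proof. exact: mulr_gt0. Qed.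
Let m0 : (0 < m)%N. Proof. exact: ltn_trans m2. Qed.
Let m0R : 0 < m%:R :> R. Proof. by rewrite ltr0n. Qed.
Let mD : measurable D. Proof. exact: measurable_itv. Qed.
Let L0 := fold_length_gt0 c0 m2.
Let mI : measurable I. Proof. exact: measurable_itv. Qed.
Let Ioo : (mu I < +oo)%E. Proof. by rewrite lebesgue_measure_period// ltry. Qed.

Let lam01 (x : R) : `|x| <= c -> kappa <= lam x <= 1.
Proof. by move=> xc; have [] := kernel_bound_symbol kb xc. Qed.

Let mlam : measurable_fun [set: TR] lam. Proof. exact: measurable_symbol. Qed.

Let Lfhat : L2 fhat. Proof. by have [] := ff. Qed.

Let mal : measurable_fun [set: TR] al.
Proof. by have [? _ _ _] := L2_integrable Lfhat; exact: measurable_funM. Qed.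

Let mbe : measurable_fun [set: TR] be.
Proof. by have [_ ? _ _] := L2_integrable Lfhat; exact: measurable_funM. Qed.

Let ial : mu.-integrable D (EFin \o (fun x => al x ^+ 2)).
Proof.
have [_ _ ir _] := L2_integrable Lfhat.
apply: (@integrableS _ _ _ _ setT) => //.
apply: (eq_Rintegrable mT _ (RintegrableZl mT ((2 * pi)^-1 ^+ 2) ir)) => x _.
by rewrite /al exprMn.
Qed.

Let ibe : mu.-integrable D (EFin \o (fun x => be x ^+ 2)).
Proof.
have [_ _ _ ii] := L2_integrable Lfhat.
apply: (@integrableS _ _ _ _ setT) => //.
apply: (eq_Rintegrable mT _ (RintegrableZl mT ((2 * pi)^-1 ^+ 2) ii)) => x _.
by rewrite /be exprMn.
Qed.

Lemma PW_fourier_support : {ae mu, forall y : TR, ~ (`|y : R| <= c) -> fhat y = 0}.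
Proof.
have [_ _ [g fg g0]] := Pf; have gf := is_fourier2_unique fg ff.
have h : {ae mu, forall y : TR, (~ (`|y : R| <= c) -> g y = 0) /\ g y = fhat y} by exact: filterI.
by apply: filterS h => y [h <-].
Qed.

Let Doo : (mu D < +oo)%E.
Proof. by rewrite lebesgue_measure_itv/=; case: ifP => _; rewrite -?EFinD ltry. Qed.

Lemma Rintegrable_flow_trig (g k : R -> R) (t : R) : 0 <= t ->
  measurable_fun [set: TR] g -> mu.-integrable D (EFin \o (fun x => g x ^+ 2)) ->
  measurable_fun [set: TR] k -> (forall x, `|k x| <= 1) ->
  mu.-integrable D (EFin \o (fun y => g y * flow_multiplier lam t y * k y)).
Proof.
move=> t0 mg ig mk k1.
have mM : measurable_fun [set: TR] (fun y : R => flow_multiplier lam t y).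
  exact: (measurableT_comp (measurable_flow_multiplier mlam) (pair2_measurable t)).
have ig1 := Rintegrable_sqr mD Doo (measurable_funTS mg) ig.
have igM : mu.-integrable D (EFin \o (fun y => g y * flow_multiplier lam t y)).
  apply: (RintegrableMb mD ig1 (h := flow_multiplier lam t) (M := 1)).
    exact: measurable_funTS.
  move=> y; rewrite /= in_itv/= -ler_norml => yc.
  by have /andP[h1 h2] := flow_multiplier01 lam01 t0 yc; rewrite ger0_norm.
exact: (RintegrableMb mD igM (measurable_funTS mk) (fun x _ => k1 x)).
Qed.

Lemma flow_sample (t x0 : R) : 0 <= t ->
  Ref (ft t) x0 = \int[mu]_(y in D)
    (al y * flow_multiplier lam t y * cos (x0 * y) -
     be y * flow_multiplier lam t y * sin (x0 * y)) /\
  Imf (ft t) x0 = \int[mu]_(y in D)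
    (be y * flow_multiplier lam t y * cos (x0 * y) +
     al y * flow_multiplier lam t y * sin (x0 * y)).
Proof.
move=> t0; have [[_ cf _] fg] := flow t0.
set g := (fun xi => fhat xi * _) in fg.
have g0 : {ae mu, forall y : TR, ~ (`|y : R| <= c) -> g y = 0}.
  by apply: filterS PW_fourier_support => y h /h; rewrite /g => ->; rewrite mul0r.
have gr y : D y -> Ref g y = 2 * pi * (al y * flow_multiplier lam t y) /\
    Imf g y = 2 * pi * (be y * flow_multiplier lam t y).
  rewrite /= in_itv/= -ler_norml => yc.
  have /andP[l0 _] := lam01 yc; have /andP[k0 _] := k01.
  have ly : 0 < lam y by exact: lt_le_trans l0.
  (* For a positive base [powR] is [expR] of [t * ln]; positivity comes from the lower bound
     [kappa]. *)
  have -> : flow_multiplier lam t y = complex.Re (fourier phi y) `^ t.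
    by rewrite /powR -/(symbol phi y) gt_eqF.
  rewrite /al /be !mulrA divff ?gt_eqF// !mul1r /g /Ref /Imf.
  by case: (fhat y) => a b /=; split; ring.
have [h1 h2] := fourier_inversion x0 c0 cf fg g0.
have mc := measurable_cos1 x0; have ms := measurable_sin1 x0.
have iac := Rintegrable_flow_trig t0 mal ial mc (fun x => cos_max _).
have ias := Rintegrable_flow_trig t0 mal ial ms (fun x => sin_max _).
have ibc := Rintegrable_flow_trig t0 mbe ibe mc (fun x => cos_max _).
have ibs := Rintegrable_flow_trig t0 mbe ibe ms (fun x => sin_max _).
have pn : 2 * pi != 0 :> R by rewrite gt_eqF.
split; apply: (mulfI pn); rewrite -RintegralZl//.
- rewrite h1; apply: eq_Rintegral => y; rewrite inE => Dy.
  by have [-> ->] := gr y Dy; ring.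
- exact: RintegrableB.
- rewrite h2; apply: eq_Rintegral => y; rewrite inE => Dy.
  by have [-> ->] := gr y Dy; ring.
- exact: RintegrableD.
Qed.

(** At the sampling points, a shift by [j * L] changes the phase by a multiple of [2 * pi]. The [m]
    folds thus share one trigonometric factor, and a sample sees only their sum. *)
Lemma sample_phase (k : int) (j : nat) (u : R) :
  m%:R * pi / c * k%:~R * (u + j%:R * L) =
  k%:~R * (2 * pi / L * u) + (k * j%:Z)%:~R * (2 * pi).
Proof.
rewrite intrM -pmulrn; move: (pi : R) => P.
by field; rewrite !gt_eqF.
Qed.

Lemma flow_sample_energy (t : R) : 0 <= t ->
  \esum_(k in [set: int])
    (Normc.normc (ft t (m%:R * pi / c * k%:~R)) ^+ 2)%:E =
  (flow_energy c m al be lam t)%:E.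
Proof.
move=> t0.
pose A := folded c m lam al t; pose B := folded c m lam be t.
have mA : measurable_fun I A by apply: measurable_funTS; exact: measurable_folded.
have mB : measurable_fun I B by apply: measurable_funTS; exact: measurable_folded.
have iA : mu.-integrable I (EFin \o (fun u => A u ^+ 2)).
  exact: (Rintegrable_folded_sqr c0 m2 mlam lam01 t0 mal ial).
have iB : mu.-integrable I (EFin \o (fun u => B u ^+ 2)).
  exact: (Rintegrable_folded_sqr c0 m2 mlam lam01 t0 mbe ibe).
rewrite /flow_energy -(complex_parseval (a := - c) L0 mA mB iA iB).
apply: eq_esum => k _; congr (_%:E).
rewrite sqr_normc; set x0 := m%:R * pi / c * k%:~R.
have [] := flow_sample x0 t0; rewrite /Ref /Imf => -> ->.
have mc := measurable_cos1 x0; have ms := measurable_sin1 x0.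
have iac := Rintegrable_flow_trig t0 mal ial mc (fun x => cos_max _).
have ias := Rintegrable_flow_trig t0 mal ial ms (fun x => sin_max _).
have ibc := Rintegrable_flow_trig t0 mbe ibe mc (fun x => cos_max _).
have ibs := Rintegrable_flow_trig t0 mbe ibe ms (fun x => sin_max _).
have iA1 := Rintegrable_sqr mI Ioo mA iA; have iB1 := Rintegrable_sqr mI Ioo mB iB.
have iAc := Rintegrable_cosM k iA1; have iAs := Rintegrable_sinM k iA1.
have iBc := Rintegrable_cosM k iB1; have iBs := Rintegrable_sinM k iB1.
congr (_ ^+ 2 + _ ^+ 2).
  rewrite -(fold_interval c m2) Rintegral_fold//; last first.
    by rewrite (fold_interval c m2); exact: RintegrableB.
  rewrite -RintegralB//; apply: eq_Rintegral => u _.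
  rewrite /A /B /folded !mulr_suml -sumrB; apply: eq_bigr => j _.
  by rewrite sample_phase cosD2piz sinD2piz.
rewrite -(fold_interval c m2) Rintegral_fold//; last first.
  by rewrite (fold_interval c m2); exact: RintegrableD.
rewrite -RintegralD//; apply: eq_Rintegral => u _.
rewrite /A /B /folded !mulr_suml -big_split/=; apply: eq_bigr => j _.
by rewrite sample_phase cosD2piz sinD2piz.
Qed.

Lemma sample_energyE : sample_energy c m ft =
  (\int[mu]_(t in `[0, 1]) flow_energy c m al be lam t)%:E.
Proof.
rewrite EFin_Rintegral//; last first.
  exact: (Rintegrable_flow_energy c0 m2 mal mbe mlam ial ibe lam01).
apply: eq_integral => t; rewrite inE/= in_itv/= => /andP[t0 _].
exact: flow_sample_energy.
Qed.

Let density x : al x ^+ 2 + be x ^+ 2 =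
  (4 * pi ^+ 2)^-1 * (Ref fhat x ^+ 2 + Imf fhat x ^+ 2).
Proof.
rewrite /al /be; move: (pi : R) pi0 => P P0.
by field; rewrite gt_eqF.
Qed.

Let i2 : mu.-integrable [set: TR] (EFin \o (fun x => Ref fhat x ^+ 2 + Imf fhat x ^+ 2)).
Proof. by have [_ _ ir ii] := L2_integrable Lfhat; exact: RintegrableD. Qed.

Lemma sample_energy_upper :
  (sample_energy c m ft <= (c / (2 * pi ^+ 2))%:E * norm2 fhat ^+ 2)%E.
Proof.
rewrite sample_energyE norm2_sqr -EFin_Rintegral// -EFinM lee_fin.
apply: (le_trans (Rintegral_flow_energy_le c0 m2 mal mbe mlam ial ibe lam01)).
under eq_Rintegral do rewrite density.
have i2D : mu.-integrable D (EFin \o (fun x => Ref fhat x ^+ 2 + Imf fhat x ^+ 2)).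
  by apply: (@integrableS _ _ _ _ setT).
rewrite RintegralZl// mulrA.
have -> : 2 * c * (4 * pi ^+ 2)^-1 = c / (2 * pi ^+ 2).
  by move: (pi : R) pi0 => P P0; field; rewrite gt_eqF.
rewrite ler_wpM2l ?divr_ge0 ?mulr_ge0 ?exprn_ge0 ?(ltW c0) ?(ltW pi0)//.
rewrite -lee_fin !EFin_Rintegral//; apply: ge0_subset_integral => //.
  by apply/measurable_EFinP; exact: Rintegrable_measurable i2.
by move=> x _; rewrite lee_fin addr_ge0 ?sqr_ge0.
Qed.

Lemma sample_energy_lower (Et : set R) (delta : R) : compact Et -> 0 < delta ->
  (forall j k : nat, (j < k <= m - 1)%N -> forall xi : R, Et xi ->
     delta <= Normc.normc (phat_p c phi (2 * c / m%:R * (xi + j%:R))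
                                  - phat_p c phi (2 * c / m%:R * (xi + k%:R)))) ->
  ((c / (4 * expR 1 * pi ^+ 2)
           * (delta ^+ (m * (m - 1)) / m%:R ^+ (1 + m ^ 2))
           * ((kappa `^ (2 / m%:R) - 1) / ln kappa))%:E *
     norm2 (restr (lifted_set c m Et) fhat) ^+ 2 <= sample_energy c m ft)%E.
Proof.
move=> cE d0 sep.
have mE := measurable_lifted_set c0 m0 cE; set E := lifted_set c m Et in mE *.
have spE (u : R) (j0 : 'I_m) : - c <= u < - c + L -> E (u + j0%:R * L) ->
  forall j k : 'I_m, j != k -> delta <= `|lam (u + j%:R * L) - lam (u + k%:R * L)|.
  by move=> uI Ej0; apply: (symbol_separation c0 kb m0 sep uI (ltn_ord j0)).
have low := Rintegral_flow_energy_ge c0 m2 k01 mal mbe mlam ial ibe lam01 mE d0 spE.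
rewrite sample_energyE norm2_sqr.
pose h x := (Ref fhat x ^+ 2 + Imf fhat x ^+ 2) * \1_E x : R.
have ih : mu.-integrable [set: TR] (EFin \o h).
  apply: (RintegrableMb mT i2 (h := \1_E) (M := 1)); first exact: measurable_indic.
  by move=> x _; rewrite indicE; case: (_ \in _); rewrite ?normr1 ?normr0.
have ihD : mu.-integrable D (EFin \o h) by apply: (@integrableS _ _ _ _ setT).
(* [E] is contained in [[-c, c]], so the integral over the line reduces to [D]. *)
have -> : (\int[mu]_x (Ref (restr E fhat) x ^+ 2 + Imf (restr E fhat) x ^+ 2)%:E =
    (\int[mu]_(x in D) h x)%:E)%E.
  rewrite Rintegral_mkcond EFin_Rintegral//.
    apply: eq_integral => x _; rewrite patchE; case: ifPn => xD.
      rewrite /h /restr /Ref /Imf indicE; case: (fhat x) => a b; congr (_%:E).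
      by case: (_ \in _) => /=; ring.
    rewrite /restr /Ref /Imf indicE memNset; last first.
      by move=> [_ Dx]; move: xD; rewrite mem_set.
    by case: (fhat x) => a b /=; rewrite !mulr0 subrr addr0 expr0n addr0.
  apply: (eq_Rintegrable mT _ ih) => x _; rewrite patchE; case: ifPn => // xD.
  rewrite /h indicE memNset ?mulr0//.
  by move=> [_ Dx]; move: xD; rewrite mem_set.
have JE : \int[mu]_(x in D) ((al x ^+ 2 + be x ^+ 2) * \1_E x) =
    (4 * pi ^+ 2)^-1 * \int[mu]_(x in D) h x.
  by rewrite -RintegralZl//; apply: eq_Rintegral => x _; rewrite density /h mulrA.
rewrite JE in low; rewrite -EFinM lee_fin; apply: le_trans low.
(* The constants agree exactly: [L = 2 * c / m] supplies the extra [m] in [m ^+ (1 + m ^ 2)], and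
   [2 * ln kappa] and [4 * pi ^ 2] account for the rest. *)
rewrite [leRHS]mulrA le_eqVlt; apply/predU1P; left; congr (_ * _).
rewrite exprD expr1.
have /andP[k0 k1] := k01.
have lk : ln kappa != 0 by rewrite lt_eqF// ln_lt0// k0.
move: (kappa `^ (2 / m%:R)) (ln kappa) lk => K l l0.
have e0 : expR 1 != 0 :> R by rewrite gt_eqF// expR_gt0.
move: (expR 1) e0 (delta ^+ _) => e e0 d.
have M0 : m%:R ^+ (m ^ 2) != 0 :> R by rewrite gt_eqF// exprn_gt0.
move: (m%:R ^+ (m ^ 2)) M0 => M M0.
move: (pi : R) pi0 => P P0.
by field; rewrite ?e0 ?M0 ?l0 ?gt_eqF.
Qed.

End flow.
End SampleEnergy.

Theorem theorem2p8 (R : realType) (c : R) (phi : R -> R[i]%C) (kappa : R)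
    (m : nat) (Et : set R) (delta : R) :
  0 < c ->
  Phi c phi -> 0 < kappa < 1 -> kernel_bound c phi kappa ->
  (2 <= m)%N ->
  compact Et -> Et `<=` `[0, 1] ->
  0 < delta ->
  (forall j k : nat, (j < k <= m - 1)%N -> forall xi : R, Et xi ->
     delta <= Normc.normc (phat_p c phi (2 * c / m%:R * (xi + j%:R))
                                  - phat_p c phi (2 * c / m%:R * (xi + k%:R)))) ->
  let E := lifted_set c m Et in
  let A := c / (4 * expR 1 * pi ^+ 2)
           * (delta ^+ (m * (m - 1)) / m%:R ^+ (1 + m ^ 2))
           * ((kappa `^ (2 / m%:R) - 1) / ln kappa) in
  stably_recoverable c m phi E /\
  forall (f fhat : R -> R[i]%C) (ft : R -> R -> R[i]%C),
    PW c f -> is_fourier2 f fhat -> is_flow c phi fhat ft ->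
    (A%:E * norm2 (restr E fhat) ^+ 2 <= sample_energy c m ft)%E /\
    (sample_energy c m ft <= (c / (2 * pi ^+ 2))%:E * norm2 fhat ^+ 2)%E.
Proof.
move=> c0 [iphi _ _] k01 kb m2 cE _ d0 sep E A.
have low f fhat ft : PW c f -> is_fourier2 f fhat -> is_flow c phi fhat ft ->
    (A%:E * norm2 (restr E fhat) ^+ 2 <= sample_energy c m ft)%E.
  by move=> Pf ff fl; exact: (sample_energy_lower c0 m2 k01 iphi kb Pf ff fl cE d0 sep).
split; last first.
  move=> f fhat ft Pf ff fl; split; first exact: (low f).
  exact: (sample_energy_upper c0 m2 k01 iphi kb Pf ff fl).
exists A => //.
(* Positivity of [A]: both [kappa ^ (2 / m) - 1] and [ln kappa] are negative, so their quotient is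
   positive. *)
have /andP[k0 k1] := k01.
have m0 : 0 < m%:R :> R by rewrite ltr0n; exact: ltn_trans m2.
have l0 : ln kappa < 0 by rewrite ln_lt0// k0.
have K1 : kappa `^ (2 / m%:R) < 1.
  by rewrite /powR gt_eqF// expR_lt1 pmulr_rlt0// divr_gt0.
apply: mulr_gt0; last by rewrite nmulr_rgt0 ?invr_lt0 ?subr_lt0.
apply: mulr_gt0; last by rewrite divr_gt0 ?exprn_gt0.
by rewrite divr_gt0 ?mulr_gt0 ?exprn_gt0 ?expR_gt0 ?pi_gt0.
Qed.
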